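(* There exist absolute constants $\delta>0$ and $C<\infty$ such that for every finite field $\mathbb{F}$ in which $-1$ is not a square, the extension constant of the $3$-dimensional paraboloid $\mathcal{P}=\{(\omega,\omega\cdot\omega):\omega\in\mathbb{F}_*^2\}\subset\mathbb{F}_*^3$ satisfies $$\mathcal{R}^{*}\Big(2\rightarrow \tfrac{18}{5}-\delta\Big)\le C.$$
   Context: Let $\mathbb{F}$ be a finite field, $e(\cdot)$ a fixed non-principal additive character of $\mathbb{F}$, and $x\cdot\xi=\sum_i x_i\xi_i$. The space $\mathbb{F}^n$ carries counting measure $dx$; $\mathbb{F}_*^n$ denotes its (isomorphic) dual. Norms: $\|f\|_{L^q(\mathbb{F}^n,dx)}=(\sum_{x\in\mathbb{F}^n}|f(x)|^q)^{1/q}$. For nonempty $S\subset\mathbb{F}_*^n$, $d\sigma$ is the measure assigning mass $|S|^{-1}$ to each point of $S$, so $\|g\|_{L^p(S,d\sigma)}=(|S|^{-1}\sum_{\xi\in S}|g(\xi)|^p)^{1/p}$, and $(g\,d\sigma)^\vee(x)=|S|^{-1}\sum_{\xi\in S}g(\xi)e(x\cdot\xi)$ for $x\in\mathbb{F}^n$. For $1\le p,q\le\infty$, $\mathcal{R}^*(p\to q)$ is the best constant such that $\|(g\,d\sigma)^\vee\|_{L^q(\mathbb{F}^n,dx)}\le\mathcal{R}^*(p\to q)\|g\|_{L^p(S,d\sigma)}$ for all $g:S\to\mathbb{C}$. Here $n=3$ and $S=\mathcal{P}$. *)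

(* Defs.v *)
From HB Require Import structures.
From mathcomp Require Import all_boot all_order all_algebra.
From mathcomp Require Import complex.
From mathcomp Require Import all_classical all_reals ereal exp.

Set Implicit Arguments.
Unset Strict Implicit.
Unset Printing Implicit Defensive.

Import Order.TTheory GRing.Theory Num.Theory.

Local Open Scope classical_set_scope.
Local Open Scope ring_scope.
Local Open Scope complex_scope.

Definition additive_character (R : realType) (F : finFieldType)
    (e : F -> R[i]) : Prop :=
  (forall a, `|e a| = 1) /\ {morph e : a b / a + b >-> a * b}.

Definition nonprincipal_character (R : realType) (F : finFieldType)
    (e : F -> R[i]) : Prop :=
  additive_character e /\ exists a, e a <> 1.

Definition dot (F : finFieldType) (n : nat) (x y : 'rV[F]_n) : F :=
  \sum_(i < n) x 0 i * y 0 i.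

(* The L^p norm for the measure that gives mass w > 0 to each point of A;
   [normc] is the modulus as an element of R. The -oo branch is never used. *)
Definition wnorm (R : realType) (T : finType) (w : R) (A : {set T})
    (p : \bar R) (f : T -> R[i]) : R :=
  match p with
  | r%:E => (w * \sum_(x in A) (Normc.normc (f x)) `^ r) `^ r^-1
  | +oo%E => \big[Num.max/0]_(x in A) Normc.normc (f x)
  | -oo%E => 0
  end.

Definition Lq_norm (R : realType) (F : finFieldType) (n : nat)
    (q : \bar R) (f : 'rV[F]_n -> R[i]) : R :=
  wnorm 1 [set: 'rV[F]_n]%SET q f.

(* A function S -> C is represented by a function on the whole (dual) space
   whose values outside S are ignored. *)
Definition Lp_norm_on (R : realType) (F : finFieldType) (n : nat)
    (S : {set 'rV[F]_n}) (p : \bar R) (g : 'rV[F]_n -> R[i]) : R :=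
  wnorm #|S|%:R^-1 S p g.

Definition extension (R : realType) (F : finFieldType) (n : nat)
    (e : F -> R[i]) (S : {set 'rV[F]_n}) (g : 'rV[F]_n -> R[i])
    (x : 'rV[F]_n) : R[i] :=
  #|S|%:R^-1 * \sum_(xi in S) g xi * e (dot x xi).

(* The best constant R^*(p -> q), for S nonempty and 1 <= p, q <= +oo;
   it is +oo if no real constant works. *)
Definition extension_constant (R : realType) (F : finFieldType) (n : nat)
    (e : F -> R[i]) (S : {set 'rV[F]_n}) (p q : \bar R) : \bar R :=
  ereal_inf [set C%:E | C in [set C : R | forall g : 'rV[F]_n -> R[i],
    Lq_norm q (extension e S g) <= C * Lp_norm_on S p g]].

Definition paraboloid (F : finFieldType) (d : nat) : {set 'rV[F]_(d + 1)} :=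
  [set row_mx w (dot w w)%:M | w : 'rV[F]_d]%SET.

(* Main.v *)
(* By duality it is enough to bound the L^2 norm on the paraboloid of the
   Fourier transform of a function supported on a set E of size s in F^3, and a
   weak-type bound with exponent below 18/5 suffices because the strong bound
   may lose a little in the exponent.  Expanding the square, the contribution of
   each horizontal slice of E is controlled, after a pseudo-conformal change of
   variables, either trivially or by the additive energy of the slice lifted to
   the paraboloid (Mockenhaupt-Tao).  The trivial energy bound N^(5/2) gives the
   exponent 18/5, and it is lossless only when all slices have size about
   q^(4/5).

   For slices of that size the energy bound is improved by a power.  As -1 is
   not a square, the energy counts rectangles, hence incidences between N points
   and N lines x.y = 1.  If there were nearly N^(3/2) of them, projecting from a
   point to infinity would yield sets V, V' of size about n = N^(1/2) and about
   n dilation factors l for which V + l V' is small along a dense graph; by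
   Balog-Szemeredi-Gowers and the calculus of Ruzsa and Petridis, a set Y of size
   about n would be approximately invariant under dilation by a set T of size
   about n.  Then either (T - T) / (T - T) is a subfield of order about q^(2/5),
   which does not exist, or T + xi T has size n^2 for some xi and is still made of
   such dilation factors, of which there are at most about n.

   Losses are measured by powers of an integer K, and approximate structure is
   excluded in the form: n <= K ^ c for an absolute constant c. *)

Require Import Defs.
From HB Require Import structures.
From mathcomp Require Import all_boot all_order all_algebra.
From mathcomp Require Import complex.
From mathcomp Require Import zify ring lra.

Set Implicit Arguments.
Unset Strict Implicit.
Unset Printing Implicit Defensive.

Import Order.TTheory GRing.Theory Num.Theory.

(** Origin of the exponents: write [q = #|F|] and [s = #|E|]. After division by [q ^ 2], the
    off-diagonal part of the squared restriction norm is at most [s ^ 2 / q] trivially and about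
    [s ^ (11/8) * q ^ (1/8)] with the trivial energy bound. The two agree at [s = q ^ (9/5)], where
    both equal [s ^ (13/9)]; Cauchy-Schwarz halves this to [13/18 = 1 - 5/18], whence 18/5. So a
    gain is needed only for [s] near [q ^ (9/5)], when the average slice has size about [q ^ (4/5)].
    The integer [K] is tied to the field only at the end, as about [q ^ (1/c)]. A gain of a fixed
    power of [K] is then a gain of a fixed power of [s], because [s <= q ^ 3]. That -1 is not a
    square means that nonzero vectors of the plane have nonzero norm. This makes inversion
    [w / (w.w)] available at every nonzero [w], which turns right angles into incidences, and it
    allows any point lying on a line [x.y = 1] to be sent to infinity. *)

(** * Counting, Cauchy-Schwarz and pigeonhole for natural numbers *)

Lemma leq_card_dinj (T T' : finType) (S : {set T}) (S' : {set T'})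
    (g : T -> T') :
  {in S, forall x, g x \in S'} -> {in S &, injective g} -> #|S| <= #|S'|.
Proof.
move=> gS g_inj; rewrite -(card_in_imset g_inj) subset_leq_card //.
by apply/subsetP => _ /imsetP[x xS ->]; apply: gS.
Qed.

Lemma sum_nat_cauchy (I : Type) (r : seq I) (P : pred I) (a : I -> nat) :
  (\sum_(i <- r | P i) a i) ^ 2
    <= (\sum_(i <- r | P i) 1) * \sum_(i <- r | P i) a i ^ 2.
Proof.
rewrite -(@leq_pmul2l 2) // mulnA -mulnn.
rewrite big_distrlr /= big_distrr /=.
apply: (@leq_trans (\sum_(i <- r | P i) \sum_(j <- r | P j)
    (a i ^ 2 + a j ^ 2))).
  apply: leq_sum => i _; rewrite big_distrr /=; apply: leq_sum => j _.
  by rewrite nat_Cauchy.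
under eq_bigr => i _ do rewrite big_split /=.
rewrite big_split /= [X in _ + X]exchange_big /= addnn -mul2n.
rewrite -mulnA leq_mul2l /= [X in _ <= X]mulnC big_distrl /=.
apply: leq_sum => i _; rewrite big_distrr /=; apply: leq_sum => j _.
by rewrite muln1.
Qed.

Lemma sum_nat_cauchy_set (T : finType) (A : {set T}) (a : T -> nat) :
  (\sum_(i in A) a i) ^ 2 <= #|A| * \sum_(i in A) a i ^ 2.
Proof. by rewrite -sum1_card; apply: sum_nat_cauchy. Qed.

Lemma sum_nat_pigeon (T : finType) (A : {set T}) (a b : T -> nat) :
  0 < \sum_(i in A) a i -> \sum_(i in A) a i <= \sum_(i in A) b i ->
  exists2 i, i \in A & 0 < b i /\ a i <= b i.
Proof.
move=> a_gt0 le_ab.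
have [/exists_inP[i iA /andP[bi ai]]|nex] :=
  boolP [exists i in A, (0 < b i) && (a i <= b i)]; first by exists i.
(* If the conclusion fails at every index, [b] is below [a] everywhere, and strictly at some index
   because the sum of [a] is positive. *)
have bad i : i \in A -> b i <= a i /\ (0 < a i -> b i < a i).
  move=> iA; move: nex; rewrite negb_exists_in => /forall_inP /(_ i iA).
  by rewrite negb_and -leqNgt -ltnNge; lia.
have [i iA ai] : exists2 i, i \in A & 0 < a i.
  apply/exists_inP; apply: contraTT a_gt0.
  rewrite negb_exists_in -leqNgt leqn0 => /forall_inP a0.
  by rewrite big1 // => i /a0; case: (a i).
have := bad i iA => -[_ /(_ ai) lt_i].
suff: \sum_(i in A) b i < \sum_(i in A) a i by lia.
rewrite (bigD1 i) //= [X in _ < X](bigD1 i) //= -addSn leq_add //.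
by apply: leq_sum => j /andP[/bad[]].
Qed.

(** Cauchy-Schwarz over the fibres of [f]: their sizes sum to [#|A|] and the squares of their sizes
    count the colliding pairs. *)
Lemma card_collisions (T T' : finType) (A : {set T}) (f : T -> T') :
  #|A| ^ 2 <= #|f @: A| * #|[set p in setX A A | f p.1 == f p.2]|.
Proof.
rewrite -sum1_card.
rewrite (partition_big_imset f) /=.
apply: leq_trans (sum_nat_cauchy_set _ _) _; rewrite leq_mul2l; apply/orP; right.
rewrite -sum1_card.
rewrite (partition_big (fun p => f p.1) (mem (f @: A))) /=; last first.
  by move=> [u v]; rewrite inE => /andP[/setXP[uA _] _]; apply: imset_f.
apply: leq_sum => y _; rewrite !sum1_card -mulnn.
rewrite -[X in X * _]cardsE -[X in _ * X]cardsE -cardsX.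
rewrite -[X in _ <= X]cardsE; apply: subset_leq_card.
apply/subsetP => -[u v] /setXP[].
rewrite !inE => /andP[uA /eqP fu] /andP[vA /eqP fv]; apply/andP; split.
  by rewrite inE in_setX uA vA /= fu fv.
by rewrite /= fu.
Qed.

(** * Sumset calculus in finite abelian groups *)

Definition sumset (V : finZmodType) (A B : {set V}) : {set V} :=
  [set (x + y)%R | x in A, y in B].

Definition oppset (V : finZmodType) (A : {set V}) : {set V} :=
  [set (- x)%R | x in A].

Definition dilate (F : finFieldType) (t : F) (A : {set F}) : {set F} :=
  [set (t * x)%R | x in A].

Fixpoint itersum (V : finZmodType) (A : {set V}) (j : nat) : {set V} :=
  if j is j'.+1 then sumset A (itersum A j') else [set 0%R].

Local Notation "A |+| B" := (sumset A B) (at level 50, left associativity).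
Local Notation "|-| A" := (oppset A) (at level 35, right associativity).
Local Notation "t |*| A" := (dilate t A) (at level 40, left associativity).

Section Sumsets.
Variable V : finZmodType.
Implicit Types A B C D X Y Z : {set V}.

Lemma mem_sumset A B x y : x \in A -> y \in B -> (x + y)%R \in A |+| B.
Proof. exact: imset2_f. Qed.

Lemma sumsetP A B z :
  reflect (exists x y, [/\ x \in A, y \in B & z = (x + y)%R]) (z \in A |+| B).
Proof.
apply: (iffP imset2P) => [[x y ? ? ->]|[x [y [? ? ->]]]]; last by exists x y.
by exists x, y.
Qed.

Lemma mem_oppset A x : ((- x)%R \in |-| A) = (x \in A).
Proof.
apply/imsetP/idP => [[y yA /oppr_inj ->] // | xA]; by exists x.
Qed.

Lemma mem_oppsetN A x : (x \in |-| A) = ((- x)%R \in A).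
Proof. by rewrite -{1}(opprK x) mem_oppset. Qed.

Lemma sumsetC A B : A |+| B = B |+| A.
Proof.
by apply/setP => z; apply/sumsetP/sumsetP => -[x [y [? ? ->]]];
  exists y, x; rewrite addrC.
Qed.

Lemma sumsetA A B C : A |+| (B |+| C) = A |+| B |+| C.
Proof.
apply/setP => z; apply/sumsetP/sumsetP.
  case=> x [_ [xA /sumsetP[y [w [yB wC ->]]] ->]].
  by exists (x + y)%R, w; rewrite mem_sumset // addrA.
case=> _ [w [/sumsetP[x [y [xA yB ->]]] wC ->]].
by exists x, (y + w)%R; rewrite mem_sumset // addrA.
Qed.

Lemma sumsetACA A B C D : A |+| B |+| (C |+| D) = A |+| C |+| (B |+| D).
Proof. by rewrite !sumsetA -(sumsetA A B C) (sumsetC B C) !sumsetA. Qed.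

Lemma sumset0 A : A |+| [set 0%R] = A.
Proof.
apply/setP => z; apply/sumsetP/idP => [[x [y [xA /set1P -> ->]]]|zA].
  by rewrite addr0.
by exists z, 0%R; rewrite set11 addr0.
Qed.

Lemma sumsetS A B C D : A \subset C -> B \subset D -> A |+| B \subset C |+| D.
Proof.
move=> /subsetP AC /subsetP BD; apply/subsetP => _ /sumsetP[x [y [xA yB ->]]].
by rewrite mem_sumset ?AC ?BD.
Qed.

Lemma oppset_sum A B : |-| (A |+| B) = |-| A |+| |-| B.
Proof.
apply/setP => z; rewrite mem_oppsetN; apply/sumsetP/sumsetP.
  move=> [x [y [xA yB e]]]; exists (- x)%R, (- y)%R.
  by rewrite !mem_oppset -opprD -e opprK.
move=> [x [y [xA yB ->]]]; exists (- x)%R, (- y)%R.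
by rewrite -!mem_oppsetN opprD.
Qed.

Lemma oppsetK A : |-| |-| A = A.
Proof. by apply/setP => z; rewrite !mem_oppsetN opprK. Qed.

Lemma card_oppset A : #|oppset A| = #|A|.
Proof. by rewrite card_imset //; apply: oppr_inj. Qed.

Lemma oppset0 : |-| [set 0%R] = [set 0%R] :> {set V}.
Proof. by rewrite /oppset imset_set1 oppr0. Qed.

Lemma card_sumset1 A x : #|A |+| [set x]| = #|A|.
Proof.
rewrite -(card_imset (mem A) (addIr x)); apply: eq_card => z.
apply/sumsetP/imsetP => [[a [y [aA /set1P -> ->]]]|[a aA ->]].
  by exists a.
by exists a, x; rewrite set11.
Qed.

Lemma card_sumset_le A B : #|A |+| B| <= #|A| * #|B|.
Proof. by rewrite /sumset curry_imset2X -cardsX leq_imset_card. Qed.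

Lemma card_sumsetN A B : #|sumset (oppset A) (oppset B)| = #|A |+| B|.
Proof. by rewrite -oppset_sum card_oppset. Qed.

(** Fix one representation [d = a - c] of each difference and send [(d, b)] to [(a - b, b - c)]. The
    sum of the two entries recovers [d], hence [a], hence [b]. *)
Lemma ruzsa_triangle A B C :
  #|A |+| |-| C| * #|B| <= #|A |+| |-| B| * #|B |+| |-| C|.
Proof.
pose f d := odflt (0%R, 0%R) [pick p in setX A C | (p.1 - p.2)%R == d].
have fP d : d \in A |+| |-| C ->
    [/\ (f d).1 \in A, (f d).2 \in C & ((f d).1 - (f d).2)%R = d].
  case/sumsetP=> x [y [xA]]; rewrite mem_oppsetN => yC ->; rewrite /f.
  case: pickP => [[u v] /andP[/setXP[uA vC] /eqP uv] //|/(_ (x, - y)%R)].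
  by rewrite in_setX xA yC /= opprK eqxx.
rewrite -!cardsX.
apply: (@leq_card_dinj _ _ _ _
    (fun p => ((f p.1).1 - p.2, p.2 - (f p.1).2)%R)).
  move=> [d b] /setXP[/fP[f1 f2 _] bB] /=.
  by rewrite in_setX !mem_sumset // mem_oppset.
move=> [d b] [d' b'] /setXP[/fP[_ _ e] _] /setXP[/fP[_ _ e'] _] /= [e1 e2].
have ed : d = d'.
  by rewrite -e -e' -[LHS](subrKA b) e1 e2 subrKA.
by move: e1; rewrite ed => /addrI/oppr_inj ->.
Qed.

Lemma ruzsa_triangle_add A B C :
  #|A |+| |-| C| * #|B| <= #|A |+| B| * #|B |+| C|.
Proof.
have := ruzsa_triangle A (|-| B) C.
by rewrite oppsetK card_sumsetN card_oppset.
Qed.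

Lemma sumsetU A B C : A |+| (B :|: C) = (A |+| B) :|: (A |+| C).
Proof.
apply/setP => z; rewrite inE; apply/sumsetP/orP.
  case=> x [y [xA /setUP[yB|yC] ->]]; [left|right]; exact: mem_sumset.
by case=> /sumsetP[x [y [xA yB ->]]]; exists x, y; rewrite inE yB ?orbT.
Qed.

(* Petridis's lemma: [X] is a minimiser of [#|X |+| B| / #|X|]. *)
Lemma petridis X B :
  (forall Z, Z \subset X -> #|X |+| B| * #|Z| <= #|Z |+| B| * #|X|) ->
  forall C, #|X |+| B |+| C| * #|X| <= #|X |+| B| * #|X |+| C|.
Proof.
move=> minX D; have [m] := ubnP #|D|.
elim: m D => // m IHm D; have [-> _|[c cD] Dm] := set_0Vmem D.
  have -> : X |+| B |+| set0 = set0.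
    by apply/setP => z; rewrite inE; apply/sumsetP => -[x [y []]]; rewrite inE.
  by rewrite cards0.
have [C [cC -> /IHm IH]] : exists C, [/\ c \notin C, D = c |: C & #|C| < m].
  exists (D :\ c); rewrite setD11 setD1K //; split=> //.
  by move: Dm; rewrite (cardsD1 c) cD.
(* Adjoining [c] to [C] enlarges [X |+| C] by exactly [#|X| - #|Z|], and enlarges [X |+| B |+| C] by
   at most [#|X |+| B| - #|Z |+| B|], since the translate of [Z |+| B] by [c] is already there.
   Minimality of [X], tested on [Z], compares the two increments. *)
pose Z := [set x in X | (x + c)%R \in X |+| C].
have ZX : Z \subset X by apply/subsetP => x; rewrite inE => /andP[].
have eX : #|X |+| (c |: C)| = #|X |+| C| + (#|X| - #|Z|).
  rewrite setUC sumsetU cardsU -addnBA; last by rewrite subset_leq_card // subsetIr.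
  rewrite card_sumset1; congr (_ + (_ - _)).
  rewrite -(card_sumset1 Z c); apply: eq_card => z; rewrite inE.
  apply/andP/sumsetP => [[zC /sumsetP[x [y [xX /set1P -> e]]]]|].
    by exists x, c; rewrite set11 inE xX -e zC.
  case=> x [y [+ /set1P -> ->]]; rewrite inE => /andP[xX ->].
  by rewrite mem_sumset ?set11.
have eXB : #|X |+| B |+| (c |: C)| <= #|X |+| B |+| C| + (#|X |+| B| - #|Z |+| B|).
  rewrite setUC sumsetU.
  rewrite -[#|Z |+| B|](card_sumset1 _ c) -[#|X |+| B|](card_sumset1 _ c).
  rewrite cardsU -addnBA; last by rewrite subset_leq_card // subsetIr.
  rewrite leq_add2l leq_sub2l // subset_leq_card //.
  apply/subsetP => _ /sumsetP[_ [y [/sumsetP[x [b [xZ bB ->]]] /set1P -> ->]]].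
  move: xZ; rewrite inE => /andP[xX xc]; rewrite inE; apply/andP; split.
    rewrite addrAC -sumsetA (sumsetC B) sumsetA; exact: mem_sumset.
  by rewrite !mem_sumset ?set11.
rewrite eX; apply: (@leq_trans
  ((#|X |+| B |+| C| + (#|X |+| B| - #|Z |+| B|)) * #|X|)).
  by rewrite leq_mul2r eXB orbT.
rewrite mulnDl mulnDr leq_add // mulnBl mulnBr leq_sub2l //.
exact: minX.
Qed.

(** Ratios are compared by cross multiplication. This comparison is transitive on nonempty sets and
    total, so a minimiser is found by running through the list of nonempty subsets of [Y]. *)
Lemma exists_petridis Y B : Y != set0 ->
  exists X, [/\ X != set0, X \subset Y, #|X |+| B| * #|Y| <= #|Y |+| B| * #|X|
    & forall C, #|X |+| B |+| C| * #|X| <= #|X |+| B| * #|X |+| C|].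
Proof.
move=> Y0.
pose P X := (X != set0) && (X \subset Y).
pose r X Z := #|X |+| B| * #|Z| <= #|Z |+| B| * #|X|.
have r_trans : {in P & &, transitive r}.
  move=> X Z W /andP[X0 _] /andP[Z0 _] /andP[W0 _]; rewrite /r => h1 h2.
  have Xp : 0 < #|X| by rewrite card_gt0.
  rewrite -(leq_pmul2r Xp) mulnAC.
  apply: (@leq_trans (#|X |+| B| * #|Z| * #|W|)); first by rewrite leq_mul2r h1 orbT.
  by rewrite mulnAC [X in _ <= X]mulnAC leq_mul2r h2 orbT.
have [X /andP[X0 XY] Xmin] : exists2 X, P X & forall Z, P Z -> r X Z.
  suff: forall s : seq {set V}, all P s -> s != [::] ->
      exists2 X, P X & {in s, forall Z, r X Z}.
    move=> /(_ (enum P)) []; first by apply/allP => X; rewrite mem_enum.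
      by rewrite -size_eq0 -cardE -lt0n; apply/card_gt0P; exists Y; rewrite /in_mem /= /P Y0 /=.
    by move=> X PX h; exists X => // Z PZ; apply: h; rewrite mem_enum.
  elim=> [//|W s IH] /= /andP[PW Ps] _.
  have [->|s0] := eqVneq s [::].
    by exists W => // Z; rewrite inE => /eqP ->; rewrite /r.
  have [X PX h] := IH Ps s0.
  case: (leqP (#|X |+| B| * #|W|) (#|W |+| B| * #|X|)) => [le|/ltnW le].
    by exists X => // Z; rewrite inE => /predU1P[->|/h].
  exists W => // Z; rewrite inE => /predU1P[->|Zs]; first by rewrite /r.
  apply: (r_trans X) => //; [exact: (allP Ps)|exact: h].
exists X; split=> //; first by apply: Xmin; rewrite /P Y0 /=.
apply: petridis => Z ZX; have [->|Z0] := eqVneq Z set0.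
  by rewrite cards0 muln0.
by apply: Xmin; rewrite /P Z0 (subset_trans ZX).
Qed.

Lemma itersum_opp Y j : |-| itersum Y j = itersum (|-| Y) j.
Proof. by elim: j => [|j IH] /=; rewrite ?oppset0 // oppset_sum IH. Qed.

Lemma itersum_diff Y j : itersum (Y |+| |-| Y) j = itersum Y j |+| |-| itersum Y j.
Proof.
elim: j => [|j IH] /=; first by rewrite oppset0 sumset0.
by rewrite IH oppset_sum sumsetACA.
Qed.

Lemma itersumD A i j : itersum A (i + j) = itersum A i |+| itersum A j.
Proof.
elim: i => [|i IH] /=; first by rewrite sumsetC sumset0.
by rewrite IH sumsetA.
Qed.

(** Petridis's lemma with [B = |-| Y] bounds [X] minus [i] copies of [Y] by induction on [i]. The
    iterated difference set is [jY - jY], so the triangle inequality through [X] finishes. *)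
Lemma plunnecke_diff Y K j : Y != set0 -> #|Y |+| |-| Y| <= K * #|Y| ->
  #|itersum (Y |+| |-| Y) j| <= K ^ (j + j) * #|Y|.
Proof.
move=> Y0 small.
have [X [X0 XY Xs Xpet]] := exists_petridis (|-| Y) Y0.
have Xp : 0 < #|X| by rewrite card_gt0.
have Yp : 0 < #|Y| by rewrite card_gt0.
have {}Xs : #|X |+| |-| Y| <= K * #|X|.
  rewrite -(leq_pmul2r Yp); apply: leq_trans Xs _.
  by rewrite mulnAC leq_mul2r small orbT.
have it i : #|X |+| itersum (|-| Y) i| <= K ^ i * #|X|.
  elim: i => [|i IH] /=; first by rewrite sumset0 mul1n.
  rewrite sumsetA -(leq_pmul2r Xp); apply: leq_trans (Xpet _) _.
  by apply: leq_trans (leq_mul Xs IH) _; rewrite expnS mulnACA mulnA.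
rewrite itersum_diff -(leq_pmul2r Xp).
apply: leq_trans (ruzsa_triangle _ _ _) _.
rewrite -card_sumsetN oppsetK sumsetC itersum_opp expnD.
apply: leq_trans (leq_mul (it j) (it j)) _.
rewrite mulnACA [_ * #|Y| * _]mulnAC -!mulnA !leq_mul //.
exact: subset_leq_card.
Qed.

Lemma ruzsa_covering A B K : A != set0 -> #|A |+| B| <= K * #|A| ->
  exists Z, [/\ Z \subset B, #|Z| <= K & B \subset A |+| |-| A |+| Z].
Proof.
move=> A0 small.
have Ap : 0 < #|A| by rewrite card_gt0.
(* The inequality says that the translates of [A] by [Z] are pairwise disjoint. For a maximal [Z],
   the translate of [A] by any further [b] in [B] meets one of them, which puts [b] in
   [A - A + Z]. *)
pose P Z := (Z \subset B) && (#|A| * #|Z| <= #|A |+| Z|).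
have P0 : P set0 by rewrite /P sub0set cards0 muln0.
have [Z /andP[ZB ZA] Zmax] := arg_maxnP (fun Z : {set V} => #|Z|) P0.
exists Z; split=> //.
  rewrite -(leq_pmul2r Ap) mulnC; apply: leq_trans ZA _.
  apply: leq_trans small; apply: subset_leq_card; exact: sumsetS.
apply/subsetP => b bB; apply: contraT => nb.
have bZ : b \notin Z.
  apply: contra nb => bZ; rewrite -[b]add0r mem_sumset //.
  case/set0Pn: A0 => a aA; rewrite -(subrr a) mem_sumset // mem_oppset //.
have : P (b |: Z).
  rewrite /P subUset sub1set bB ZB /= cardsU1 bZ mulnDr muln1.
  rewrite setUC sumsetU cardsU.
  suff -> : (A |+| Z) :&: (A |+| [set b]) = set0.
    by rewrite cards0 subn0 card_sumset1 addnC leq_add2r.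
  apply/setP => z; rewrite !inE; apply/negP => /andP[/sumsetP[a [y [aA yZ ->]]]].
  case/sumsetP => a' [_ [a'A /set1P -> e]]; case/negP: nb.
  have -> : b = ((a - a') + y)%R by rewrite addrAC e addrAC subrr add0r.
  by rewrite !mem_sumset // mem_oppset.
by move/Zmax; rewrite cardsU1 bZ; lia.
Qed.

End Sumsets.
(** * Approximate subfields *)

Section FieldCovering.
Variable F : finFieldType.
Implicit Types (A B C W X Y Z T Q : {set F}) (s t u v : F).

Lemma card_dilate t A : t != 0%R -> #|t |*| A| = #|A|.
Proof. by move=> t0; rewrite card_imset //; apply: mulfI. Qed.

Lemma leq_card_dilate t A : #|t |*| A| <= #|A|.
Proof. exact: leq_imset_card. Qed.

Lemma mem_dilate t A x : x \in A -> (t * x)%R \in t |*| A.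
Proof. exact: imset_f. Qed.

Lemma dilate_sumset t A B : t |*| (A |+| B) = t |*| A |+| t |*| B.
Proof.
apply/setP => z; apply/imsetP/sumsetP.
  case=> _ /sumsetP[x [y [xA yB ->]]] ->.
  by exists (t * x)%R, (t * y)%R; rewrite !mem_dilate // mulrDr.
case=> _ [_ [/imsetP[x xA ->] /imsetP[y yB ->] ->]].
by exists (x + y)%R; rewrite ?mem_sumset // mulrDr.
Qed.

Lemma dilate_opp t A : t |*| (|-| A) = |-| (t |*| A).
Proof.
by rewrite /dilate /oppset -!imset_comp; apply: eq_imset => x /=; rewrite mulrN.
Qed.

Lemma dilateM s t A : s |*| (t |*| A) = (s * t)%R |*| A.
Proof. by rewrite /dilate -imset_comp; apply: eq_imset => x /=; rewrite mulrA. Qed.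

Lemma dilateD s t A : (s + t)%R |*| A \subset s |*| A |+| t |*| A.
Proof.
apply/subsetP => _ /imsetP[x xA ->].
by rewrite mulrDl mem_sumset ?mem_dilate.
Qed.

Lemma dilateN t A : (- t)%R |*| A = |-| (t |*| A).
Proof.
by rewrite /dilate /oppset -imset_comp; apply: eq_imset => x /=; rewrite mulNr.
Qed.

Lemma dilateS t A B : A \subset B -> t |*| A \subset t |*| B.
Proof. exact: imsetS. Qed.

Lemma dilate_iter t A j : t |*| itersum A j = itersum (t |*| A) j.
Proof.
elim: j => [|j IH] /=; last by rewrite dilate_sumset IH.
by rewrite /dilate imset_set1 mulr0.
Qed.

(** Factors [t] that preserve [A] up to few translates behave like an approximate ring: they can be
    added, negated and multiplied, at the price of larger [j] and [m], which are tracked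
    explicitly. *)
Definition covers A K j m t :=
  exists2 Z : {set F}, #|Z| <= K ^ m & t |*| A \subset itersum A j |+| Z.

Lemma itersum_sumset A B j : itersum (A |+| B) j = itersum A j |+| itersum B j.
Proof.
elim: j => [|j IH] /=; first by rewrite sumset0.
by rewrite IH sumsetACA.
Qed.

Lemma card_itersum A m j : #|A| <= m -> #|itersum A j| <= m ^ j.
Proof.
move=> Am; elim: j => [|j IH] /=; first by rewrite cards1.
by apply: leq_trans (card_sumset_le _ _) _; rewrite expnS leq_mul.
Qed.

Lemma itersumS A B j : A \subset B -> itersum A j \subset itersum B j.
Proof. by move=> AB; elim: j => [|j IH] //=; rewrite sumsetS. Qed.

Lemma itersumM A i j : itersum (itersum A i) j = itersum A (j * i).
Proof. by elim: j => [|j IH] //=; rewrite IH mulSn itersumD. Qed.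

Lemma coversD A K i j m n s t :
  covers A K i m s -> covers A K j n t -> covers A K (i + j) (m + n) (s + t)%R.
Proof.
case=> [Z Zm sA] [W Wn tA]; exists (Z |+| W).
  by apply: leq_trans (card_sumset_le _ _) _; rewrite expnD leq_mul.
apply: subset_trans (dilateD _ _ _) _; rewrite itersumD sumsetACA.
exact: sumsetS.
Qed.

Lemma coversN A K j m t : |-| A = A -> covers A K j m t -> covers A K j m (- t)%R.
Proof.
move=> AN [Z Zm tA]; exists (|-| Z); first by rewrite card_oppset.
rewrite dilateN -[in itersum _ _]AN -itersum_opp -oppset_sum.
by apply: imsetS.
Qed.

Lemma coversM A K i j m n s t :
  covers A K i m s -> covers A K j n t ->
  covers A K (j * i) (m * j + n) (s * t)%R.
Proof.
case=> [Z Zm sA] [W Wn tA]; exists (itersum Z j |+| s |*| W).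
  apply: leq_trans (card_sumset_le _ _) _; rewrite expnD leq_mul //.
    by rewrite expnM card_itersum.
  exact: leq_trans (leq_card_dilate _ _) _.
rewrite -dilateM; apply: subset_trans (dilateS _ tA) _.
rewrite dilate_sumset dilate_iter sumsetA; apply: sumsetS => //.
by rewrite -itersumM -itersum_sumset; apply: itersumS.
Qed.

(* Few dilation factors [r] can make [Y + r Y] small: summing additive energies
   over [r], a quadruple with [y2 <> y4] determines [r]. *)
Lemma card_small_dilates Y T M :
  {in T, forall r, #|Y |+| r |*| Y| <= M} ->
  #|T| * #|Y| ^ 4 <= M * (#|T| * #|Y| ^ 2 + #|Y| ^ 4).
Proof.
move=> small.
pose YY := setX Y Y.
pose f r (p : F * F) := (p.1 + r * p.2)%R.
pose En r := [set p in setX YY YY | f r p.1 == f r p.2].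
have enr r : r \in T -> #|Y| ^ 4 <= M * #|En r|.
  move=> rT; have := card_collisions YY (f r).
  rewrite cardsX -mulnn -!mulnA => h; rewrite !expnS expn0 muln1.
  apply: leq_trans h _; rewrite leq_mul2r; apply/orP; right.
  apply: leq_trans (small r rT); apply: subset_leq_card.
  apply/subsetP => _ /imsetP[[u v] /setXP[uY vY] ->].
  by rewrite mem_sumset ?mem_dilate.
rewrite -sum_nat_const.
apply: (@leq_trans (\sum_(r in T) M * #|En r|)); first exact: leq_sum.
rewrite -big_distrr leq_mul2l /=; apply/orP; right.
pose D := [set p in setX YY YY | p.1 == p.2].
apply: (@leq_trans (\sum_(r in T) (#|Y| ^ 2 + #|En r :\: D|))).
  apply: leq_sum => r rT; rewrite -[X in X <= _](cardsID D) leq_add2r.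
  rewrite -mulnn -cardsX.
  apply: (@leq_card_dinj _ _ _ _ (fun p => p.1)).
    by move=> [p p']; rewrite !inE => /andP[/andP[/andP[/= + _] _] _].
  move=> [p p'] [u u']; rewrite !inE /=.
  by move=> /andP[_ /andP[_ /eqP->]] /andP[_ /andP[_ /eqP->]] /= ->.
rewrite big_split /= sum_nat_const leq_add2l.
pose TT := [set q : F * ((F * F) * (F * F)) | (q.1 \in T) && (q.2 \in En q.1 :\: D)].
have -> : \sum_(r in T) #|En r :\: D| = #|TT|.
  rewrite -sum1_card (partition_big (fun q => q.1) (mem T)) /=; last first.
    by move=> q; rewrite inE => /andP[].
  apply: eq_bigr => r rT; rewrite sum1_card -(card_imset (mem (En r :\: D)) (f := fun p => (r, p))); last first.
    by move=> ? ? [].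
  apply: eq_card => -[r' p]; apply/imsetP/andP => /=.
    by case=> p' pE [-> ->]; rewrite inE /= rT pE.
  by rewrite inE /= => -[/andP[_ pE] /eqP e]; exists p; rewrite -e.
have -> : #|Y| ^ 4 = #|setX YY YY| by rewrite !cardsX !expnS expn0 muln1 -!mulnA.
apply: (@leq_card_dinj _ _ _ _ (fun q => q.2)).
  by move=> [r p]; rewrite !inE /= => /andP[_ /andP[_ /andP[]]].
move=> [r [[a b] [c d]]] [r' p]; rewrite inE /= => /andP[_ h] + /esym e.
rewrite e inE /= => /andP[_ h'].
move: h h'; rewrite !inE /= /f /= => /andP[nD /andP[ins /eqP e1]].
move=> /andP[_ /andP[_ /eqP e2]]; congr (_, _).
have bd : b != d.
  apply: contra nD => /eqP bd; rewrite ins /= bd.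
  by move: e1; rewrite bd => /addIr ->.
have h s : (a + s * b = c + s * d -> s * (b - d) = c - a)%R.
  by move=> es; rewrite mulrBr -[a](addrK (s * b)%R) es; ring.
have h1 := h _ e1; have h2 := h _ e2.
by apply: (@mulIf _ (b - d)%R); rewrite ?subr_eq0 // h1.
Qed.

Definition is_subfield Q :=
  [/\ 0%R \in Q, 1%R \in Q, {in Q &, forall x y, (x - y)%R \in Q},
    {in Q &, forall x y, (x * y)%R \in Q} & {in Q, forall x, (x^-1)%R \in Q}].

(* If [xi] lies outside a subfield [Q] then [(x, y) |-> x + xi y] is injective
   on [Q * Q]; one more element outside the image gives [Q * Q * Q]. *)
Lemma subfield_card Q : is_subfield Q ->
  [\/ #|Q| = #|F|, #|Q| ^ 2 = #|F| | #|Q| ^ 3 <= #|F|].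
Proof.
move=> [Q0 Q1 QB QM QV].
have QN x : x \in Q -> (- x)%R \in Q by move=> xQ; rewrite -[(- x)%R]add0r QB.
have QD x y : x \in Q -> y \in Q -> (x + y)%R \in Q.
  by move=> xQ yQ; rewrite -[y]opprK QB ?QN.
have [QT|/subsetPn[xi _ xiQ]] := boolP ([set: F] \subset Q).
  by apply: Or31; rewrite -cardsT; apply: eq_card => z; rewrite (subsetP QT) // inE.
pose f (p : F * F) : F := (p.1 + xi * p.2)%R.
have f_inj : {in setX Q Q &, injective f}.
  move=> [x y] [x' y'] /setXP[xQ yQ] /setXP[x'Q y'Q]; rewrite /f /= => e.
  have [yy|yy] := eqVneq y y'; first by move: e; rewrite yy => /addIr ->.
  case/negP: xiQ; have y0 : (y - y')%R != 0%R by rewrite subr_eq0.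
  have -> : xi = ((x' - x) * (y - y')^-1)%R.
    apply: (mulIf y0); rewrite divfK // -[x](addrK (xi * y)%R) e; ring.
  by rewrite QM ?QV ?QB.
pose Q2 := f @: setX Q Q.
have cQ2 : #|Q2| = #|Q| ^ 2 by rewrite card_in_imset // cardsX mulnn.
have [QT|/subsetPn[eta _ etaQ]] := boolP ([set: F] \subset Q2).
  apply: Or32; rewrite -cQ2 -cardsT.
  by apply: eq_card => z; rewrite (subsetP QT) // inE.
apply: Or33; rewrite expnSr -cQ2 -cardsX -cardsT.
apply: (@leq_card_dinj _ _ _ _ (fun p => (p.1 + eta * p.2)%R)).
  by move=> ? _; rewrite inE.
move=> [u y] [u' y'] /setXP[/imsetP[[a b] /setXP[aQ bQ] eu] yQ].
move=> /setXP[/imsetP[[a' b'] /setXP[a'Q b'Q] eu'] y'Q] /= e.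
have [yy|yy] := eqVneq y y'; first by move: e; rewrite yy => /addIr ->.
rewrite {}eu {}eu' in e.
case/negP: etaQ; have y0 : (y - y')%R != 0%R by rewrite subr_eq0.
apply/imsetP; exists ((a' - a) * (y - y')^-1, (b' - b) * (y - y')^-1)%R.
  by rewrite in_setX !QM ?QV ?QB.
apply: (mulIf y0); rewrite /f /= mulrDl -(mulrA xi) !divfK //.
rewrite /f /= in e.
have -> : a = (a' + xi * b' + eta * y' - eta * y - xi * b)%R by rewrite -e; ring.
ring.
Qed.

Definition quotients T : {set F} :=
  [set ((p.1.1 - p.1.2) / (p.2.1 - p.2.2))%R | p in
    [set p in setX (setX T T) (setX T T) | p.2.1 != p.2.2]].

Lemma quotientsP T r : reflect
  (exists a b c d, [/\ [/\ a \in T, b \in T, c \in T & d \in T], c != d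
     & r = ((a - b) / (c - d))%R]) (r \in quotients T).
Proof.
apply: (iffP imsetP) => [[[[a b] [c d]]]|[a [b [c [d [[aT bT cT dT] cd ->]]]]]].
  by rewrite inE => /andP[/setXP[/setXP[? ?] /setXP[? ?]] /= ?] ->; exists a, b, c, d.
by exists ((a, b), (c, d)); rewrite // inE !in_setX /= aT bT cT dT.
Qed.

(** A collision with [y != y'] would exhibit [al / be] as [(x - x') / (y' - y)]. *)
Lemma quotients_outside T (al be : F) : (be != 0)%R -> (al / be)%R \notin quotients T ->
  {in setX T T &, injective (fun p => be * p.1 + al * p.2)%R}.
Proof.
move=> b0 nq [x y] [x' y'] /setXP[xT yT] /setXP[x'T y'T] /= e.
have [yy|yy] := eqVneq y' y.
  by move: e; rewrite yy => /addIr/(mulfI b0) ->.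
case/negP: nq; apply/quotientsP; exists x, x', y', y; split=> //.
have y0 : (y' - y)%R != 0%R by rewrite subr_eq0.
apply: (mulIf y0); apply: (mulIf b0); rewrite divfK // mulrAC divfK //.
have -> : (al * (y' - y) = be * x' + al * y' - be * x' - al * y)%R by ring.
by rewrite -e; ring.
Qed.

(** The quotient set always contains 0 and is stable under negation and inversion, so only stability
    under [r + 1] or under products can fail. Either failure gives an element outside it. The
    resulting injective map is stated with denominators cleared, so that its coefficients are built
    from differences of elements of [T] by sums and products only, which [covers] can follow. *)
Lemma quotients_dichotomy T : 1 < #|T| ->
  is_subfield (quotients T) \/
  exists a b c d a' b' c' d', [/\ [/\ a \in T, b \in T, c \in T & d \in T],
    [/\ a' \in T, b' \in T, c' \in T & d' \in T] &
    {in setX T T &, injective (fun p => (c - d) * p.1 + (a - b + (c - d)) * p.2)%R}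
    \/ {in setX T T &, injective (fun p =>
          (c - d) * (c' - d') * p.1 + (a - b) * (a' - b') * p.2)%R}].
Proof.
move=> /card_gt1P[x [y [xT yT xy]]].
set Q := quotients T.
have [/forall_inP Q1|] := boolP [forall r in Q, (r + 1)%R \in Q]; last first.
  case/forall_inPn => r /quotientsP[a [b [c [d [[aT bT cT dT] cd ->]]]]] nQ; right.
  exists a, b, c, d, a, b, c, d; split=> //; left; apply: quotients_outside.
    by rewrite subr_eq0.
  by rewrite mulrDl divff ?subr_eq0.
have [/forall_inP QM|] :=
    boolP [forall r in Q, [forall s in Q, (r * s)%R \in Q]]; last first.
  case/forall_inPn => r /quotientsP[a [b [c [d [[aT bT cT dT] cd ->]]]]].
  case/forall_inPn => s /quotientsP[a' [b' [c' [d' [[a'T b'T c'T d'T] cd' ->]]]]] nQ.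
  right; exists a, b, c, d, a', b', c', d'; split=> //; right.
  apply: quotients_outside; first by rewrite mulf_neq0 ?subr_eq0.
  by move: nQ; rewrite mulf_div.
left.
have {}QM u v : u \in Q -> v \in Q -> (u * v)%R \in Q.
  by move=> uQ vQ; have /forall_inP := QM u uQ; apply.
have Q0 : 0%R \in Q.
  by apply/quotientsP; exists x, x, x, y; rewrite subrr mul0r.
have QI : 1%R \in Q by rewrite -[1%R]add0r Q1.
have QV u : u \in Q -> (u^-1)%R \in Q.
  move=> /quotientsP[a [b [c [d [[aT bT cT dT] cd ->]]]]].
  have [->|ab] := eqVneq a b; first by rewrite subrr mul0r invr0.
  by apply/quotientsP; exists c, d, a, b; rewrite invf_div.
have QN u : u \in Q -> (- u)%R \in Q.
  move=> /quotientsP[a [b [c [d [[aT bT cT dT] cd ->]]]]].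
  by apply/quotientsP; exists b, a, c, d; rewrite -mulNr opprB.
split=> // u v uQ vQ; have [->|v0] := eqVneq v 0%R; first by rewrite subr0.
(* Stability under differences reduces to products, negation, inversion and adding one. *)
have -> : (u - v = (- v) * ((- (u / v)) + 1))%R.
  by rewrite mulrDr mulrNN mulr1 mulrC divfK.
by rewrite QM ?QN // Q1 ?QN // QM ?QV.
Qed.

Lemma leq_card_quotients T : 1 < #|T| -> #|T| <= #|quotients T|.
Proof.
move=> /card_gt1P[x [y [xT yT xy]]].
apply: (@leq_card_dinj _ _ _ _ (fun t => (t - x) / (x - y))%R).
  by move=> t tT; apply/quotientsP; exists t, x, x, y.
move=> t t' _ _ /= /mulIf; rewrite invr_eq0 subr_eq0 => /(_ xy).
exact: addIr.
Qed.

(** Once [2 * H <= #|Y|], the diagonal term of [card_small_dilates] is at most half of the left side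
    and is absorbed. *)
Lemma few_dilates Y T H : {in T, forall r, #|Y |+| r |*| Y| <= H * #|Y|} ->
  2 * H <= #|Y| -> 0 < #|Y| -> #|T| <= 2 * H * #|Y|.
Proof.
move=> /card_small_dilates h HY Yp.
have h1 : #|T| * #|Y| ^ 3 <= H * (#|T| * #|Y| ^ 2 + #|Y| ^ 4).
  rewrite -(leq_pmul2r Yp) -mulnA -expnSr; apply: leq_trans h _.
  by rewrite mulnAC.
have h2 : 2 * H * #|T| * #|Y| ^ 2 <= #|T| * #|Y| ^ 3.
  by rewrite (expnS _ 2) (mulnC (2 * H)) -mulnA leq_mul // leq_mul2r HY orbT.
have h3 : #|T| * #|Y| ^ 3 <= 2 * H * #|Y| ^ 4.
  move: h1 h2; rewrite !mulnDr !mulnA; lia.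
have Y3 : 0 < #|Y| ^ 3 by rewrite expn_gt0 Yp.
by rewrite -(leq_pmul2r Y3) -mulnA -expnS.
Qed.

(** [Y] lies in a translate of [Y - Y], so [Y |+| t |*| Y] lies in a translate of [j.+1] copies of
    [Y - Y] plus the covering set. [plunnecke_diff] with [K ^ 2] for the constant gives the exponent
    [4 * j.+1]. *)
Lemma covers_card Y K j m t : Y != set0 -> #|Y |+| |-| Y| <= K ^ 2 * #|Y| ->
  covers (Y |+| |-| Y) K j m t -> #|Y |+| t |*| Y| <= K ^ (4 * j.+1 + m) * #|Y|.
Proof.
move=> Y0 small [Z Zm tD]; have /set0Pn[y yY] := Y0.
set D := Y |+| |-| Y in small tD.
have YD : Y \subset D |+| [set y].
  apply/subsetP => x xY; rewrite -[x](subrK y) mem_sumset ?set11 //.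
  by rewrite mem_sumset // mem_oppset.
apply: (@leq_trans #|itersum D j.+1 |+| ([set y] |+| t |*| [set y]) |+| Z|).
  apply: subset_leq_card.
  apply: subset_trans (sumsetS YD (dilateS t YD)) _.
  rewrite dilate_sumset sumsetACA /=; move: ([set y] |+| t |*| [set y]) => W.
  have -> : D |+| itersum D j |+| W |+| Z = D |+| (itersum D j |+| Z) |+| W.
    by rewrite -!sumsetA (sumsetC W).
  by do 2 apply: sumsetS => //.
apply: leq_trans (card_sumset_le _ _) _.
rewrite expnD mulnAC leq_mul //.
rewrite {1}/dilate imset_set1 /sumset imset2_set1l imset_set1 card_sumset1.
have := plunnecke_diff j.+1 Y0 small.
by rewrite -expnM addnn -mul2n mulnA.
Qed.

(** Multiplying by [t] turns the sumset into [t |*| Y |+| s |*| Y], so that quotients are reached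
    without covering by inverses. *)
Lemma card_ratio_dilate Y K i j m n s t : Y != set0 ->
  #|Y |+| |-| Y| <= K ^ 2 * #|Y| -> t != 0%R ->
  covers (Y |+| |-| Y) K i m s -> covers (Y |+| |-| Y) K j n t ->
  #|Y |+| (s / t)%R |*| Y| <= K ^ (4 * (i + j) + (m + n)) * #|Y|.
Proof.
move=> Y0 small t0 [Z Zm sD] [W Wn tD]; have /set0Pn[y yY] := Y0.
set D := Y |+| |-| Y in small sD tD.
rewrite -[X in X <= _](card_dilate _ t0) dilate_sumset dilateM mulrC divfK //.
have YD : Y \subset D |+| [set y].
  apply/subsetP => x xY; rewrite -[x](subrK y) mem_sumset ?set11 //.
  by rewrite mem_sumset // mem_oppset.
apply: (@leq_trans #|(itersum D (j + i) |+| (W |+| Z)) |+| (t |*| [set y] |+| s |*| [set y])|).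
  apply: subset_leq_card.
  apply: subset_trans (sumsetS (dilateS t YD) (dilateS s YD)) _.
  rewrite (dilate_sumset t D) (dilate_sumset s D) sumsetACA; apply: sumsetS => //.
  by rewrite itersumD -sumsetACA; apply: sumsetS.
rewrite /dilate !imset_set1 [X in _ |+| X]/sumset imset2_set1l imset_set1 card_sumset1.
apply: leq_trans (card_sumset_le _ _) _.
rewrite expnD mulnAC leq_mul //.
  have := plunnecke_diff (j + i) Y0 small.
  by rewrite -expnM addnn -mul2n mulnA (addnC j).
by apply: leq_trans (card_sumset_le _ _) _; rewrite addnC expnD leq_mul.
Qed.

Lemma covers_diffset Y K t : (exists2 Z : {set F}, #|Z| <= K & t |*| Y \subset Y |+| |-| Y |+| Z) ->
  covers (Y |+| |-| Y) K 2 2 t.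
Proof.
case=> Z ZK tY; exists (Z |+| |-| Z).
  by apply: leq_trans (card_sumset_le _ _) _; rewrite card_oppset -mulnn leq_mul.
rewrite dilate_sumset dilate_opp /= sumset0.
set D := Y |+| |-| Y in tY *.
have DN : |-| D = D by rewrite /D oppset_sum oppsetK sumsetC.
have -> : D |+| D |+| (Z |+| |-| Z) = D |+| Z |+| |-| (D |+| Z).
  by rewrite oppset_sum DN sumsetACA.
by apply: sumsetS => //; apply: imsetS.
Qed.

(* The only place where the absence of a subfield of order about [n ~ q^(2/5)]
   is used. *)
Lemma no_approximate_subfield Y T K n : 1 < K -> 0 < n ->
  n <= K * #|Y| -> #|Y| <= K * n -> #|Y |+| |-| Y| <= K * n -> n <= K * #|T| ->
  {in T, forall t, exists2 Z : {set F}, #|Z| <= K & t |*| Y \subset Y |+| |-| Y |+| Z} ->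
  #|F| ^ 2 <= K * n ^ 5 -> n ^ 5 <= K * #|F| ^ 2 -> n <= K ^ 400.
Proof.
move=> K1 n0 nY Yn DY nT Tcov qn nq.
have Kp : 0 < K by lia.
have leK a b : a <= b -> K ^ a <= K ^ b by move=> ab; rewrite leq_pexp2l.
have Yp : 0 < #|Y| by move: nY n0; case: #|Y|; rewrite ?muln0; lia.
have Y0 : Y != set0 by rewrite -card_gt0.
set D := Y |+| |-| Y in DY Tcov.
have small : #|D| <= K ^ 2 * #|Y|.
  by apply: leq_trans DY _; rewrite -mulnn -mulnA leq_mul2l nY orbT.
have DN : |-| D = D by rewrite /D oppset_sum oppsetK sumsetC.
have covT t : t \in T -> covers D K 2 2 t by move=> /Tcov; apply: covers_diffset.
have covTT s t : s \in T -> t \in T -> covers D K 4 4 (s - t)%R.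
  by move=> sT tT; apply: (@coversD D K 2 2 2 2); [exact: covT|apply: coversN; [|exact: covT]].
have le_n_K e : #|Y| <= K ^ e -> n <= K ^ e.+1.
  by move=> h; apply: leq_trans nY _; rewrite expnS leq_mul2l h orbT.
(* [few_dilates] needs [Y] to be large; if it is not, [n] itself is bounded by a power of [K]. *)
have dich E (T' : {set F}) : {in T', forall r, #|Y |+| r |*| Y| <= K ^ E * #|Y|} ->
    n <= K ^ E.+2 \/ #|T'| <= K ^ E.+2 * n.
  move=> h; have [le|lt] := leqP (2 * K ^ E) #|Y|.
    right; apply: leq_trans (few_dilates h le Yp) _.
    by rewrite expnS (expnS _ E) -!mulnA leq_mul // mulnCA leq_mul2l Yn orbT.
  by left; apply: le_n_K; apply: (leq_trans (ltnW lt)); rewrite expnS leq_mul.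
have [T1|T1] := leqP #|T| 1.
  by apply: leq_trans nT _; apply: leq_trans (leK 1 400 isT); rewrite expn1 -[X in _ <= X]muln1 leq_mul2l T1 orbT.
(* An injective [f] produces at least [(n / K) ^ 2] factors, while at most [K ^ 346 * n] exist. The
   exponent 344 is [4 * 65 + 84]: the longer of the two combinations below is covered with [j = 64]
   and [m = 84]. *)
have growth (f : F * F -> F) : {in setX T T &, injective f} ->
    (forall s t, s \in T -> t \in T -> #|Y |+| f (s, t) |*| Y| <= K ^ 344 * #|Y|) ->
    n <= K ^ 400.
  move=> f_inj fsmall.
  have [|le|le] := dich 344 (f @: setX T T); last 1 first.
  - rewrite card_in_imset // cardsX in le.
    have : n * n <= K * K * (K ^ 346 * n).
      by apply: leq_trans (leq_mul nT nT) _; rewrite mulnACA leq_mul.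
    rewrite mulnA leq_pmul2r // mulnn -expnD => h.
    by apply: (leq_trans h); rewrite leK.
  - by move=> _ /imsetP[[s t] /setXP[sT tT] ->]; apply: fsmall.
  - by apply: (leq_trans le); rewrite leK.
case: (quotients_dichotomy T1); last first.
  move=> [a [b [c [d [a' [b' [c' [d' [[aT bT cT dT] [a'T b'T c'T d'T] [] finj]]]]]]]]].
    apply: growth finj _ => s t sT tT /=.
    have c1 := coversM (covTT c d cT dT) (covT s sT).
    have c2 := coversM (coversD (covTT a b aT bT) (covTT c d cT dT)) (covT t tT).
    apply: leq_trans (covers_card Y0 small (coversD c1 c2)) _.
    by rewrite leq_mul2r leK ?orbT.
  apply: growth finj _ => s t sT tT /=.
  have c1 := coversM (coversM (covTT c d cT dT) (covTT c' d' c'T d'T)) (covT s sT).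
  have c2 := coversM (coversM (covTT a b aT bT) (covTT a' b' a'T b'T)) (covT t tT).
  apply: leq_trans (covers_card Y0 small (coversD c1 c2)) _.
  by rewrite leq_mul2r leK ?orbT.
move=> Qfield; set Q := quotients T in Qfield.
have nQ : n <= K * #|Q|.
  by apply: leq_trans nT _; rewrite leq_mul2l leq_card_quotients ?orbT.
(* The exponent is [4 * (4 + 4) + (4 + 4)], from [card_ratio_dilate] applied to two differences of
   elements of [T]. *)
have [|le|Qn] := dich 40 Q.
- move=> r /quotientsP[a [b [c [d [[aT bT cT dT] cd ->]]]]].
  by apply: card_ratio_dilate (covTT a b aT bT) (covTT c d cT dT); rewrite ?subr_eq0.
- by apply: (leq_trans le); rewrite leK.
have Q5 : #|Q| ^ 5 <= K ^ 210 * n ^ 5.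
  by rewrite (expnM _ 42 5) -expnMn leq_exp2r.
have n5 : n <= n ^ 5 by rewrite -[X in X <= _]expn1 leq_pexp2l.
have q0 : 0 < #|F| by apply/card_gt0P; exists 0%R.
have Qp : 0 < #|Q| by move: nQ n0; case: #|Q|; rewrite ?muln0; lia.
have Q6 : #|Q| ^ 5 <= K ^ 211 * #|F| ^ 2.
  by apply: leq_trans Q5 _; rewrite (expnSr _ 210) -mulnA leq_mul.
(* Up to powers of [K], [#|Q|] is [q ^ (2/5)] with [q = #|F|]. Orders [q] and [q ^ (1/2)] are too
   large and an order of at most [q ^ (1/3)] is too small, unless [n] is bounded by a power of
   [K]. *)
case: (subfield_card Qfield) => eQ.
- rewrite eQ (expnD _ 3 2) leq_pmul2r ?expn_gt0 ?q0 // in Q6.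
  apply: leq_trans n5 _; apply: leq_trans nq _.
  apply: (@leq_trans (K * K ^ 211)); last by rewrite -expnS leK.
  by rewrite leq_mul2l (leq_trans _ Q6) ?orbT // leq_pexp2l.
- rewrite -eQ -expnM (expnD _ 1 4) leq_pmul2r ?expn_gt0 ?Qp // expn1 in Q6.
  apply: (leq_trans nQ); apply: (@leq_trans (K * K ^ 211)).
    by rewrite leq_mul2l Q6 orbT.
  by rewrite -expnS leK.
have h6 : #|Q| ^ 6 <= #|F| ^ 2 by rewrite (expnM _ 3 2) leq_exp2r.
have h5 : n ^ 5 <= K ^ 5 * #|Q| ^ 5 by rewrite -expnMn leq_exp2r.
have : #|Q| * #|Q| ^ 5 <= K ^ 6 * #|Q| ^ 5.
  rewrite -expnS; apply: leq_trans h6 _; apply: leq_trans qn _.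
  by rewrite (expnS _ 5) -mulnA leq_mul2l h5 orbT.
rewrite leq_pmul2r ?expn_gt0 ?Qp // => h.
apply: (leq_trans nQ); apply: (@leq_trans (K * K ^ 6)).
  by rewrite leq_mul2l h orbT.
by rewrite -expnS leK.
Qed.

End FieldCovering.

(** * Balog-Szemeredi-Gowers *)

Lemma exchange_card (T1 T2 : finType) (A : {set T1}) (B : {set T2})
    (G : T1 -> T2 -> bool) :
  \sum_(a in A) #|[set b in B | G a b]| = \sum_(b in B) #|[set a in A | G a b]|.
Proof.
under eq_bigr do rewrite -sum1_card.
under [RHS]eq_bigr do rewrite -sum1_card.
rewrite (exchange_big_dep (mem B)) /=; last by move=> a b _; rewrite inE => /andP[].
by apply: eq_bigr => b bB; apply: eq_bigl => a; rewrite !inE bB.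
Qed.

Lemma card_setX_filter (T1 T2 : finType) (A : {set T1}) (B : {set T2})
    (G : T1 -> T2 -> bool) :
  #|[set p in setX A B | G p.1 p.2]| = \sum_(a in A) #|[set b in B | G a b]|.
Proof.
rewrite -sum1_card (partition_big (fun p => p.1) (mem A)) /=; last first.
  by move=> [a b]; rewrite !inE => /andP[/andP[]].
apply: eq_bigr => a aA; rewrite sum1_card.
rewrite -(card_imset (mem [set b in B | G a b]) (f := fun b => (a, b))); last first.
  by move=> ? ? [].
apply: eq_card => -[a' b]; apply/andP/imsetP => /=.
  rewrite !inE /= => -[/andP[/andP[_ bB] Gab] /eqP e]; exists b; rewrite -?e //.
  by rewrite inE bB.
by case=> b'; rewrite inE => /andP[b'B Gab] [-> ->]; rewrite !inE /= aA b'B Gab.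
Qed.

(** Indices below the threshold [s / (2 * k)] contribute at most [B / (2 * k)], half of the
    guaranteed [B / k]. *)
Lemma sum_nat_popular (T : finType) (A : {set T}) (a : T -> nat) k s B :
  #|A| * s <= B -> B <= k * \sum_(i in A) a i ->
  B <= 2 * k * \sum_(i in [set i in A | s <= 2 * k * a i]) a i.
Proof.
move=> hB h.
suff: \sum_(i in A) 2 * k * a i <=
    #|A| * s + 2 * k * \sum_(i in [set i in A | s <= 2 * k * a i]) a i.
  by rewrite -big_distrr /= -mulnA; lia.
rewrite big_distrr /= -sum_nat_const.
rewrite (bigID (fun i => s <= 2 * k * a i)) /= addnC; apply: leq_add.
  rewrite big_mkcondr /=; apply: leq_sum => i _.
  by case: (leqP s (2 * k * a i)) => //= /ltnW.
by rewrite [X in _ <= X](eq_bigl (fun i => (i \in A) && (s <= 2 * k * a i))) // => i; rewrite inE.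
Qed.

(** The graph part of the theorem. A vertex [b0] is chosen so that most pairs in its neighbourhood
    [A3] have many common neighbours. [A'] keeps the vertices of [A3] with few bad partners, [B']
    the vertices of [B] with many neighbours in [A3]. A path from [a] to [b] passes through a
    neighbour [a'] of [b] that is not a bad partner of [a], and through a common neighbour of [a]
    and [a']. *)
Lemma many_paths3 (T1 T2 : finType) (A : {set T1}) (B : {set T2})
    (G : T1 -> T2 -> bool) m K : 1 < K -> 0 < m -> #|A| <= m -> #|B| <= m ->
  m ^ 2 <= K * #|[set p in setX A B | G p.1 p.2]| ->
  exists (A' : {set T1}) (B' : {set T2}), [/\ A' \subset A, B' \subset B,
    m <= K ^ 4 * #|A'|, m <= K ^ 4 * #|B'| & {in A' & B', forall a b, m ^ 2 <= K ^ 17 *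
      #|[set p : T2 * T1 | [&& G a p.1, G p.2 p.1 & G p.2 b]]|}].
Proof.
move=> K1 m0 Am Bm.
have Kp : 0 < K by lia.
have leK a b : a <= b -> K ^ a <= K ^ b by move=> ab; rewrite leq_pexp2l.
have K2 a : 2 * K ^ a <= K ^ a.+1 by rewrite expnS leq_mul.
pose N a := [set b in B | G a b].
rewrite card_setX_filter => Gbig0.
have {Gbig0} Gbig : m ^ 2 <= K * \sum_(a in A) #|N a| := Gbig0.
pose A1 := [set a in A | m <= 2 * K * #|N a|].
have A1A : A1 \subset A by apply/subsetP => a; rewrite inE => /andP[].
have A1m : #|A1| <= m := leq_trans (subset_leq_card A1A) Am.
have H1 : m ^ 2 <= 2 * K * \sum_(a in A1) #|N a|.
  by apply: sum_nat_popular Gbig; rewrite -mulnn leq_mul2r Am orbT.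
pose A2 b := [set a in A1 | G a b].
have H2 : m ^ 3 <= 4 * K ^ 2 * \sum_(b in B) #|A2 b| ^ 2.
  rewrite exchange_card -/(A2 _) in H1.
  rewrite -(leq_pmul2r m0) -expnSr.
  have := sum_nat_cauchy_set B (fun b => #|A2 b|).
  have : (m ^ 2) ^ 2 <= (2 * K * \sum_(b in B) #|A2 b|) ^ 2 by rewrite leq_exp2r.
  rewrite -(expnM m) (expnMn (2 * K)) (expnMn 2 K) => h1 h2; apply: (leq_trans h1).
  rewrite -[X in _ <= X]mulnA leq_mul2l; apply/orP; right.
  by apply: (leq_trans h2); rewrite mulnC leq_mul2l Bm orbT.
pose isbad a a' := K ^ 10 * #|N a :&: N a'| < m.
pose bad b := #|[set p in setX (A2 b) (A2 b) | isbad p.1 p.2]|.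
have H3 : K ^ 10 * \sum_(b in B) bad b <= m ^ 3.
  pose badA := [set p in setX A1 A1 | isbad p.1 p.2].
  have -> : \sum_(b in B) bad b = \sum_(p in badA) #|N p.1 :&: N p.2|.
    have -> : \sum_(b in B) bad b =
        \sum_(b in B) #|[set p in badA | G p.1 b && G p.2 b]|.
      apply: eq_bigr => b _; apply: eq_card => -[a a']; rewrite !inE /=.
      by case: (a \in A); case: (a' \in A); case: (m <= 2 * K * #|N a|);
         case: (m <= 2 * K * #|N a'|); case: (isbad a a'); case: (G a b);
         case: (G a' b).
    rewrite -(exchange_card badA B (fun p b => G p.1 b && G p.2 b)).
    apply: eq_bigr => p _; apply: eq_card => b; rewrite !inE.
    by case: (b \in B).
  rewrite big_distrr /=; apply: (@leq_trans (\sum_(p in badA) m)).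
    by apply: leq_sum => p; rewrite inE => /andP[_ /ltnW].
  rewrite sum_nat_const expnSr leq_mul2r; apply/orP; right.
  apply: (@leq_trans #|setX A1 A1|).
    by apply: subset_leq_card; apply/subsetP => p; rewrite inE => /andP[].
  by rewrite cardsX -mulnn leq_mul.
(* A single pigeonhole serves both requirements: with bad pairs weighted by [K ^ 10], the
   neighbourhood of [b0] is at once large and poor in bad pairs. *)
have [b0 b0B [_ Hb0]] : exists2 b, b \in B & 0 < 8 * K ^ 2 * #|A2 b| ^ 2 /\
    m ^ 2 + K ^ 10 * bad b <= 8 * K ^ 2 * #|A2 b| ^ 2.
  have B0 : 0 < #|B|.
    rewrite card_gt0; apply: contraTneq H2 => ->.
    by rewrite big_set0 muln0 -ltnNge expn_gt0 m0.
  apply: sum_nat_pigeon.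
    by rewrite big_split /= sum_nat_const addn_gt0 muln_gt0 B0 expn_gt0 m0.
  rewrite big_split /= sum_nat_const -!big_distrr /=.
  apply: (@leq_trans (m ^ 3 + m ^ 3)).
    by apply: leq_add => //; rewrite (expnS _ 2) leq_mul.
  rewrite addnn -mul2n; apply: leq_trans (leq_mul (leqnn 2) H2) _.
  by rewrite !mulnA.
set A3 := A2 b0 in Hb0.
have A31 : A3 \subset A1 by apply/subsetP => a; rewrite inE => /andP[].
have A3m : m <= K ^ 3 * #|A3|.
  rewrite -leq_sqr expnMn -expnM.
  apply: leq_trans (leq_trans (leq_addr _ _) Hb0) _; rewrite leq_mul2r.
  apply/orP; right; apply: (@leq_trans (K ^ 5)); last exact: leK.
  by rewrite (expnD _ 3 2) leq_mul2r (@leq_exp2r 2 K 3) ?K1 ?orbT.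
have A30 : 0 < #|A3| by move: A3m; case: #|A3|; rewrite // muln0; lia.
have badA3 : K ^ 5 * bad b0 <= #|A3| ^ 2.
  have : K ^ 5 * (K ^ 5 * bad b0) <= K ^ 5 * #|A3| ^ 2.
    rewrite mulnA -expnD.
    apply: leq_trans (leq_trans (leq_addl _ _) Hb0) _; rewrite leq_mul2r.
    apply/orP; right.
    by rewrite (expnD _ 3 2) leq_mul2r (@leq_exp2r 2 K 3) ?K1 ?orbT.
  by rewrite leq_pmul2l // expn_gt0 Kp.
pose bp a := #|[set a' in A3 | isbad a a']|.
pose A' := [set a in A3 | K ^ 4 * bp a <= #|A3|].
pose dg b := #|[set a in A3 | G a b]|.
pose B' := [set b in B | #|A3| <= K ^ 3 * dg b].
have A'big : #|A3| <= 2 * #|A'|.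
  have hbp : \sum_(a in A3) bp a = bad b0 by rewrite /bad card_setX_filter.
  have : #|A3 :\: A'| * #|A3| <= K ^ 4 * bad b0.
    rewrite -hbp big_distrr /= -sum_nat_const.
    apply: (@leq_trans (\sum_(a in A3 :\: A') K ^ 4 * bp a)).
      apply: leq_sum => a; rewrite !inE => /andP[+ aA3].
      by rewrite aA3 /= -ltnNge => /ltnW.
    rewrite [X in _ <= X](big_setID A') /= addnC.
    exact: leq_addr.
  move=> h; have : K * #|A3 :\: A'| * #|A3| <= #|A3| * #|A3|.
    rewrite mulnn -mulnA; apply: leq_trans badA3.
    by rewrite (expnS _ 4) -mulnA leq_mul2l h orbT.
  rewrite leq_pmul2r // => h2.
  have h3 : 2 * #|A3 :\: A'| <= #|A3| by apply: leq_trans h2; rewrite leq_mul2r K1 orbT.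
  have := cardsID A' A3.
  have -> : A3 :&: A' = A' by apply/setIidPr/subsetP => a; rewrite inE => /andP[].
  lia.
have B'big : m <= 4 * K * #|B'|.
  have h1 : #|A3| * m <= 2 * K * \sum_(b in B) dg b.
    rewrite -exchange_card big_distrr /= -sum_nat_const.
    by apply: leq_sum => a /(subsetP A31); rewrite inE => /andP[].
  have h2 : K ^ 3 * \sum_(b in B :\: B') dg b <= m * #|A3|.
    rewrite big_distrr /=; apply: (@leq_trans (\sum_(b in B) #|A3|)).
      rewrite [X in _ <= X](big_setID B') /= addnC; apply: leq_trans (leq_addr _ _).
      apply: leq_sum => b; rewrite !inE => /andP[+ bB].
      by rewrite bB /= -ltnNge => /ltnW.
    by rewrite sum_nat_const leq_mul2r Bm orbT.
  have h3 : 4 * K * \sum_(b in B :\: B') dg b <= m * #|A3|.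
    apply: leq_trans h2; rewrite leq_mul2r; apply/orP; right.
    by rewrite (expnSr _ 2) leq_mul2r (@leq_exp2r 2 K 2) ?K1 ?orbT.
  have h4 : \sum_(b in B') dg b <= #|B'| * #|A3|.
    rewrite -sum_nat_const; apply: leq_sum => b _; apply: subset_leq_card.
    by apply/subsetP => a; rewrite inE => /andP[].
  have h5 : \sum_(b in B) dg b = \sum_(b in B') dg b + \sum_(b in B :\: B') dg b.
    rewrite (big_setID B') /=; congr (_ + _); apply: eq_bigl => b.
    by rewrite !inE; case: (b \in B).
  have h6 : m * #|A3| <= 4 * K * \sum_(b in B') dg b.
    move: h1 h3; rewrite h5 (mulnC _ m) !mulnDr.
    by rewrite -!mulnA; lia.
  rewrite -(leq_pmul2r A30); apply: (leq_trans h6).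
  by rewrite -[X in _ <= X]mulnA leq_mul2l h4 orbT.
exists A', B'; split.
- apply: subset_trans (subset_trans A31 A1A).
  by apply/subsetP => a; rewrite inE => /andP[].
- by apply/subsetP => b; rewrite inE => /andP[].
- apply: (leq_trans A3m); apply: (@leq_trans (K ^ 3 * (2 * #|A'|))).
    by rewrite leq_mul2l A'big orbT.
  by rewrite mulnA leq_mul2r (mulnC _ 2) K2 orbT.
- apply: (leq_trans B'big); rewrite leq_mul2r; apply/orP; right.
  apply: (@leq_trans (K ^ 3)); last exact: leK.
  by rewrite (expnSr _ 2) leq_mul2r (@leq_exp2r 2 K 2) ?K1 ?orbT.
move=> a b; rewrite !inE => /andP[_ bpa] /andP[bB dgb].
pose S := [set a' in A3 | G a' b & ~~ isbad a a'].
have Sbig : #|A3| <= K ^ 4 * #|S|.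
  have hS : dg b <= #|S| + bp a.
    rewrite /dg -(cardsID [set a' | isbad a a']) addnC leq_add //.
      apply: subset_leq_card; apply/subsetP => x; rewrite !inE.
      by case/andP=> -> /andP[-> ->].
    apply: subset_leq_card; apply/subsetP => x; rewrite !inE.
    by case/andP=> /andP[-> _] ->.
  have h1 : 2 * #|A3| <= K ^ 4 * dg b.
    by rewrite (expnS _ 3) -mulnA leq_mul.
  have : K ^ 4 * dg b <= K ^ 4 * #|S| + K ^ 4 * bp a by rewrite -mulnDr leq_mul2l hS orbT.
  lia.
pose PP := [set p in setX B S | G a p.1 && G p.2 p.1].
have PPsub : #|PP| <= #|[set p : T2 * T1 | [&& G a p.1, G p.2 p.1 & G p.2 b]]|.
  apply: subset_leq_card; apply/subsetP => -[x y]; rewrite !inE /=.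
  by case/andP => /andP[_ /and3P[_ -> _]] /andP[-> ->].
have PPc : #|S| * m <= K ^ 10 * #|PP|.
  rewrite (card_setX_filter _ _ (fun x y => G a x && G y x)) exchange_card.
  rewrite big_distrr /= -sum_nat_const; apply: leq_sum => a' a'S.
  move: (a'S); rewrite inE => /and3P[_ _]; rewrite /isbad -leqNgt => h.
  apply: (leq_trans h); rewrite leq_mul2l; apply/orP; right.
  by apply: subset_leq_card; apply/subsetP => x; rewrite !inE; case: (x \in B).
apply: (@leq_trans (K ^ 17 * #|PP|)); last by rewrite leq_mul2l PPsub orbT.
(* [17 = 3 + 4 + 10]: the losses for the size of [A3], for the size of [S] in [A3], and for the
   number of common neighbours of a pair that is not bad. *)
rewrite (expnD _ 7 10) -mulnA; apply: (@leq_trans (K ^ 7 * (#|S| * m))); last first.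
  by rewrite leq_mul2l PPc orbT.
rewrite mulnA -mulnn leq_mul2r; apply/orP; right.
rewrite (expnD _ 3 4) -mulnA; apply: (leq_trans A3m).
by rewrite leq_mul2l Sbig orbT.
Qed.

(** Since [a + b = (a + x) - (y + x) + (y + b)], each path of length three expresses [a + b] by
    three elements of [S]. Every sum has at least [m ^ 2 / K ^ 17] such expressions, and there are
    at most [m ^ 3] triples. *)
Lemma balog_szemeredi_gowers (V : finZmodType) (A B S : {set V}) m K :
  1 < K -> 0 < m -> #|A| <= m -> #|B| <= m -> #|S| <= m ->
  m ^ 2 <= K * #|[set p in setX A B | (p.1 + p.2)%R \in S]| ->
  exists A' B' : {set V}, [/\ A' \subset A, B' \subset B, m <= K ^ 4 * #|A'|,
    m <= K ^ 4 * #|B'| & #|A' |+| B'| <= K ^ 17 * m].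
Proof.
move=> K1 m0 Am Bm Sm big.
have [A' [B' [A'A B'B A'm B'm paths]]] :=
  many_paths3 (G := fun a b => (a + b)%R \in S) K1 m0 Am Bm big.
exists A', B'; split=> //.
pose f d := odflt (0%R, 0%R) [pick p in setX A' B' | (p.1 + p.2)%R == d].
have fP d : d \in A' |+| B' ->
    [/\ (f d).1 \in A', (f d).2 \in B' & ((f d).1 + (f d).2)%R = d].
  case/sumsetP=> x [y [xA yB ->]]; rewrite /f.
  case: pickP => [[u v] /andP[/setXP[uA vC] /eqP uv] //|/(_ (x, y))].
  by rewrite in_setX xA yB /= eqxx.
pose P d := [set p : V * V | [&& ((f d).1 + p.1)%R \in S, (p.2 + p.1)%R \in S
   & (p.2 + (f d).2)%R \in S]].
pose W := [set q in setX (A' |+| B') [set: V * V] | q.2 \in P q.1].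
have Wbig : #|A' |+| B'| * m ^ 2 <= K ^ 17 * #|W|.
  rewrite (card_setX_filter _ _ (fun d p => p \in P d)) big_distrr /= -sum_nat_const.
  apply: leq_sum => d /fP[d1 d2 _]; apply: leq_trans (paths _ _ d1 d2) _.
  rewrite leq_mul2l; apply/orP; right; apply: subset_leq_card.
  by apply/subsetP => p; rewrite !inE.
have Wsmall : #|W| <= m ^ 3.
  apply: (@leq_trans #|setX S (setX S S)|); last first.
    by rewrite !cardsX !expnS expn0 muln1 !leq_mul.
  apply: (@leq_card_dinj _ _ _ _ (fun q =>
    (((f q.1).1 + q.2.1)%R, ((q.2.2 + q.2.1)%R, (q.2.2 + (f q.1).2)%R)))).
    by move=> [d [x y]]; rewrite !inE /= => /andP[_ /and3P[-> -> ->]].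
  move=> [d [x y]] [d' [x' y']]; rewrite !inE /= => /andP[/andP[dA _] _].
  move=> /andP[/andP[d'A _] _] [e1 e2 e3].
  have [_ _ ed] := fP _ dA; have [_ _ ed'] := fP _ d'A.
  have dd : d = d'.
    rewrite -ed -ed'.
    have -> : ((f d).1 + (f d).2 = ((f d).1 + x) - (y + x) + (y + (f d).2))%R.
      by rewrite (addrC y x) opprD !addrA addrK subrK.
    rewrite e1 e2 e3.
    by rewrite (addrC y' x') opprD !addrA addrK subrK.
  by move: e1 e3; rewrite dd => /addrI -> /addIr ->.
have : #|A' |+| B'| * m ^ 2 <= K ^ 17 * m * m ^ 2.
  by apply: (leq_trans Wbig); rewrite -mulnA -expnS leq_mul2l Wsmall orbT.
by rewrite leq_pmul2r // expn_gt0 m0.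
Qed.


(** * Dilates, lines and incidences *)

(** The form in which triangle inequalities are used below: the middle set, of size [b], is divided
    out at the cost of [K ^ j]. *)
Lemma leq_cancel K i j n a b : 0 < n ->
  a * b <= K ^ i * (n * n) -> n <= K ^ j * b -> a <= K ^ (i + j) * n.
Proof.
move=> n0 ab nb; rewrite -(leq_pmul2r n0).
apply: (@leq_trans (a * (K ^ j * b))); first by rewrite leq_mul2l nb orbT.
rewrite mulnCA expnD (mulnC (K ^ i)) -!mulnA leq_mul2l ab orbT //.
Qed.

(** By Cauchy-Schwarz over [W], dense subsets of [W] meet substantially on average over pairs; [i0]
    does at least as well as the average. *)
Lemma popular_intersection (I T : finType) (L : {set I}) (W : {set T})
    (R : I -> {set T}) (s M : nat) :
  L != set0 -> 0 < s -> {in L, forall i, R i \subset W} ->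
  {in L, forall i, s <= M * #|R i|} -> 0 < #|W| ->
  exists2 i0, i0 \in L &
    #|L| * s ^ 2 <= M ^ 2 * #|W| * \sum_(i in L) #|R i :&: R i0|.
Proof.
move=> L0 s0 RW Rs W0.
have Lp : 0 < #|L| by rewrite card_gt0.
pose d w := #|[set i in L | w \in R i]|.
have Ed : \sum_(i in L) #|R i| = \sum_(w in W) d w.
  rewrite -exchange_card; apply: eq_bigr => i iL; apply: eq_card => w.
  by rewrite !inE; case: (boolP (w \in R i)) => [/(subsetP (RW i iL)) ->|]; rewrite ?andbF.
have Ed2 : \sum_(w in W) d w ^ 2 = \sum_(i0 in L) \sum_(i in L) #|R i :&: R i0|.
  under [RHS]eq_bigr => i0 i0L.
    have -> : \sum_(i in L) #|R i :&: R i0| = \sum_(w in W) (w \in R i0) * d w.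
      under [RHS]eq_bigr do rewrite mulnC /d -sum1_card big_distrl /=.
      rewrite (exchange_big_dep (mem L)) /=; last by move=> w i _; rewrite inE => /andP[].
      apply: eq_bigr => i iL; rewrite -sum1_card big_mkcond [RHS]big_mkcond /=.
      apply: eq_bigr => w _; rewrite !inE iL /=.
      case: (boolP (w \in R i)) => [/(subsetP (RW i iL)) ->|]; last by rewrite andbF.
      by case: (w \in R i0).
    over.
  rewrite exchange_big /=; apply: eq_bigr => w _.
  rewrite -big_distrl /= -mulnn; congr (_ * _).
  rewrite /d -sum1_card big_mkcond [RHS]big_mkcond /=.
  by apply: eq_bigr => i _; rewrite inE; case: (i \in L) => //; case: (_ \in _).
have h1 : #|L| * s <= M * \sum_(w in W) d w.
  rewrite -Ed big_distrr /= -sum_nat_const; exact: leq_sum.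
have h2 := sum_nat_cauchy_set W d; rewrite Ed2 in h2.
have [] := @sum_nat_pigeon _ L (fun=> #|L| * s ^ 2)
   (fun i0 => M ^ 2 * #|W| * \sum_(i in L) #|R i :&: R i0|).
- by rewrite sum_nat_const muln_gt0 Lp muln_gt0 Lp expn_gt0 s0.
- rewrite sum_nat_const -big_distrr /= mulnA mulnn -expnMn.
  apply: (@leq_trans ((M * \sum_(w in W) d w) ^ 2)); first by rewrite leq_exp2r.
  by rewrite expnMn -mulnA leq_mul2l h2 orbT.
by move=> i0 i0L [_ h]; exists i0.
Qed.

(** For each [l], Balog-Szemeredi-Gowers gives a large rectangle [R l] in [setX V0 V1] with a small
    sum of its first side and [l] times its second. Some [R l0] meets many other rectangles in large
    sets, and triangle inequalities through the common part compare [l |*| Y] with [l0 |*| Y]. So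
    [l / l0] nearly preserves [Y], and [no_approximate_subfield] applies. *)
Lemma dilate_sums_structure : exists c, forall (F : finFieldType)
    (V0 V1 Lam : {set F}) (S : F -> {set F}) (K n : nat),
  1 < K -> 0 < n -> #|V0| <= K * n -> #|V1| <= K * n -> n <= K * #|Lam| ->
  {in Lam, forall l, [/\ l != 0%R, #|S l| <= K * n &
     n ^ 2 <= K * #|[set p in setX V0 V1 | (p.1 + l * p.2)%R \in S l]|]} ->
  #|F| ^ 2 <= K * n ^ 5 -> n ^ 5 <= K * #|F| ^ 2 -> n <= K ^ c.
Proof.
(* 400 is the exponent of [no_approximate_subfield], which is applied with [K ^ 336], the loss
   reached in [t4]. *)
exists (336 * 400) => F V0 V1 Lam S K n K1 n0 V0n V1n Lamn HS qn nq.
have Kp : 0 < K by lia.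
have leK a b : a <= b -> K ^ a <= K ^ b by move=> ab; rewrite leq_pexp2l.
have K2 a : 2 * K ^ a <= K ^ a.+1 by rewrite expnS leq_mul.
have m0 : 0 < K * n by rewrite muln_gt0 Kp.
have Lam0 : Lam != set0.
  by rewrite -card_gt0; move: Lamn n0; case: #|Lam|; rewrite ?muln0; lia.
(* Membership in [Lam] stands under the existential so that one choice function serves all [l]. The
   theorem is run with [m = K * n], which turns the density [K] into [K ^ 3]. *)
have ex l : exists RRl : {set F} * {set F}, l \in Lam ->
    [/\ RRl.1 \subset V0, RRl.2 \subset V1, n <= K ^ 12 * #|RRl.1|,
      n <= K ^ 12 * #|RRl.2| & #|RRl.1 |+| l |*| RRl.2| <= K ^ 52 * n].
  have [lL|] := boolP (l \in Lam); last by exists (set0, set0).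
  have [l0 Sl El] := HS l lL.
  have K31 : 1 < K ^ 3 by rewrite -(exp1n 3) ltn_exp2r.
  have [||A' [B' [A'A B'B A'm B'm ABm]]] :=
      @balog_szemeredi_gowers F V0 (l |*| V1) (S l) (K * n) (K ^ 3) K31 m0 V0n _ Sl.
  - exact: leq_trans (leq_card_dilate _ _) _.
  - rewrite expnMn (expnSr K 2) -mulnA leq_mul2l; apply/orP; right.
    apply: (leq_trans El); rewrite leq_mul2l; apply/orP; right.
    apply: (@leq_card_dinj _ _ _ _ (fun p => (p.1, l * p.2)%R)).
      move=> [x y]; rewrite !inE /= => /andP[/andP[-> yV] ->].
      by rewrite mem_dilate.
    by move=> [x y] [x' y'] _ _ /= [-> /(mulfI l0) ->].
  have lV : l |*| (l^-1%R |*| B') = B'.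
    rewrite dilateM divff // /dilate -[RHS]imset_id.
    by apply: eq_imset => x; rewrite mul1r.
  exists (A', l^-1%R |*| B'); rewrite /= lV => _; split=> //.
  + apply: subset_trans (dilateS _ B'B) _; rewrite dilateM mulVf // /dilate.
    apply/subsetP => _ /imsetP[x xV ->]; by rewrite mul1r.
  + rewrite (expnM _ 3 4); apply: leq_trans A'm; by rewrite leq_pmull.
  + rewrite card_dilate ?invr_eq0 // (expnM _ 3 4); apply: leq_trans B'm.
    by rewrite leq_pmull.
  + apply: (leq_trans ABm); rewrite -expnM mulnA -expnSr.
    by rewrite leq_mul2r leK ?orbT.
have [RR HR] := fin_all_exists ex.
pose R l := setX (RR l).1 (RR l).2.
pose W := setX V0 V1.
have RW : {in Lam, forall l, R l \subset W}.
  by move=> l /HR[h1 h2 _ _ _]; apply: setXS.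
have Rbig : {in Lam, forall l, n ^ 2 <= K ^ 24 * #|R l|}.
  move=> l /HR[_ _ h1 h2 _]; rewrite cardsX -mulnn (expnD _ 12 12) mulnACA.
  exact: leq_mul.
have Wle : #|W| <= K ^ 2 * n ^ 2 by rewrite cardsX -expnMn -mulnn leq_mul.
have [l0 l0L hl0] : exists2 l0, l0 \in Lam &
    #|Lam| * n ^ 2 <= K ^ 50 * \sum_(l in Lam) #|R l :&: R l0|.
  have n20 : 0 < n ^ 2 by rewrite expn_gt0 n0.
  have W0 : 0 < #|W|.
    have /set0Pn[l lL] := Lam0; apply: leq_trans (subset_leq_card (RW l lL)).
    have := leq_trans n20 (Rbig l lL); by rewrite muln_gt0 => /andP[].
  have [l0 l0L h] := popular_intersection Lam0 n20 RW Rbig W0.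
  exists l0 => //; rewrite -(leq_pmul2r n20) -mulnA mulnn.
  apply: (leq_trans h); rewrite -expnM; move: (\sum_(l in Lam) _) => Sg.
  apply: (@leq_trans (K ^ 48 * (K ^ 2 * n ^ 2) * Sg)).
    by rewrite leq_mul2r leq_mul2l Wle !orbT.
  by rewrite (mulnA (K ^ 48)) -expnD mulnAC.
have [XV0 YV1 nX nY XYn] := HR l0 l0L.
set X := (RR l0).1 in XV0 nX XYn; set Y := (RR l0).2 in YV1 nY XYn.
have [l00 _ _] := HS l0 l0L.
pose Lam' := [set l in Lam | n ^ 2 <= 2 * K ^ 50 * #|R l :&: R l0|].
have Lam'n : n <= K ^ 54 * #|Lam'|.
  have h1 := sum_nat_popular (leqnn _) hl0.
  have h2 : \sum_(l in Lam') #|R l :&: R l0| <= #|Lam'| * (K ^ 2 * n ^ 2).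
    rewrite -sum_nat_const; apply: leq_sum => l _; apply: leq_trans Wle.
    by apply: subset_leq_card; apply: subset_trans (subsetIr _ _) (RW _ l0L).
  have h3 : #|Lam| * n ^ 2 <= K ^ 53 * #|Lam'| * n ^ 2.
    apply: (leq_trans h1); apply: (@leq_trans (K ^ 51 * (#|Lam'| * (K ^ 2 * n ^ 2)))).
      by rewrite leq_mul.
    by rewrite (expnD _ 51 2); move: (K ^ 51) (K ^ 2) (n ^ 2) #|Lam'|; lia.
  rewrite leq_pmul2r ?expn_gt0 ?n0 // in h3.
  by apply: (leq_trans Lamn); rewrite (expnS _ 53) -mulnA leq_mul2l h3 orbT.
have n2 : n ^ 2 = n * n by rewrite mulnn.
have DY : #|Y |+| |-| Y| <= K ^ 116 * n.
  rewrite -(card_dilate _ l00) dilate_sumset dilate_opp.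
  apply: (@leq_cancel K 104 12 n _ _ n0 _ nX).
  apply: leq_trans (ruzsa_triangle_add _ _ _) _.
  rewrite (sumsetC (l0 |*| Y)); apply: leq_trans (leq_mul XYn XYn) _.
  by rewrite mulnACA -expnD.
have YK : #|Y| <= K * n := leq_trans (subset_leq_card YV1) V1n.
have XK : #|X| <= K * n := leq_trans (subset_leq_card XV0) V0n.
pose T := [set (l / l0)%R | l in Lam'].
have cT : #|T| = #|Lam'|.
  by rewrite card_imset //; apply: mulIf; rewrite invr_eq0.
have K336 : 1 < K ^ 336 by rewrite -(exp1n 336) ltn_exp2r.
rewrite expnM; apply: (@no_approximate_subfield F Y T (K ^ 336) n) => //.
- by apply: (leq_trans nY); rewrite leq_mul2r leK ?orbT.
- by apply: (leq_trans YK); rewrite leq_mul2r (leK 1) ?orbT.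
- by apply: (leq_trans DY); rewrite leq_mul2r leK ?orbT.
- by rewrite cT; apply: (leq_trans Lam'n); rewrite leq_mul2r leK ?orbT.
- move=> _ /imsetP[l + ->]; rewrite inE => /andP[lL lbig].
  have [XlV0 YlV1 _ _ XYl] := HR l lL; have [lnz _ _] := HS l lL.
  set Xi := (RR l).1 :&: X; set Yi := (RR l).2 :&: Y.
  have Eint : R l :&: R l0 = setX Xi Yi.
    by apply/setP => -[x y]; rewrite !inE /= andbACA.
  rewrite Eint cardsX n2 in lbig.
  have {}lbig : n * n <= K ^ 51 * (#|Xi| * #|Yi|).
    by apply: (leq_trans lbig); rewrite leq_mul2r K2 orbT.
  have Xin : n <= K ^ 52 * #|Xi|.
    have : #|Yi| <= K * n.
      by apply: leq_trans YK; apply: subset_leq_card; apply: subsetIr.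
    move=> Yin; rewrite -(leq_pmul2r n0) (expnSr K 51).
    apply: (leq_trans lbig); apply: (@leq_trans (K ^ 51 * (#|Xi| * (K * n)))).
      by rewrite !leq_mul2l Yin !orbT.
    by rewrite (mulnCA #|Xi|) mulnA mulnA.
  have Yin : n <= K ^ 52 * #|Yi|.
    have : #|Xi| <= K * n.
      by apply: leq_trans XK; apply: subset_leq_card; apply: subsetIr.
    move=> Xin'; rewrite -(leq_pmul2r n0) (expnSr K 51).
    apply: (leq_trans lbig); apply: (@leq_trans (K ^ 51 * ((K * n) * #|Yi|))).
      by rewrite leq_mul2l leq_mul2r Xin' !orbT.
    by rewrite (mulnAC K n) mulnA mulnA.
  (* Triangle inequality through [Xi], which lies in the first sides of both rectangles and so has
     small sums with [l |*| Yi] and with [l0 |*| Y]. *)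
  have t2 : #|l |*| Yi |+| |-| (l0 |*| Y)| <= K ^ 156 * n.
    apply: (@leq_cancel K 104 52 n _ _ n0 _ Xin).
    apply: leq_trans (ruzsa_triangle_add _ _ _) _.
    rewrite (sumsetC (l |*| Yi)) (expnD _ 52 52) mulnACA.
    apply: leq_mul; [apply: leq_trans XYl|apply: leq_trans XYn];
      apply: subset_leq_card; apply: sumsetS => //; rewrite ?subsetIl ?subsetIr //.
    by apply: dilateS; apply: subsetIl.
  (* Triangle inequality through [l |*| Yi]: the small difference set of [Y] allows the passage from
     [Yi] to all of [Y]. *)
  have t3 : #|l |*| Y |+| |-| (l0 |*| Y)| <= K ^ 324 * n.
    have Yin' : n <= K ^ 52 * #|l |*| Yi| by rewrite card_dilate.
    apply: (@leq_cancel K 272 52 n _ _ n0 _ Yin').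
    apply: leq_trans (ruzsa_triangle _ _ _) _.
    rewrite (expnD _ 116 156) mulnACA; apply: leq_mul => //.
    apply: leq_trans DY; rewrite -dilate_opp -dilate_sumset card_dilate //.
    apply: subset_leq_card; apply: sumsetS => //; apply: imsetS.
    exact: subsetIr.
  have Yn0 : Y != set0.
    by apply: contraTneq nY => ->; rewrite cards0 muln0 -ltnNge.
  have A0 : |-| (l0 |*| Y) != set0.
    by rewrite -card_gt0 card_oppset card_dilate // card_gt0.
  have t4 : #|sumset (oppset (l0 |*| Y)) (l |*| Y)| <= K ^ 336 * #|oppset (l0 |*| Y)|.
    rewrite sumsetC card_oppset card_dilate //; apply: (leq_trans t3).
    by rewrite (expnD _ 324 12) -mulnA leq_mul2l nY orbT.
  have [Z [_ ZK Zc]] := ruzsa_covering A0 t4.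
  exists (l0^-1%R |*| Z); first exact: leq_trans (leq_card_dilate _ _) _.
  have -> : (l / l0)%R |*| Y = l0^-1%R |*| (l |*| Y) by rewrite dilateM mulrC.
  apply: subset_trans (dilateS _ Zc) _.
  rewrite oppsetK !dilate_sumset dilate_opp !dilateM mulVf //.
  have -> : 1%R |*| Y = Y.
    by rewrite /dilate -[RHS]imset_id; apply: eq_imset => x; rewrite mul1r.
  by rewrite (sumsetC _ Y).
- by apply: (leq_trans qn); rewrite leq_mul2r (leK 1) ?orbT.
- by apply: (leq_trans nq); rewrite leq_mul2r (leK 1) ?orbT.
Qed.

Lemma card_offdiag (T : finType) (A : {set T}) :
  #|[set p in setX A A | p.1 != p.2]| = #|A| * (#|A| - 1).
Proof.
rewrite (card_setX_filter _ _ (fun x y => x != y)) -sum_nat_const.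
apply: eq_bigr => x xA; rewrite -[#|A|](cardsID [set x]).
have -> : A :&: [set x] = [set x] by apply/setIidPr; rewrite sub1set.
rewrite cards1 addKn; apply: eq_card => y.
by rewrite !inE andbC eq_sym.
Qed.

(** [V u] is the column of points above [u] and [y] codes an affine graph. A graph is determined by
    its heights over two columns [u0] and [u1], and its height over a third is a weighted mean of
    these. Many graphs therefore put many sums [v0 + lam * v1] into a dilate of [V u], and [lam] is
    the dilation factor. *)
Lemma affine_incidence_structure : exists c, forall (F : finFieldType)
    (U : {set F}) (V : F -> {set F}) (L : {set F * F}) (K n : nat),
  1 < K -> 0 < n -> #|U| <= K * n -> {in U, forall u, #|V u| <= K * n} ->
  #|L| <= K * n ^ 2 ->
  n ^ 3 <= K * \sum_(y in L) #|[set u in U | (y.1 + y.2 * u)%R \in V u]| ->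
  #|F| ^ 2 <= K * n ^ 5 -> n ^ 5 <= K * #|F| ^ 2 -> n <= K ^ c.
Proof.
have [c Hc] := dilate_sums_structure.
exists (16 * c + 5) => F U V L K n K1 n0 Un Vn Ln big qn nq.
have Kp : 0 < K by lia.
have leK a b : a <= b -> K ^ a <= K ^ b by move=> ab; rewrite leq_pexp2l.
have K2 a : 2 * K ^ a <= K ^ a.+1 by rewrite expnS leq_mul.
(* For larger [n], each graph in [L'] below meets at least four columns, so its number of triples of
   distinct columns is comparable to a cube. *)
have [small|/ltnW nbig] := leqP n (8 * K ^ 2).
  apply: (leq_trans small); apply: (@leq_trans (K ^ 5)); last by rewrite leK ?leq_addl.
  by rewrite (expnD _ 3 2) leq_mul2r (@leq_exp2r 2 K 3) ?K1 ?orbT.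
pose A (y : F * F) := [set u in U | (y.1 + y.2 * u)%R \in V u].
have {}big : n ^ 3 <= K * \sum_(y in L) #|A y| := big.
pose L' := [set y in L | n <= 2 * K ^ 2 * #|A y|].
have bigL' : K * n ^ 3 <= 2 * K ^ 2 * \sum_(y in L') #|A y|.
  apply: sum_nat_popular.
    by rewrite (expnSr n 2) mulnA leq_mul2r Ln orbT.
  by rewrite -mulnn -mulnA leq_mul2l big orbT.
have big3 : n ^ 5 <= K ^ 11 * \sum_(y in L) #|A y| * (#|A y| - 1) * (#|A y| - 2).
  have h1 : n ^ 2 * \sum_(y in L') #|A y| <=
      16 * K ^ 4 * \sum_(y in L) #|A y| * (#|A y| - 1) * (#|A y| - 2).
    rewrite !big_distrr /=.
    apply: (@leq_trans (\sum_(i in L') 16 * K ^ 4 * (#|A i| * (#|A i| - 1) * (#|A i| - 2)))).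
      apply: leq_sum => y; rewrite inE => /andP[_ hy].
      have a4 : 4 <= #|A y|.
        have K20 : 0 < 2 * K ^ 2 by rewrite muln_gt0 expn_gt0 Kp.
        rewrite -(leq_pmul2l K20); apply: leq_trans hy; apply: leq_trans nbig.
        by rewrite mulnAC.
      have h2 : n ^ 2 <= 4 * K ^ 4 * #|A y| ^ 2.
        have -> : 4 * K ^ 4 * #|A y| ^ 2 = (2 * K ^ 2 * #|A y|) ^ 2.
          by rewrite (expnMn (2 * K ^ 2)) expnMn -expnM.
        by rewrite leq_sqr.
      have h3 : #|A y| ^ 2 <= 4 * ((#|A y| - 1) * (#|A y| - 2)).
        by move: a4; rewrite -mulnn; nia.
      rewrite mulnC -(mulnA #|A y|) mulnCA leq_mul2l; apply/orP; right.
      apply: (leq_trans h2).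
      apply: leq_trans (leq_mul (leqnn _) h3) _.
      by move: (K ^ 4) ((#|A y| - 1) * (#|A y| - 2)) => a b; lia.
    rewrite [X in _ <= X](big_setID L') /=.
    have -> : L :&: L' = L' by apply/setIidPr/subsetP => y; rewrite inE => /andP[].
    exact: leq_addr.
  move: (\sum_(y in L) _) h1 => Sg h1.
  have h2 : K * n ^ 5 <= 2 * K ^ 2 * (16 * K ^ 4 * Sg).
    rewrite (expnD _ 3 2) mulnA.
    apply: leq_trans (leq_mul bigL' (leqnn _)) _.
    by rewrite -mulnA (mulnC _ (n ^ 2)) leq_mul2l h1 orbT.
  rewrite -(leq_pmul2l Kp); apply: (leq_trans h2).
  have -> : 2 * K ^ 2 * (16 * K ^ 4 * Sg) = 2 ^ 5 * (K ^ 6 * Sg).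
    by rewrite (expnD _ 2 4) -[2 ^ 5]/32; move: (K ^ 2) (K ^ 4) => a b; lia.
  have -> : K * (K ^ 11 * Sg) = K ^ 6 * (K ^ 6 * Sg).
    by rewrite mulnA -expnS mulnA -expnD.
  rewrite leq_mul2r; apply/orP; right; apply: leq_trans (leK 5 6 isT).
  by rewrite leq_exp2r.
pose PP := [set p in setX U U | p.1 != p.2].
pose Lp (p : F * F) := [set y in L | (p.1 \in A y) && (p.2 \in A y)].
have {}big3 : n ^ 5 <= K ^ 11 * \sum_(p in PP) \sum_(y in Lp p) (#|A y| - 2).
  apply: (leq_trans big3); rewrite leq_mul2l; apply/orP; right.
  rewrite (exchange_big_dep (mem L)) /=; last by move=> p y _; rewrite inE => /andP[].
  apply: leq_sum => y yL; rewrite sum_nat_const leq_mul2r -card_offdiag.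
  apply/orP; right; apply: subset_leq_card; apply/subsetP => -[p1' p2'].
  rewrite inE in_setX => /andP[/andP[p1 p2] p12]; apply/andP; split.
    rewrite inE in_setX p12 andbT.
    by move: p1 p2; rewrite !inE => /andP[-> _] /andP[-> _].
  by rewrite inE yL p1 p2.
(* Triples of distinct columns met by one graph are grouped by their first two members, and an
   average pair is fixed. *)
have [[u0 u1]] : exists2 p, p \in PP & 0 < K ^ 13 * \sum_(y in Lp p) (#|A y| - 2) /\
    n ^ 3 <= K ^ 13 * \sum_(y in Lp p) (#|A y| - 2).
  apply: sum_nat_pigeon.
    rewrite sum_nat_const muln_gt0 [0 < n ^ 3]expn_gt0 n0 andbT card_gt0.
    apply: contraTneq big3 => ->.
    by rewrite big_set0 muln0 -ltnNge expn_gt0 n0.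
  rewrite sum_nat_const -big_distrr /=.
  apply: (@leq_trans (K ^ 2 * n ^ 5)); last first.
    by rewrite (expnD _ 2 11) -mulnA leq_mul2l big3 orbT.
  rewrite (expnD n 2 3) mulnA leq_mul2r -expnMn -mulnn; apply/orP; right.
  apply: (@leq_trans #|setX U U|); last by rewrite cardsX leq_mul.
  by apply: subset_leq_card; apply/subsetP => p; rewrite inE => /andP[].
rewrite inE in_setX /= => /andP[/andP[u0U u1U] u01] [_ bigp].
pose U' := U :\: [set u0; u1].
pose g u := #|[set y in Lp (u0, u1) | u \in A y]|.
have bigg : n ^ 3 <= K ^ 13 * \sum_(u in U') g u.
  apply: (leq_trans bigp); rewrite leq_mul2l; apply/orP; right.
  rewrite -(exchange_card (Lp (u0, u1)) U' (fun y u => u \in A y)).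
  apply: leq_sum => y; rewrite inE /= => /andP[_ /andP[y0 y1]].
  rewrite leq_subLR -[X in X <= _](cardsID [set u0; u1]); apply: leq_add.
    apply: leq_trans (subset_leq_card (subsetIr _ _)) _.
    by rewrite cards2; case: (_ == _).
  apply: subset_leq_card; apply/subsetP => u; rewrite 2!inE => /andP[nu uA].
  rewrite uA andbT in_setD nu.
  by move: uA; rewrite inE => /andP[].
have L_inj : injective (fun y : F * F => (y.1 + y.2 * u0, y.1 + y.2 * u1)%R).
  move=> [a b] [a' b'] /= [e0 e1].
  have d0 : (u0 - u1)%R != 0%R by rewrite subr_eq0.
  have eb : b = b'.
    apply: (mulIf d0).
    have -> : (b * (u0 - u1) = (a + b * u0) - (a + b * u1))%R by ring.
    by rewrite e0 e1; ring.
  by move: e0; rewrite eb => /addIr ->.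
have g_le u : g u <= #|setX (V u0) (V u1)|.
  apply: (@leq_card_dinj _ _ _ _ (fun y : F * F => (y.1 + y.2 * u0, y.1 + y.2 * u1)%R)).
    move=> y; rewrite !inE /= => /andP[/and3P[_ /andP[_ h0] /andP[_ h1]] _].
    by rewrite h0.
  by move=> y y' _ _; apply: L_inj.
pose U'' := [set u in U' | n ^ 2 <= 2 * K ^ 14 * g u].
have U''n : n <= K ^ 16 * #|U''|.
  have h1 : K * n ^ 3 <= 2 * K ^ 14 * \sum_(u in U'') g u.
    apply: sum_nat_popular.
      rewrite (expnS n 2) mulnA leq_mul2r; apply/orP; right.
      by apply: leq_trans Un; apply: subset_leq_card; apply: subsetDl.
    by rewrite (expnS K 13) -mulnA leq_mul2l bigg orbT.
  have h2 : \sum_(u in U'') g u <= #|U''| * (K ^ 2 * n ^ 2).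
    rewrite -sum_nat_const; apply: leq_sum => u _; apply: (leq_trans (g_le u)).
    by rewrite cardsX -expnMn -mulnn leq_mul ?Vn.
  have h3 : K * n ^ 3 <= K ^ 15 * (#|U''| * (K ^ 2 * n ^ 2)).
    by apply: (leq_trans h1); apply: leq_mul.
  have K0n2 : 0 < K * n ^ 2 by rewrite muln_gt0 Kp expn_gt0 n0.
  rewrite -(leq_pmul2l K0n2); apply: leq_trans (leq_trans h3 _).
    by rewrite -mulnA -expnSr.
  rewrite (expnS K 15) (expnS K 1) expn1.
  by move: (K ^ 15) (n ^ 2) #|U''| => a b d; lia.
(* The solution of [u = (u0 + lam * u1) / (1 + lam)]; the columns [u0] and [u1] were removed from
   [U'], so it is defined and nonzero. *)
pose lam u := ((u - u0) / (u1 - u))%R.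
have lam1 u : u \in U'' -> [/\ (1 + lam u != 0)%R, lam u != 0%R &
    ((u0 + lam u * u1) / (1 + lam u))%R = u].
  rewrite inE in_setD !inE => /andP[/andP[+ _] _]; rewrite negb_or => /andP[h0 h1].
  have n1 : (u1 - u != 0)%R by rewrite subr_eq0 eq_sym.
  have e : (1 + lam u = (u1 - u0) / (u1 - u))%R.
    by rewrite /lam -{1}(divff n1) -mulrDl; congr (_ / _)%R; ring.
  have n2 : (u1 - u0 != 0)%R by rewrite subr_eq0 eq_sym.
  split; first by rewrite e mulf_neq0 ?invr_eq0.
    by rewrite mulf_neq0 ?invr_eq0 // subr_eq0.
  by rewrite e /lam; field; rewrite n1 n2.
pose S l := ((1 + l) |*| V ((u0 + l * u1) / (1 + l)))%R.
have := @Hc F (V u0) (V u1) (lam @: U'') S (K ^ 16) n.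
have le16 : K <= K ^ 16 by rewrite (leK 1).
have cL : #|lam @: U''| = #|U''|.
  rewrite card_in_imset // => u v uU vU e.
  by have [_ _ <-] := lam1 u uU; have [_ _ <-] := lam1 v vU; rewrite e.
rewrite cL -expnM => h; apply: (@leq_trans (K ^ (16 * c))); last by rewrite leK ?leq_addr.
apply: h => //.
- by rewrite -(exp1n 16) ltn_exp2r.
- by apply: leq_trans (Vn _ u0U) _; rewrite leq_mul2r le16 orbT.
- by apply: leq_trans (Vn _ u1U) _; rewrite leq_mul2r le16 orbT.
- move=> _ /imsetP[u uU'' ->]; have [l1 l0 eu] := lam1 u uU''.
  move: (uU''); rewrite inE => /andP[]; rewrite in_setD => /andP[_ uU] gu.
  split=> //; rewrite /S eu.
    rewrite card_dilate //; apply: leq_trans (Vn _ uU) _.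
    by rewrite leq_mul2r le16 orbT.
  apply: (leq_trans gu); apply: leq_mul.
    by apply: leq_trans (K2 14) _; rewrite leK.
  apply: (@leq_card_dinj _ _ _ _ (fun y : F * F => (y.1 + y.2 * u0, y.1 + y.2 * u1)%R)).
    move=> y; rewrite !inE /= => /andP[/and3P[_ /andP[_ h0] /andP[_ h1]] /andP[_ hu]].
    rewrite h0 h1 /=.
    have -> : (y.1 + y.2 * u0 + lam u * (y.1 + y.2 * u1) =
        (1 + lam u) * (y.1 + y.2 * u))%R.
      have eu' : ((1 + lam u) * u = u0 + lam u * u1)%R.
        by rewrite -{2}eu mulrC divfK.
      have -> : ((1 + lam u) * (y.1 + y.2 * u) =
          (1 + lam u) * y.1 + y.2 * ((1 + lam u) * u))%R by ring.
      by rewrite eu'; ring.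
    exact: mem_dilate.
  by move=> y y' _ _; apply: L_inj.
- by apply: (leq_trans qn); rewrite leq_mul2r le16 orbT.
- by apply: (leq_trans nq); rewrite leq_mul2r le16 orbT.
Qed.

(** Indices with [a i > r] contribute at most [M / r] by the second moment, hence at most half of
    [B / k]. *)
Lemma sum_nat_unpopular (T : finType) (A : {set T}) (a : T -> nat) k M B r :
  0 < r -> B <= k * \sum_(i in A) a i -> \sum_(i in A) a i ^ 2 <= M ->
  2 * k * M <= B * r -> B <= 2 * k * \sum_(i in [set i in A | a i <= r]) a i.
Proof.
move=> r0 hB hM h.
have -> : \sum_(i in [set i in A | a i <= r]) a i = \sum_(i in A | a i <= r) a i.
  by apply: eq_bigl => i; rewrite inE.
have h1 : r * \sum_(i in A | ~~ (a i <= r)) a i <= M.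
  apply: leq_trans hM; rewrite big_distrr big_mkcondr /=.
  apply: leq_sum => i _; case: (leqP (a i) r) => //= /ltnW ri.
  by rewrite -mulnn leq_mul2r ri orbT.
have h2 : 2 * k * \sum_(i in A | ~~ (a i <= r)) a i <= B.
  rewrite -(leq_pmul2r r0); apply: leq_trans h.
  by rewrite -mulnA leq_mul2l (mulnC _ r) h1 orbT.
move: hB; rewrite (bigID (fun i => a i <= r)) /=.
move: h2; move: (\sum_(i in A | a i <= r) _) (\sum_(i in A | ~~ _) _) => x y.
by rewrite -!(mulnA 2) mulnDr; move: (k * x) (k * y); lia.
Qed.

(** The squares count pairs of elements of [A] with a common neighbour [b]; equal pairs give the
    first term, and a pair of distinct elements has at most one such [b]. *)
Lemma sum_sq_degrees (T1 T2 : finType) (A : {set T1}) (B : {set T2})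
    (G : T1 -> T2 -> bool) :
  (forall a a' b b', a != a' -> G a b -> G a' b -> G a b' -> G a' b' -> b = b') ->
  \sum_(b in B) #|[set a in A | G a b]| ^ 2
    <= \sum_(b in B) #|[set a in A | G a b]| + #|A| ^ 2.
Proof.
move=> two.
pose D b := [set p in setX A A | [&& p.1 != p.2, G p.1 b & G p.2 b]].
have sq b : #|[set a in A | G a b]| ^ 2 = #|[set a in A | G a b]| + #|D b|.
  set N := [set a in A | G a b].
  have -> : #|D b| = #|[set p in setX N N | p.1 != p.2]|.
    apply: eq_card => -[x y]; rewrite !inE /=.
    by case: (x \in A); case: (y \in A); case: (G x b); case: (G y b); case: (x == y).
  by rewrite card_offdiag -mulnn; nia.
under eq_bigr do rewrite sq.
rewrite big_split leq_add2l /=.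
rewrite (eq_bigr (fun b => #|[set p in setX A A | [&& p.1 != p.2, G p.1 b & G p.2 b]]|)) //.
rewrite -(exchange_card (setX A A) B (fun p b => [&& p.1 != p.2, G p.1 b & G p.2 b])).
rewrite -mulnn -cardsX -[X in _ <= X]muln1 -sum_nat_const.
apply: leq_sum => -[x y] _; rewrite leqNgt; apply/negP => /card_gt1P[b [b' []]].
rewrite !inE /= => /and4P[_ xy xb yb] /and4P[_ _ xb' yb'].
by rewrite (two _ _ _ _ xy xb yb xb' yb') eqxx.
Qed.

Definition pdot (F : finFieldType) (x y : F * F) : F := (x.1 * y.1 + x.2 * y.2)%R.

(** Lines missing the origin are coded by their coefficient vector, so points and lines have the
    same type and incidence is symmetric. *)
Definition incident (F : finFieldType) (x y : F * F) : bool := pdot x y == 1%R.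

Lemma incidentC (F : finFieldType) (x y : F * F) : incident x y = incident y x.
Proof. by rewrite /incident /pdot mulrC (mulrC x.2). Qed.

Lemma incident_two_points (F : finFieldType) (x x' y y' : F * F) : x != x' ->
  incident x y -> incident x' y -> incident x y' -> incident x' y' -> y = y'.
Proof.
case: x x' y y' => [x1 x2] [x1' x2'] [y1 y2] [y1' y2'] xx.
rewrite /incident /pdot /= => /eqP e1 /eqP e2 /eqP e3 /eqP e4.
apply/eqP; apply: contraTT xx => yy; rewrite negbK.
(* If this determinant is nonzero, the two lines have a single common point; if it vanishes they are
   parallel, and a common point makes them equal. *)
pose d := (y1 * y2' - y2 * y1')%R.
have d1 : (d * (x1 - x1') = 0)%R.
  have -> : (d * (x1 - x1') = y2' * ((x1 * y1 + x2 * y2) - (x1' * y1 + x2' * y2))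
    - y2 * ((x1 * y1' + x2 * y2') - (x1' * y1' + x2' * y2')))%R by rewrite /d; ring.
  by rewrite e1 e2 e3 e4 !subrr !mulr0 subrr.
have d2 : (d * (x2 - x2') = 0)%R.
  have -> : (d * (x2 - x2') = y1 * ((x1 * y1' + x2 * y2') - (x1' * y1' + x2' * y2'))
    - y1' * ((x1 * y1 + x2 * y2) - (x1' * y1 + x2' * y2)))%R by rewrite /d; ring.
  by rewrite e1 e2 e3 e4 !subrr !mulr0 subrr.
have [d0|d0] := eqVneq d 0%R.
  case/negP: yy; rewrite xpair_eqE; apply/andP; split; rewrite -subr_eq0; apply/eqP.
    have -> : (y1 - y1' = x2 * d + y1 * (1 - (x1 * y1' + x2 * y2'))
        - y1' * (1 - (x1 * y1 + x2 * y2)))%R by rewrite /d; ring.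
    by rewrite e1 e3 d0; ring.
  have -> : (y2 - y2' = - x1 * d + y2 * (1 - (x1 * y1' + x2 * y2'))
      - y2' * (1 - (x1 * y1 + x2 * y2)))%R by rewrite /d; ring.
  by rewrite e1 e3 d0; ring.
move/eqP: d1; rewrite mulf_eq0 (negPf d0) /= subr_eq0 => /eqP ->.
by move/eqP: d2; rewrite mulf_eq0 (negPf d0) /= subr_eq0 => /eqP ->.
Qed.

Lemma anisotropic (F : finFieldType) (a b : F) :
  (forall t : F, t ^+ 2 != -1)%R -> (a ^+ 2 + b ^+ 2 == 0)%R -> (a, b) = (0, 0)%R.
Proof.
move=> ns; have [->|b0] := eqVneq b 0%R.
  by rewrite expr0n addr0 expf_eq0 /= => /eqP ->.
rewrite addr_eq0 => /eqP e; case/negP: (ns (a / b)%R).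
by rewrite expr_div_n e mulNr divff // expf_neq0.
Qed.

(* The lines through [p0 = (a, b)] have slopes [s] and the projective change
   of coordinates sending [p0] to infinity makes the other lines graphs of
   affine functions of [s]. *)
Section PencilCoordinates.
Variables (F : finFieldType) (a b : F).
Let n0 := (a ^+ 2 + b ^+ 2)%R.
Hypothesis n0_neq0 : n0 != 0%R.

Definition pencil_slope (y : F * F) : F := (y.2 * a - y.1 * b)%R.
Definition pencil_height (x : F * F) : F := (n0 / (x.2 * a - x.1 * b))%R.
Definition pencil_line (y : F * F) : F * F :=
  (pencil_slope y / (1 - pdot (a, b) y),
   - pdot (a, b) y / (1 - pdot (a, b) y))%R.

Lemma pencil_ext (y y' : F * F) : pdot (a, b) y = pdot (a, b) y' ->
  pencil_slope y = pencil_slope y' -> y = y'.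
Proof.
case: y y' => [y1 y2] [y1' y2']; rewrite /pencil_slope /pdot /= => e1 e2.
congr (_, _); apply: (mulfI n0_neq0); rewrite /n0.
  have -> : ((a ^+ 2 + b ^+ 2) * y1 = a * (a * y1 + b * y2) - b * (y2 * a - y1 * b))%R by ring.
  by rewrite e1 e2; ring.
have -> : ((a ^+ 2 + b ^+ 2) * y2 = b * (a * y1 + b * y2) + a * (y2 * a - y1 * b))%R by ring.
by rewrite e1 e2; ring.
Qed.

Lemma pencil_slope_inj y y' : incident (a, b) y -> incident (a, b) y' ->
  pencil_slope y = pencil_slope y' -> y = y'.
Proof. by move=> /eqP e1 /eqP e2; apply: pencil_ext; rewrite e1 e2. Qed.

Lemma pencil_line_inj y y' : ~~ incident (a, b) y -> ~~ incident (a, b) y' ->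
  pencil_line y = pencil_line y' -> y = y'.
Proof.
rewrite /incident /pencil_line => n1 n2 [e1 e2].
have {}n1 : (1 - pdot (a, b) y != 0)%R by rewrite subr_eq0 eq_sym.
have {}n2 : (1 - pdot (a, b) y' != 0)%R by rewrite subr_eq0 eq_sym.
have e : (1 - pdot (a, b) y = 1 - pdot (a, b) y')%R.
  apply: invr_inj.
  have h (t : F) : (1 - t != 0 -> (1 - t)^-1 = 1 - - t / (1 - t))%R.
    by move=> t0; field.
  by rewrite (h _ n1) (h _ n2) e2.
apply: pencil_ext; first by move: e => /addrI /oppr_inj.
by move: e1; rewrite e => /(mulIf _); apply; rewrite invr_eq0.
Qed.

(** [key] is Lagrange's identity: [n0] times a scalar product is the product of the scalar products
    with [(a, b)] plus the product of the determinants with [(a, b)]. At [z = u] and [z = y] it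
    gives two equations in the coordinates [s] and [j] of [x]; eliminating [s] leaves [n0 / j]. *)
Lemma pencil_incidence x u y : x != (a, b) -> incident (a, b) u ->
  incident x u -> ~~ incident (a, b) y -> incident x y ->
  pencil_height x = ((pencil_line y).1 + (pencil_line y).2 * pencil_slope u)%R.
Proof.
move=> xab /eqP pu /eqP xu npy /eqP xy.
have n1 : (1 - pdot (a, b) y != 0)%R by rewrite subr_eq0 eq_sym.
pose j := (x.2 * a - x.1 * b)%R; pose s := (x.1 * a + x.2 * b)%R.
have key z : (n0 * pdot x z = s * pdot (a, b) z + j * pencil_slope z)%R.
  by rewrite /n0 /s /j /pencil_slope /pdot /=; ring.
have eu := key u; rewrite xu pu !mulr1 in eu.
have ey := key y; rewrite xy mulr1 in ey.
have j0 : j != 0%R.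
  apply: contra xab => /eqP j0; rewrite j0 mul0r addr0 in eu.
  rewrite [x]surjective_pairing; apply/eqP; congr (_, _); apply: (mulfI n0_neq0).
    have -> : (n0 * x.1 = a * s - b * j)%R by rewrite /n0 /s /j; ring.
    by rewrite -eu j0; ring.
  have -> : (n0 * x.2 = b * s + a * j)%R by rewrite /n0 /s /j; ring.
  by rewrite -eu j0; ring.
have es : s = (n0 - j * pencil_slope u)%R by rewrite eu; ring.
rewrite /pencil_height /pencil_line -/j /=.
have e : (n0 * (1 - pdot (a, b) y) = j * (pencil_slope y - pencil_slope u * pdot (a, b) y))%R.
  by rewrite mulrBr mulr1 {1}ey es; ring.
apply: (mulIf j0); rewrite divfK //; apply: (mulIf n1); rewrite e; field.
exact: n1.
Qed.

End PencilCoordinates.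

(** Pruning leaves lines [C1] with at most about [n] points, and points [P1] on about [n] lines of
    [C1]. A point [p0] whose lines carry many points is sent to infinity: the lines through it
    become columns and the other lines become affine graphs. *)
Lemma plane_incidence_structure : exists c, forall (F : finFieldType)
    (P C : {set F * F}) (K n : nat),
  (forall t : F, t ^+ 2 != -1)%R ->
  1 < K -> 0 < n -> #|P| <= K * n ^ 2 -> #|C| <= K * n ^ 2 ->
  n ^ 3 <= K * \sum_(y in C) #|[set x in P | incident x y]| ->
  #|F| ^ 2 <= K * n ^ 5 -> n ^ 5 <= K * #|F| ^ 2 -> n <= K ^ c.
Proof.
have [c Hc] := affine_incidence_structure.
exists (16 * c + 18) => F P C K n ns K1 n0 Pn Cn big qn nq.
have Kp : 0 < K by lia.
have leK a b : a <= b -> K ^ a <= K ^ b by move=> ab; rewrite leq_pexp2l.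
have K2 a : 2 * K ^ a <= K ^ a.+1 by rewrite expnS leq_mul.
have K4 a : 4 * K ^ a <= K ^ a.+2 by rewrite -[4]/(2 * 2) -mulnA; apply: leq_trans (leq_mul _ (K2 a)) (K2 _).
have [small|/ltnW nbig] := leqP n (K ^ 18).
  by apply: (leq_trans small); rewrite leK ?leq_addl.
have cardG (A B : {set F * F}) (G : F * F -> F * F -> bool) :
    \sum_(y in B) #|[set x in A | G x y]| <= #|A| * #|B|.
  rewrite mulnC -sum_nat_const; apply: leq_sum => y _; apply: subset_leq_card.
  by apply/subsetP => x; rewrite inE => /andP[].
have sq_le (A B : {set F * F}) : #|A| <= K * n ^ 2 -> #|B| <= K * n ^ 2 ->
    \sum_(y in B) #|[set x in A | incident x y]| ^ 2 <= 2 * K ^ 2 * n ^ 4.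
  move=> An Bn; have two := @incident_two_points F.
  apply: leq_trans (sum_sq_degrees A B two) _.
  have -> : 2 * K ^ 2 * n ^ 4 = (K * n ^ 2) * (K * n ^ 2) + (K * n ^ 2) * (K * n ^ 2).
    by rewrite mulnn expnMn -expnM addnn -mul2n mulnA.
  apply: leq_add; last by rewrite -mulnn leq_mul.
  by apply: leq_trans (cardG _ _ _) _; apply: leq_mul.
pose r y := #|[set x in P | incident x y]|.
pose C1 := [set y in C | r y <= K ^ 5 * n].
have C1n : #|C1| <= K * n ^ 2.
  by apply: leq_trans Cn; apply: subset_leq_card; apply/subsetP => y; rewrite inE => /andP[].
have big1 : n ^ 3 <= K ^ 2 * \sum_(y in C1) r y.
  apply: (@leq_trans (2 * K * \sum_(y in C1) r y)); last first.
    by rewrite leq_mul2r (K2 1) orbT.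
  apply: (@sum_nat_unpopular _ C r K (2 * K ^ 2 * n ^ 4) (n ^ 3) (K ^ 5 * n)) => //.
  - by rewrite muln_gt0 expn_gt0 Kp.
  - exact: sq_le.
  have -> : 2 * K * (2 * K ^ 2 * n ^ 4) = 4 * K ^ 3 * n ^ 4.
    by rewrite (expnS K 2); move: (K ^ 2) (n ^ 4); clear; lia.
  by rewrite mulnCA -expnSr leq_mul2r K4 orbT.
pose dg x := #|[set y in C1 | incident x y]|.
have sumdg (A : {set F * F}) : \sum_(x in A) dg x = \sum_(y in C1) #|[set x in A | incident x y]|.
  exact: exchange_card.
pose Pa := [set x in P | n <= 2 * K ^ 3 * dg x].
have Pan : #|Pa| <= K * n ^ 2.
  by apply: leq_trans Pn; apply: subset_leq_card; apply/subsetP => y; rewrite inE => /andP[].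
have big2 : n ^ 3 <= K ^ 3 * \sum_(x in Pa) dg x.
  have : K * n ^ 3 <= 2 * K ^ 3 * \sum_(x in Pa) dg x.
    apply: sum_nat_popular.
      by rewrite (expnSr n 2) mulnA leq_mul2r Pn orbT.
    by rewrite sumdg (expnS K 2) -mulnA leq_mul2l big1 orbT.
  move=> h; rewrite -(leq_pmul2l Kp); apply: (leq_trans h).
  by rewrite mulnA -expnS leq_mul2r K2 orbT.
pose P1 := [set x in Pa | dg x <= K ^ 7 * n].
have P1n : #|P1| <= K * n ^ 2.
  by apply: leq_trans Pan; apply: subset_leq_card; apply/subsetP => y; rewrite inE => /andP[].
have big3 : n ^ 3 <= K ^ 4 * \sum_(x in P1) dg x.
  apply: (@leq_trans (2 * K ^ 3 * \sum_(x in P1) dg x)); last first.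
    by rewrite leq_mul2r K2 orbT.
  apply: (@sum_nat_unpopular _ Pa dg (K ^ 3) (2 * K ^ 2 * n ^ 4) (n ^ 3) (K ^ 7 * n)) => //.
  - by rewrite muln_gt0 expn_gt0 Kp.
  - rewrite (eq_bigr (fun x => #|[set y in C1 | incident y x]| ^ 2)); first exact: sq_le.
    by move=> x _; congr (_ ^ 2); apply: eq_card => y; rewrite !inE incidentC.
  have -> : 2 * K ^ 3 * (2 * K ^ 2 * n ^ 4) = 4 * K ^ 5 * n ^ 4.
    by rewrite (expnD K 3 2); move: (K ^ 3) (K ^ 2) (n ^ 4); clear; lia.
  by rewrite mulnCA -expnSr leq_mul2r K4 orbT.
pose r1 y := #|[set x in P1 | incident x y]|.
have r1r y : r1 y <= r y.
  apply: subset_leq_card; apply/subsetP => x; rewrite !inE => /andP[+ ->].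
  by case/andP=> /andP[-> _] _.
pose U0 p := [set y in C1 | incident p y].
pose t p := \sum_(y in U0 p) r1 y.
(* The sum counts pairs of points of [P1] on a common line of [C1], which is the second moment of
   [r1]. *)
have big4 : n ^ 4 <= K ^ 9 * \sum_(p in P1) t p.
  have -> : \sum_(p in P1) t p = \sum_(y in C1) r1 y ^ 2.
    rewrite (exchange_big_dep (mem C1)) /=; last first.
      by move=> p y _; rewrite inE => /andP[].
    apply: eq_bigr => y yC1; rewrite sum_nat_const -mulnn; congr (_ * _).
    apply: eq_card => x; rewrite -[LHS]/((x \in P1) && (y \in U0 x)) [in RHS]inE.
    by rewrite [y \in U0 x]inE yC1.
  have h1 := sum_nat_cauchy_set C1 r1.
  have h2 : (n ^ 3) ^ 2 <= (K ^ 4 * \sum_(y in C1) r1 y) ^ 2.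
    by rewrite leq_sqr -sumdg.
  have n2 : 0 < n ^ 2 by rewrite expn_gt0 n0.
  rewrite -(leq_pmul2r n2) -expnD; move: h2; rewrite -expnM expnMn -expnM => h2.
  apply: (leq_trans h2); move: h1; move: (\sum_(y in C1) r1 y ^ 2) => Sg h1.
  apply: leq_trans (leq_mul (leqnn _) h1) _.
  apply: leq_trans (leq_mul (leqnn _) (leq_mul C1n (leqnn _))) _.
  rewrite (expnSr K 8); move: (K ^ 8) (n ^ 2) => x y; lia.
have [p0 p0P1 tp0] : exists2 p, p \in P1 & n ^ 2 <= K ^ 10 * t p.
  have [||p pP [_ h]] := @sum_nat_pigeon _ P1 (fun=> n ^ 2) (fun p => K ^ 10 * t p).
  - rewrite sum_nat_const muln_gt0 [0 < n ^ 2]expn_gt0 n0 andbT card_gt0.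
    by apply: contraTneq big4 => ->; rewrite big_set0 muln0 -ltnNge expn_gt0 n0.
  - rewrite sum_nat_const -big_distrr /=.
    apply: leq_trans (leq_mul P1n (leqnn _)) _.
    by rewrite -mulnA -expnD (expnS K 9) -mulnA leq_mul2l big4 orbT.
  by exists p.
pose Q y := [set x in P1 | incident x y && (x != p0)].
have U0n : #|U0 p0| <= K ^ 7 * n by move: p0P1; rewrite inE => /andP[].
have big5 : n ^ 2 <= K ^ 11 * \sum_(u in U0 p0) #|Q u|.
  have h1 : t p0 <= \sum_(u in U0 p0) #|Q u| + #|U0 p0|.
    rewrite -sum1_card -big_split /=; apply: leq_sum => u uU.
    rewrite /r1 -(cardsID [set p0]) addnC leq_add //.
      apply: subset_leq_card; apply/subsetP => x; rewrite 2!inE.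
      case/andP => xp; rewrite inE => /andP[xP1 xu].
      by rewrite inE xP1 xu xp.
    apply: leq_trans (subset_leq_card (subsetIr _ _)) _.
    by rewrite cards1.
  have h2 : 2 * (K ^ 10 * #|U0 p0|) <= n ^ 2.
    apply: leq_trans (leq_mul (leqnn 2) (leq_mul (leqnn _) U0n)) _.
    rewrite (mulnA (K ^ 10)) -expnD (mulnA 2) -mulnn leq_mul2r; apply/orP; right.
    exact: leq_trans (K2 17) nbig.
  have h3 : K ^ 10 * t p0 <= K ^ 10 * \sum_(u in U0 p0) #|Q u| + K ^ 10 * #|U0 p0|.
    by rewrite -mulnDr leq_mul2l h1 orbT.
  apply: (@leq_trans (2 * (K ^ 10 * \sum_(u in U0 p0) #|Q u|))).
    move: tp0 h2 h3; move: (K ^ 10 * t p0) (K ^ 10 * #|U0 p0|) (K ^ 10 * \sum_(u in U0 p0) _).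
    by move: (n ^ 2); clear; lia.
  by rewrite mulnA leq_mul2r K2 orbT.
pose C2 := C1 :\: U0 p0.
pose dg2 x := #|[set y in C2 | incident x y]|.
have big6 : n ^ 3 <= K ^ 16 * \sum_(u in U0 p0) \sum_(x in Q u) dg2 x.
  rewrite (expnSr n 2) (expnD K 11 5) -mulnA.
  apply: leq_trans (leq_mul big5 (leqnn n)) _; rewrite -mulnA leq_mul2l; apply/orP; right.
  rewrite big_distrl big_distrr /=; apply: leq_sum => u uU.
  rewrite big_distrr -sum_nat_const /=; apply: leq_sum => x xQ.
  have [xP1 xu xp0] : [/\ x \in P1, incident x u & x != p0].
    by move: xQ; rewrite inE => /and3P.
  (* Only [u] passes through both [x] and [p0], so discarding the pencil of [p0] costs [x] a single
     line. *)
  have h1 : dg x <= dg2 x + 1.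
    rewrite /dg -(cardsID [set u]) addnC leq_add //; last first.
      by apply: leq_trans (subset_leq_card (subsetIr _ _)) _; rewrite cards1.
    apply: subset_leq_card; apply/subsetP => y; rewrite 2!inE => /andP[nyu].
    rewrite inE => /andP[yC1 xy]; rewrite inE xy andbT in_setD yC1 andbT.
    apply: contra nyu; rewrite inE => /andP[_ py].
    move: uU; rewrite inE => /andP[_ pu].
    by rewrite (incident_two_points xp0 xy py xu pu).
  have h2 : n <= 2 * K ^ 3 * dg x by move: xP1; rewrite !inE => /andP[/andP[_]].
  have h3 : 2 * K ^ 3 * dg x <= 2 * K ^ 3 * dg2 x + 2 * K ^ 3.
    by rewrite -[X in _ <= _ + X]muln1 -mulnDr leq_mul2l h1 orbT.
  have h4 : 2 * (2 * K ^ 3) <= n.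
    by rewrite mulnA; apply: leq_trans (K4 3) (leq_trans _ nbig); rewrite leK.
  apply: (@leq_trans (4 * K ^ 3 * dg2 x)); last by rewrite leq_mul2r K4 orbT.
  rewrite -[4]/(2 * 2) -!(mulnA 2); rewrite -!(mulnA 2) in h2 h3 h4.
  by move: h2 h3 h4; move: (K ^ 3 * dg x) (K ^ 3 * dg2 x) (K ^ 3); clear; lia.
have [u0 u0U] : exists u0, u0 \in U0 p0.
  apply/set0Pn; apply: contraTneq big5 => ->.
  by rewrite big_set0 muln0 -ltnNge expn_gt0 n0.
pose a := p0.1; pose b := p0.2.
have p0E : p0 = (a, b) by apply: surjective_pairing.
(* [p0] lies on a line [x.y = 1], so it is not the origin, and there are no isotropic vectors. *)
have ab0 : (a ^+ 2 + b ^+ 2 != 0)%R.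
  apply/negP => /(anisotropic ns) e; move: u0U; rewrite inE p0E e /incident /pdot /=.
  by rewrite !mul0r addr0 eq_sym oner_eq0 andbF.
have U0P u : u \in U0 p0 -> incident (a, b) u by rewrite inE p0E => /andP[].
have C2P y : y \in C2 -> ~~ incident (a, b) y.
  by rewrite in_setD inE p0E => /andP[+ yC1]; rewrite yC1.
pose sl := pencil_slope a b.
pose U := sl @: U0 p0.
have sl_inj : {in U0 p0 &, injective sl}.
  by move=> u v /U0P uU /U0P vU; apply: pencil_slope_inj.
(* Slopes separate the lines of the pencil, so above the slope of [u] these are just the heights of
   [Q u]. *)
pose V s := pencil_height a b @:
  [set x | [exists u in U0 p0, (x \in Q u) && (sl u == s)]].
pose L := pencil_line a b @: C2.
have cardV u : u \in U0 p0 -> #|V (sl u)| <= K ^ 5 * n.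
  move=> uU; apply: (@leq_trans (r u)); last first.
    by move: uU; rewrite !inE => /andP[/andP[]].
  apply: leq_trans (r1r u); apply: leq_trans (leq_imset_card _ _) _.
  apply: subset_leq_card; apply/subsetP => x; rewrite inE.
  case/exists_inP => v vU /andP[xQ /eqP e].
  move: xQ; rewrite (sl_inj _ _ vU uU e) => xQ.
  by move: xQ; rewrite [x \in Q _]inE => /and3P[xP1 xu _]; rewrite inE xP1.
have le16 e : e <= 16 -> K ^ e <= K ^ 16 by apply: leK.
have := @Hc F U V L (K ^ 16) n; rewrite -expnM => h.
apply: (@leq_trans (K ^ (16 * c))); last by rewrite leK ?leq_addr.
apply: h => //.
- by rewrite -(exp1n 16) ltn_exp2r.
- apply: leq_trans (leq_imset_card _ _) _; apply: (leq_trans U0n).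
  by rewrite leq_mul2r le16 ?orbT.
- move=> _ /imsetP[u uU ->]; apply: (leq_trans (cardV u uU)).
  by rewrite leq_mul2r le16 ?orbT.
- apply: leq_trans (leq_imset_card _ _) _.
  apply: leq_trans (subset_leq_card (subsetDl _ _)) _; apply: (leq_trans C1n).
  by rewrite leq_mul2r (le16 1) ?orbT.
- apply: (leq_trans big6); rewrite leq_mul2l; apply/orP; right.
  rewrite big_imset; last by move=> y y' /C2P h1 /C2P h2; apply: pencil_line_inj.
  pose E y := [set p in setX (U0 p0) P1 | (p.2 \in Q p.1) && incident p.2 y].
  have -> : \sum_(u in U0 p0) \sum_(x in Q u) dg2 x = \sum_(y in C2) #|E y|.
    have -> : \sum_(y in C2) #|E y| =
        \sum_(y in C2) #|[set p in [set p in setX (U0 p0) P1 | p.2 \in Q p.1] | incident p.2 y]|.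
      apply: eq_bigr => y _; apply: eq_card => p.
      by rewrite /E !in_set andbA.
    rewrite -(exchange_card _ C2 (fun p y => incident p.2 y)).
    rewrite pair_big_dep /=; apply: eq_bigl => -[u x] /=.
    rewrite [in RHS]in_set in_setX /=; case: (u \in U0 p0) => //=.
    by rewrite [x \in Q u]inE; case: (x \in P1).
  apply: leq_sum => y yC2.
  have EP u x : (u, x) \in E y -> [/\ u \in U0 p0, x \in Q u & incident x y].
    by rewrite /E in_set in_setX /= => /andP[/andP[uU _] /andP[xQ xy]].
  apply: (@leq_card_dinj _ _ _ _ (fun p => sl p.1)).
    move=> [u x] /EP[uU xQ xy]; rewrite in_set imset_f //=.
    move: (xQ); rewrite [x \in Q u]inE p0E => /and3P[_ xu xp0].
    rewrite -(pencil_incidence ab0 xp0 (U0P _ uU) xu (C2P _ yC2) xy).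
    by apply: imset_f; rewrite in_set; apply/exists_inP; exists u; rewrite // xQ /=.
  move=> [u x] [u' x'] /EP[uU xQ xy] /EP[u'U x'Q x'y] /= e.
  have eu := sl_inj _ _ uU u'U e; rewrite -eu in x'Q *; congr (_, _).
  move: xQ x'Q; rewrite [x \in Q u]inE [x' \in Q u]inE => /and3P[_ xu xp0] /and3P[_ x'u x'p0].
  apply/eqP; apply: contraNT (C2P _ yC2) => xx'.
  by rewrite -(incident_two_points xx' xu x'u xy x'y) U0P.
- by apply: (leq_trans qn); rewrite leq_mul2r (le16 1) ?orbT.
- by apply: (leq_trans nq); rewrite leq_mul2r (le16 1) ?orbT.
Qed.

(** * Additive energy on the paraboloid *)

Definition paraboloid_energy (F : finFieldType) (A : {set F * F}) : nat :=
  #|[set q in setX (setX A A) (setX A A) |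
     [&& q.1.1.1 + q.1.2.1 == q.2.1.1 + q.2.2.1,
         q.1.1.2 + q.1.2.2 == q.2.1.2 + q.2.2.2 &
         pdot q.1.1 q.1.1 + pdot q.1.2 q.1.2 ==
         pdot q.2.1 q.2.1 + pdot q.2.2 q.2.2]%R]|.

(** Right angles at [p.2] with arms towards [a] and [p.1]. In a rectangle [p.1] is the vertex
    opposite to [a], and the fourth vertex is determined by the other three. *)
Definition corners (F : finFieldType) (A : {set F * F}) (a : F * F) :=
  [set p in setX A A |
    ((p.2.1 - a.1) * (p.2.1 - p.1.1) + (p.2.2 - a.2) * (p.2.2 - p.1.2) == 0)%R].

Lemma two_neq0 (F : finFieldType) : (forall t : F, t ^+ 2 != -1)%R -> (2 : F)%R != 0%R.
Proof.
move=> ns; apply: contra (ns 1%R) => /eqP e.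
by rewrite expr1n -subr_eq0 opprK -e; apply/eqP; ring.
Qed.

(* Four points of [A] counted by the energy form a rectangle. *)
Lemma energy_le_corners (F : finFieldType) (A : {set F * F}) :
  (2 : F)%R != 0%R -> paraboloid_energy A <= \sum_(a in A) #|corners A a|.
Proof.
move=> two0.
have -> : \sum_(a in A) #|corners A a| =
    #|[set p in setX A [set: (F * F) * (F * F)] | p.2 \in corners A p.1]|.
  rewrite (card_setX_filter A [set: _] (fun a p => p \in corners A a)).
  by apply: eq_bigr => a _; apply: eq_card => p; rewrite [RHS]inE in_setT.
apply: (@leq_card_dinj _ _ _ _ (fun q => (q.1.1, (q.1.2, q.2.1)))).
  move=> [[[a1 a2] [b1 b2]] [[c1 c2] [d1 d2]]]; rewrite !inE /pdot /=.
  case/andP => /andP[/andP[-> ->] /andP[-> _]] /and3P[/eqP e1 /eqP e2 /eqP e3] /=.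
  have {}e1 : (d1 = a1 + b1 - c1)%R by rewrite e1 addrC addKr.
  have {}e2 : (d2 = a2 + b2 - c2)%R by rewrite e2 addrC addKr.
  (* With [d = a + b - c], the equality of squared lengths is twice the orthogonality relation. *)
  rewrite -(mulIr_eq0 _ (mulIf two0)) -(subrr (a1 * a1 + a2 * a2 + (b1 * b1 + b2 * b2))%R).
  by rewrite {1}e3 e1 e2; apply/eqP; ring.
move=> [[[a1 a2] [b1 b2]] [[c1 c2] [d1 d2]]] [[[a1' a2'] [b1' b2']] [[c1' c2'] [d1' d2']]].
rewrite !inE /=; case/andP => _ /and3P[/eqP e1 /eqP e2 _].
case/andP => _ /and3P[/eqP e1' /eqP e2' _] [? ? ? ? ? ?]; subst.
rewrite e1 in e1'; rewrite e2 in e2'.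
by have /addrI -> := e1'; have /addrI -> := e2'.
Qed.

Definition translate (F : finFieldType) (A : {set F * F}) (a : F * F) : {set F * F} :=
  [set (x.1 - a.1, x.2 - a.2)%R | x in A].

Definition inversion (F : finFieldType) (w : F * F) : F * F :=
  (w.1 / pdot w w, w.2 / pdot w w)%R.

Definition inverted (F : finFieldType) (A : {set F * F}) (a : F * F) : {set F * F} :=
  [set inversion w | w in translate A a :\ (0, 0)%R].

Lemma inversion_inj (F : finFieldType) : (forall t : F, t ^+ 2 != -1)%R ->
  {in [pred w : F * F | w != (0, 0)%R] &, injective (@inversion F)}.
Proof.
move=> ns [x y] [x' y']; rewrite !inE /inversion /pdot /= => n n' [e1 e2].
have p0 (u v : F) : (u, v) != (0, 0)%R -> (u * u + v * v != 0)%R.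
  by move=> uv; apply: contra uv => h; apply/eqP/(anisotropic ns); rewrite -!expr2 in h.
have h (u v : F) (s := (u * u + v * v)%R) : (s != 0 ->
    (u / s) * (u / s) + (v / s) * (v / s) = s^-1)%R.
  by move=> s0; rewrite !mulf_div -mulrDl -/s invfM mulrA divff // mul1r.
have := h _ _ (p0 _ _ n); rewrite e1 e2 (h _ _ (p0 _ _ n')) => /invr_inj es.
have s0 : ((x * x + y * y)^-1 != 0)%R by rewrite invr_eq0 p0.
rewrite es in e1 e2.
by rewrite (mulIf s0 e1) (mulIf s0 e2).
Qed.

(** With [w = c - a] and [x = b - a], the right angle at [c] reads [x.w = w.w], that is, [x] is
    incident to [w / (w.w)]. The degenerate corners [c = a] account for the term [#|A|]. *)
Lemma card_corners (F : finFieldType) (A : {set F * F}) (a : F * F) :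
  (forall t : F, t ^+ 2 != -1)%R -> #|corners A a| <= #|A| +
    \sum_(y in inverted A a) #|[set x in translate A a | incident x y]|.
Proof.
move=> ns; rewrite -exchange_card -card_setX_filter.
rewrite -(cardsID [set p | p.2 == a] (corners A a)); apply: leq_add.
  apply: (@leq_card_dinj _ _ _ _ (fun p => p.1)).
    by move=> [b c]; rewrite !inE /= => /andP[/andP[/andP[]]].
  by move=> [b c] [b' c']; rewrite !inE /= => /andP[_ /eqP ->] /andP[_ /eqP ->] ->.
apply: (@leq_card_dinj _ _ _ _ (fun p =>
   ((p.1.1 - a.1, p.1.2 - a.2), inversion (p.2.1 - a.1, p.2.2 - a.2))%R)).
  move=> [b c]; rewrite !inE /= => /andP[ca /andP[/andP[bA cA] /eqP h]].
  have w0 : (c.1 - a.1, c.2 - a.2)%R != (0, 0)%R.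
    apply: contra ca => /eqP[/eqP + /eqP +]; rewrite !subr_eq0 => /eqP e1 /eqP e2.
    by rewrite [c]surjective_pairing [a]surjective_pairing e1 e2.
  rewrite (imset_f (fun x : F * F => (x.1 - a.1, x.2 - a.2)%R)) //=.
  rewrite imset_f ?inE ?w0 ?(imset_f (fun x : F * F => (x.1 - a.1, x.2 - a.2)%R)) //=.
  set w1 := (c.1 - a.1)%R in h w0 *; set w2 := (c.2 - a.2)%R in h w0 *.
  have n0 : (w1 * w1 + w2 * w2 != 0)%R.
    by apply: contra w0 => n0; apply/eqP/(anisotropic ns); rewrite -!expr2 in n0.
  rewrite /incident /inversion /pdot /= !mulrA -mulrDl.
  rewrite -(divff n0); apply/eqP; congr (_ / _)%R.
  apply/eqP; rewrite -subr_eq0; apply/eqP; rewrite -[RHS]oppr0 -h /w1 /w2; ring.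
move=> [b c] [b' c']; rewrite !inE /= => /andP[ca _] /andP[c'a _] [eb1 eb2 e1 e2].
have nz (x : F * F) : x != a -> (x.1 - a.1, x.2 - a.2)%R \in [pred w : F * F | w != (0, 0)%R].
  move=> xa; apply: contra xa => /eqP[/eqP + /eqP +]; rewrite !subr_eq0 => /eqP h1 /eqP h2.
  by rewrite [x]surjective_pairing [a]surjective_pairing h1 h2.
have [/addIr ec1 /addIr ec2] := inversion_inj ns (nz _ ca) (nz _ c'a)
  (f_equal2 pair e1 e2).
have /addIr f1 := eb1; have /addIr f2 := eb2.
by rewrite [b]surjective_pairing [c]surjective_pairing ec1 ec2 f1 f2 -!surjective_pairing.
Qed.

Lemma card_translate (F : finFieldType) (A : {set F * F}) a : #|translate A a| <= #|A|.
Proof. exact: leq_imset_card. Qed.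

Lemma card_inverted (F : finFieldType) (A : {set F * F}) a : #|inverted A a| <= #|A|.
Proof.
apply: leq_trans (leq_imset_card _ _) _; apply: leq_trans (card_translate A a).
exact: subset_leq_card (subsetDl _ _).
Qed.

Lemma energy_le_of_corners (F : finFieldType) (A : {set F * F}) M :
  (2 : F)%R != 0%R -> {in A, forall a, M * #|corners A a| ^ 2 <= 6 * #|A| ^ 3} ->
  M * paraboloid_energy A ^ 2 <= 6 * #|A| ^ 5.
Proof.
move=> two0 hc.
apply: (@leq_trans (M * (\sum_(a in A) #|corners A a|) ^ 2)).
  by rewrite leq_mul2l leq_sqr energy_le_corners ?orbT.
apply: leq_trans (leq_mul (leqnn _) (sum_nat_cauchy_set _ _)) _.
rewrite mulnCA big_distrr /= (expnS _ 4) mulnCA leq_mul2l; apply/orP; right.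
rewrite (expnS _ 3) mulnCA -sum_nat_const; exact: leq_sum.
Qed.

(** With [N = #|A|], two points determine a line, so Cauchy-Schwarz gives an incidence count [I]
    with [I ^ 2 <= 2 * N ^ 3]. Then [(N + I) ^ 2 <= 2 * N ^ 2 + 2 * I ^ 2] yields the constant 6. *)
Lemma energy_le (F : finFieldType) (A : {set F * F}) :
  (forall t : F, t ^+ 2 != -1)%R -> paraboloid_energy A ^ 2 <= 6 * #|A| ^ 5.
Proof.
move=> ns; rewrite -[X in X <= _]mul1n; apply: energy_le_of_corners => [|a aA].
  exact: two_neq0.
rewrite mul1n; have N0 : 0 < #|A| by rewrite card_gt0; apply/set0Pn; exists a.
have := card_corners A a ns; set I := \sum_(y in _) _ => hI.
have I2 : I ^ 2 <= 2 * #|A| ^ 3.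
  have two := @incident_two_points F.
  apply: leq_trans (sum_nat_cauchy_set _ _) _; rewrite (expnS _ 2) mulnCA.
  apply: leq_mul; first exact: card_inverted.
  apply: leq_trans (sum_sq_degrees _ _ two) _; rewrite -/I mul2n -addnn.
  apply: leq_add; last by rewrite leq_sqr card_translate.
  rewrite /I -mulnn; apply: (@leq_trans (\sum_(y in inverted A a) #|A|)).
    apply: leq_sum => y _; apply: leq_trans (card_translate A a).
    by apply: subset_leq_card; apply/subsetP => x; rewrite inE => /andP[].
  by rewrite sum_nat_const leq_mul2r card_inverted orbT.
apply: (@leq_trans ((#|A| + I) ^ 2)); first by rewrite leq_sqr.
have h : #|A| ^ 2 <= #|A| ^ 3 by rewrite leq_pexp2l.
have [hC _] := nat_Cauchy #|A| I; rewrite sqrnD; move: I2 h hC.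
by move: (#|A| ^ 3) (#|A| ^ 2) (I ^ 2) (#|A| * I); clear; lia.
Qed.

Lemma exists_sqrt N : exists n, n ^ 2 <= N < n.+1 ^ 2.
Proof.
elim: N => [|N [n /andP[h1 h2]]]; first by exists 0.
have [lt|le] := ltnP N.+1 (n.+1 ^ 2); first by exists n; rewrite lt leqW.
exists n.+1; rewrite le /=; apply: (leq_ltn_trans h2).
by rewrite ltn_sqr.
Qed.

(** If the gain failed at some [a], [plane_incidence_structure] would apply with [n] the integer
    square root of [#|A|]: the two size hypotheses say that [n ^ 5] is about [#|F| ^ 2]. *)
Lemma energy_gain : exists c, forall (F : finFieldType) (A : {set F * F}) K,
  (forall t : F, t ^+ 2 != -1)%R -> 1 < K -> K ^ c < #|F| ->
  #|A| ^ 5 <= K ^ 5 * #|F| ^ 4 -> #|F| ^ 4 <= K ^ 5 * #|A| ^ 5 ->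
  K * paraboloid_energy A ^ 2 <= 6 * #|A| ^ 5.
Proof.
have [c Hc] := plane_incidence_structure.
(* The incidence result is used with [K ^ 8], so [n <= K ^ (8 * c)] and [#|F| <= K ^ 8 * n ^ 5 <= K
   ^ (40 * c + 8)], against the hypothesis on [K]. *)
exists (40 * c + 8) => F A K ns K1 Kq hN hq.
have Kp : 0 < K by lia.
have leK a b : a <= b -> K ^ a <= K ^ b by move=> ab; rewrite leq_pexp2l.
have q0 : 0 < #|F| by apply/card_gt0P; exists 0%R.
apply: energy_le_of_corners => [|a aA]; first exact: two_neq0.
have KN : K <= #|A|.
  rewrite leqNgt; apply/negP => /ltnW NK.
  have : (K ^ 8) ^ 4 < #|F| ^ 4.
    by rewrite ltn_exp2r //; apply: leq_ltn_trans Kq; rewrite leK ?leq_addl.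
  apply/negP; rewrite -leqNgt; apply: (leq_trans hq).
  apply: (@leq_trans (K ^ 5 * K ^ 5)); first by rewrite leq_mul2l leq_exp2r ?NK ?orbT.
  by rewrite -expnD -expnM leK.
have := card_corners A a ns; set I := \sum_(y in _) _ => hI.
suff I2 : K * I ^ 2 <= #|A| ^ 3.
  apply: (@leq_trans (K * (#|A| + I) ^ 2)); first by rewrite leq_mul2l leq_sqr hI orbT.
  have h : K * #|A| ^ 2 <= #|A| ^ 3 by rewrite (expnS _ 2) leq_mul2r KN orbT.
  have h2 : K * (2 * (#|A| * I)) <= K * (#|A| ^ 2 + I ^ 2).
    by rewrite leq_mul2l nat_Cauchy orbT.
  rewrite sqrnD 2!(mulnDr K); move: I2 h h2; rewrite mulnDr.
  by move: (#|A| ^ 3) (K * #|A| ^ 2) (K * I ^ 2) (K * (2 * (#|A| * I))); clear; lia.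
rewrite leqNgt; apply/negP => /ltnW bigI.
have [n /andP[n2N Nn]] := exists_sqrt #|A|.
have n0 : 0 < n.
  have N1 : 1 <= #|A| by apply: leq_trans KN.
  by case: n Nn {n2N} => // h; move: (leq_ltn_trans N1 h).
have N4 : #|A| <= 4 * n ^ 2.
  apply: leq_trans (ltnW Nn) _; rewrite -[4]/(2 ^ 2) -expnMn leq_sqr mul2n -addnn.
  by rewrite -addn1 leq_add2l.
have N8 : #|A| <= K ^ 8 * n ^ 2.
  apply: (leq_trans N4); rewrite leq_mul2r; apply/orP; right.
  by apply: (@leq_trans (K ^ 2)); [rewrite (@leq_exp2r 2 K 2)|rewrite leK].
have K45 : 4 ^ 5 <= K ^ 10.
  by rewrite -[4]/(2 ^ 2) -expnM leq_exp2r.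
have nq : #|F| ^ 2 <= K ^ 8 * n ^ 5.
  rewrite -leq_sqr -expnM expnMn -!expnM; apply: (leq_trans hq).
  apply: (@leq_trans (K ^ 5 * (K ^ 10 * n ^ 10))).
    rewrite leq_mul2l (leq_trans (_ : _ <= (4 * n ^ 2) ^ 5)) ?orbT ?leq_exp2r //.
    by rewrite expnMn -expnM leq_mul2r K45 orbT.
  by rewrite mulnA -expnD leq_mul2r leK ?orbT.
have qn : n ^ 5 <= K ^ 8 * #|F| ^ 2.
  rewrite -leq_sqr -expnM expnMn -!expnM (expnM n 2 5).
  apply: (@leq_trans (#|A| ^ 5)); first by rewrite leq_exp2r.
  by apply: (leq_trans hN); rewrite leq_mul2r leK ?orbT.
have hI8 : n ^ 3 <= K ^ 8 * I.
  rewrite -leq_sqr -expnM (expnM n 2 3); apply: (@leq_trans (#|A| ^ 3)).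
    by rewrite leq_exp2r.
  apply: (leq_trans bigI); rewrite expnMn -expnM leq_mul2r.
  by rewrite (leK 1) ?orbT.
have K81 : 1 < K ^ 8 by rewrite -(exp1n 8) ltn_exp2r.
have := @Hc F (translate A a) (inverted A a) (K ^ 8) n ns K81 n0
  (leq_trans (card_translate _ _) N8) (leq_trans (card_inverted _ _) N8) hI8 nq qn.
rewrite -expnM => nK; move: Kq; apply/negP; rewrite -leqNgt.
apply: (@leq_trans (#|F| ^ 2)); first by rewrite -[X in X <= _]expn1 leq_pexp2l.
apply: (leq_trans nq); rewrite expnD mulnC leq_mul2r; apply/orP; right.
apply: (@leq_trans ((K ^ (8 * c)) ^ 5)); first by rewrite leq_exp2r.
by rewrite -expnM leK // mulnAC.
Qed.

(** * Exponential sums *)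

Section Fourier.
Local Open Scope ring_scope.
Import Order.TTheory Num.Theory.
Variables (F : finFieldType) (C : numClosedFieldType) (e : F -> C).
Hypothesis e_norm : forall a, `|e a| = 1.
Hypothesis eD : {morph e : a b / a + b >-> a * b}.
Variable a0 : F.
Hypothesis e_a0 : e a0 != 1.

Implicit Types (w y x : F * F) (s t : F).

Local Notation q := (#|F|).

Lemma char_neq0 a : e a != 0.
Proof. by rewrite -normr_eq0 e_norm oner_eq0. Qed.

Lemma char0 : e 0 = 1.
Proof. by apply: (mulfI (char_neq0 0)); rewrite -eD addr0 mulr1. Qed.

Lemma charN a : e (- a) = (e a)^*.
Proof.
apply: (mulfI (char_neq0 a)); rewrite -eD subrr char0.
by rewrite -normCK e_norm expr1n.
Qed.

Lemma char_sum_eq0 (G : finType) (chi : G -> C) (f : G -> G) (b : C) :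
  injective f -> (forall g, chi (f g) = b * chi g) -> b != 1 -> \sum_g chi g = 0.
Proof.
move=> f_inj chif n1; have b1 : b - 1 != 0 by rewrite subr_eq0.
apply: (mulfI b1); rewrite mulr0 mulrBl mul1r; apply/eqP; rewrite subr_eq0; apply/eqP.
rewrite [RHS](reindex_inj f_inj) /= big_distrr /=.
by apply: eq_bigr => g _; rewrite chif.
Qed.

Lemma pdotDl x y w : pdot (x + y) w = pdot x w + pdot y w.
Proof. by rewrite /pdot /=; ring. Qed.

Lemma plane_sum w : \sum_x e (pdot x w) = (q ^ 2)%:R * (w == 0)%:R.
Proof.
have [->|w0] := eqVneq w 0.
  rewrite mulr1 (eq_bigr (fun=> 1)) => [|x _].
    by rewrite sumr_const card_prod mulnn.
  by rewrite /pdot /= !mulr0 addr0 char0.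
rewrite mulr0.
have shift g : e (pdot g w) != 1 -> \sum_x e (pdot x w) = 0.
  move=> n1; apply: (char_sum_eq0 (addrI g) _ n1) => x.
  by rewrite pdotDl eD.
have [w1|w1] := eqVneq w.1 0.
  have w2 : w.2 != 0.
    by apply: contra w0 => /eqP w2; rewrite [w]surjective_pairing w1 w2.
  by apply: (shift (0, a0 / w.2)); rewrite /pdot /= mul0r add0r divfK.
by apply: (shift (a0 / w.1, 0)); rewrite /pdot /= mul0r addr0 divfK.
Qed.

Definition dot3 (x y : F * F * F) : F := pdot x.1 y.1 + x.2 * y.2.

Lemma space_sum (z : F * F * F) : \sum_x e (dot3 x z) = (q ^ 3)%:R * (z == 0)%:R.
Proof.
have -> : \sum_x e (dot3 x z) = (\sum_x e (pdot x z.1)) * (\sum_t e (t * z.2)).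
  rewrite big_distrlr pair_bigA /=.
  by apply: eq_bigr => x _; rewrite /dot3 eD.
have -> : \sum_t e (t * z.2) = q%:R * (z.2 == 0)%:R.
  have [->|z0] := eqVneq z.2 0.
    rewrite mulr1 (eq_bigr (fun=> 1)) ?sumr_const // => t _.
    by rewrite mulr0 char0.
  rewrite mulr0; apply: (char_sum_eq0 (addrI (a0 / z.2)) _ e_a0) => t.
  by rewrite mulrDl divfK // eD.
rewrite plane_sum (expnSr q 2) natrM; case: z => z1 z2 /=; rewrite [in RHS]xpair_eqE.
by case: (z1 == 0); case: (z2 == 0); rewrite /= ?mulr1 ?mulr0 ?mul0r.
Qed.

Lemma plancherel_le (T : finType) (P : {set T}) (d : T -> C) (th : T -> F * F * F) :
  {in P, forall p, `|d p| <= 1} ->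
  \sum_x `|\sum_(p in P) d p * e (dot3 x (th p))| ^+ 2
    <= (q ^ 3)%:R * #|[set p in setX P P | th p.1 == th p.2]|%:R.
Proof.
move=> d1.
have E : \sum_x `|\sum_(p in P) d p * e (dot3 x (th p))| ^+ 2 =
    \sum_(p in P) \sum_(p' in P) d p * (d p')^* * ((q ^ 3)%:R * (th p == th p')%:R).
  under eq_bigr => x _.
    rewrite normCK rmorph_sum /= big_distrlr /=.
    under eq_bigr => p _ do under eq_bigr => p' _ do
      rewrite rmorphM /= -charN mulrACA -eD /=.
    over.
  rewrite exchange_big /=; apply: eq_bigr => p _.
  rewrite exchange_big /=; apply: eq_bigr => p' _.
  rewrite -big_distrr /=; congr (_ * _).
  rewrite -(subr_eq0 (th p)) -space_sum; apply: eq_bigr => x _; congr (e _).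
  by rewrite /dot3 /pdot /=; ring.
have -> : (q ^ 3)%:R * #|[set p in setX P P | th p.1 == th p.2]|%:R =
    \sum_(p in P) \sum_(p' in P) (q ^ 3)%:R * (th p == th p')%:R :> C.
  under [RHS]eq_bigr do rewrite -big_distrr /=.
  rewrite -big_distrr /= (card_setX_filter _ _ (fun a b => th a == th b)) natr_sum.
  congr (_ * _); apply: eq_bigr => p _; rewrite -sum1_card natr_sum.
  rewrite big_mkcond [RHS]big_mkcond /=; apply: eq_bigr => p' _.
  by rewrite inE; case: (p' \in P) => //=; case: eqP.
set Y := \sum_(p in P) _; rewrite -[X in X <= _]ger0_norm; last first.
  by apply: sumr_ge0 => x _; rewrite exprn_ge0.
rewrite E; apply: le_trans (ler_norm_sum _ _ _) _; apply: ler_sum => p pP.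
apply: le_trans (ler_norm_sum _ _ _) _; apply: ler_sum => p' p'P.
rewrite normrM [X in _ * X <= _]ger0_norm ?mulr_ge0 ?ler0n //.
rewrite -[X in _ <= X]mul1r ler_wpM2r ?mulr_ge0 ?ler0n //.
by rewrite normrM norm_conjC mulr_ile1 ?d1.
Qed.

(** The square of the sum is an exponential sum over pairs, to which [plancherel_le] applies;
    coincidences between pairs are what the energy counts. *)
Lemma fourth_moment_le (A : {set F * F}) (c : F * F -> C) :
  {in A, forall y, `|c y| <= 1} ->
  \sum_x `|\sum_(y in A) c y * e (dot3 x (y, pdot y y))| ^+ 4
    <= (q ^ 3)%:R * (paraboloid_energy A)%:R.
Proof.
move=> c1.
have := @plancherel_le _ (setX A A) (fun p => c p.1 * c p.2)
  (fun p => (p.1 + p.2, pdot p.1 p.1 + pdot p.2 p.2)).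
have -> : #|[set p in setX (setX A A) (setX A A) |
    (p.1.1 + p.1.2, pdot p.1.1 p.1.1 + pdot p.1.2 p.1.2) ==
    (p.2.1 + p.2.2, pdot p.2.1 p.2.1 + pdot p.2.2 p.2.2)]| = paraboloid_energy A.
  by apply: eq_card => -[[u v] [w z]]; rewrite !inE /= !xpair_eqE -!andbA.
move=> h; apply: le_trans (h _); last first.
  move=> [u v] /setXP[uA vA] /=; rewrite normrM mulr_ile1 ?c1 //.
apply: ler_sum => x _; rewrite (exprM _ 2 2) -normrX le_eqVlt; apply/orP; left.
apply/eqP; congr (`|_| ^+ 2); rewrite expr2 big_distrlr pair_big_dep /=.
apply: eq_big => [[u v]|[u v] _] /=; first by rewrite in_setX.
rewrite mulrACA -eD; congr (_ * e _); rewrite /dot3 /pdot /=; ring.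
Qed.

Definition gauss_sum t : C := \sum_w e (t * pdot w w).

Hypothesis two0 : (2 : F) != 0.

(** Here [w] runs over a plane, so the modulus is [q] and not its square root. In the expanded
    square the variables are [w'] and [w' + h], and the sum over [w'] vanishes unless [h = 0]. *)
Lemma norm_gauss_sum t : t != 0 -> `|gauss_sum t| = q%:R.
Proof.
move=> t0; apply/eqP; rewrite -(eqrXn2 (n := 2)) ?ler0n ?normr_ge0 //; apply/eqP.
rewrite normCK /gauss_sum rmorph_sum big_distrlr exchange_big /=.
rewrite (eq_bigr (fun w' => \sum_h e (t * pdot h h) * e (pdot w' (2 * t * h.1, 2 * t * h.2)))).
  rewrite exchange_big /=; under eq_bigr => h _ do rewrite -big_distrr plane_sum /=.
  rewrite (bigD1 (0 : F * F)) //= big1 ?addr0 => [|h h0].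
    rewrite !mulr0 eqxx mulr1 /pdot /= !mulr0 addr0 mulr0 char0 mul1r natrX.
    by [].
  rewrite xpair_eqE !mulf_eq0 (negPf two0) (negPf t0) /= -xpair_eqE -surjective_pairing.
  by rewrite (negPf h0) !mulr0.
move=> w' _; rewrite (reindex_inj (addrI w')) /=; apply: eq_bigr => h _.
rewrite -charN -!eD; congr (e _); rewrite /pdot /=; ring.
Qed.

Lemma gauss_sum_shift y t : t != 0 ->
  \sum_w e (pdot w y + t * pdot w w) = gauss_sum t * e (- (pdot y y / (4 * t))).
Proof.
move=> t0; rewrite big_distrl /=.
pose c : F * F := (- (y.1 / (2 * t)), - (y.2 / (2 * t))).
rewrite (reindex_inj (addrI c)) /=; apply: eq_bigr => w _.
rewrite -eD; congr (e _); rewrite /pdot /=; field.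
have -> : (4 : F) = 2 * 2 by ring.
by rewrite t0 two0 mulf_neq0.
Qed.

Lemma sqr_sum_le (T : finType) (A : {set T}) (a : T -> C) :
  (forall i, 0 <= a i) ->
  (\sum_(i in A) a i) ^+ 2 <= #|A|%:R * \sum_(i in A) a i ^+ 2.
Proof.
move=> a_ge0; rewrite -(ler_pMn2r (n := 2)) // expr2 big_distrlr /= -sumrMnl.
apply: (@le_trans _ _ (\sum_(i in A) \sum_(j in A) (a i ^+ 2 + a j ^+ 2))).
  apply: ler_sum => i _; rewrite -sumrMnl; apply: ler_sum => j _.
  by rewrite real_leif_mean_square_scaled ?ger0_real.
rewrite [X in X <= _](eq_bigr (fun i => a i ^+ 2 *+ #|A| + \sum_(j in A) a j ^+ 2)).
  by rewrite big_split /= sumr_const sumrMnl -mulr2n mulr_natl.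
by move=> i _; rewrite big_split /= sumr_const.
Qed.

Lemma pow4_sum_le (T : finType) (A : {set T}) (a : T -> C) :
  (forall i, 0 <= a i) ->
  (\sum_(i in A) a i) ^+ 4 <= #|A|%:R ^+ 3 * \sum_(i in A) a i ^+ 4.
Proof.
move=> a_ge0; rewrite (exprM _ 2 2).
have S0 : 0 <= \sum_(i in A) a i by apply: sumr_ge0.
have S20 : 0 <= \sum_(i in A) a i ^+ 2 by apply: sumr_ge0 => i _; rewrite exprn_ge0.
apply: (@le_trans _ _ ((#|A|%:R * \sum_(i in A) a i ^+ 2) ^+ 2)).
  by rewrite ler_sqr ?nnegrE ?exprn_ge0 ?mulr_ge0 ?ler0n // sqr_sum_le.
rewrite exprMn (exprSr _ 2) -mulrA ler_wpM2l ?exprn_ge0 ?ler0n //.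
apply: le_trans (sqr_sum_le _ _) _ => [i|]; first by rewrite exprn_ge0.
by under eq_bigr do rewrite -exprM.
Qed.

Section Slices.
Variables (E : {set F * F * F}) (f : F * F * F -> C).
Hypothesis f1 : {in E, forall p, `|f p| <= 1}.

Definition slice t : {set F * F} := [set y | (y, t) \in E].

Definition fourier_paraboloid w : C := \sum_(p in E) f p * e (dot3 p (w, pdot w w)).

Definition slice_sum t (x : F * F * F) : C :=
  \sum_(y in slice t) (f (y, t))^* * e (dot3 x (y, pdot y y)).

(* Completing the square turns the convolution of a horizontal slice with the
   Fourier transform of the paraboloid into an extension operator, evaluated at
   this pseudo-conformal change of variables. *)
Definition conformal (t : F) (p : F * F * F) : F * F * F :=
  ((p.1.1 / (2 * (p.2 - t)), p.1.2 / (2 * (p.2 - t))), - (4 * (p.2 - t))^-1).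

Definition slice_weight t : C :=
  \sum_(p in [set p in E | p.2 != t]) `|slice_sum t (conformal t p)|.

Lemma sum_slices (G : F * F * F -> C) :
  \sum_(p in E) G p = \sum_t \sum_(y in slice t) G (y, t).
Proof.
rewrite [RHS](exchange_big_dep predT) //= pair_big_dep /=.
apply: eq_big => [[y t]|[y t] _] //=; by rewrite inE.
Qed.

Lemma card_slices : #|E| = (\sum_t #|slice t|)%N.
Proof.
rewrite (eq_bigr (fun t => \sum_(y in slice t) 1)%N) => [|t _]; last by rewrite sum1_card.
rewrite [RHS](exchange_big_dep predT) //= pair_big_dep /= -sum1_card.
by apply: eq_bigl => -[y t]; rewrite inE.
Qed.

(** One factor of the square is cut into slices. A point [p] at the height of the slice sees only
    [y = p.1], which gives the first term. At any other height the sum over [w] is a Gauss sum of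
    modulus [q] times a phase depending on [p] alone times the phase in [slice_sum]. *)
Lemma sum_norm_fourier_paraboloid_le :
  \sum_w `|fourier_paraboloid w| ^+ 2 <=
    q%:R ^+ 2 * #|E|%:R + q%:R * \sum_t slice_weight t.
Proof.
pose T p t := \sum_(y in slice t) (f (y, t))^* *
  \sum_w e (pdot w (p.1 - y) + (p.2 - t) * pdot w w).
have eq1 : \sum_w `|fourier_paraboloid w| ^+ 2 = \sum_t \sum_(p in E) f p * T p t.
  under eq_bigr => w _.
    rewrite normCK rmorph_sum /= big_distrlr /=.
    over.
  rewrite exchange_big [RHS]exchange_big /=; apply: eq_bigr => p pE.
  rewrite exchange_big sum_slices /=; apply: eq_bigr => t _.
  rewrite /T big_distrr; apply: eq_bigr => y _ /=.
  rewrite mulrA big_distrr /=; apply: eq_bigr => w _.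
  rewrite rmorphM /= -charN mulrACA -eD; congr (_ * e _).
  by rewrite /dot3 /pdot /=; ring.
rewrite -[X in X <= _]ger0_norm; last first.
  by apply: sumr_ge0 => x _; rewrite exprn_ge0.
rewrite eq1; apply: le_trans (ler_norm_sum _ _ _) _.
have Tle p t : p \in E -> `|f p * T p t| <=
    (p.2 == t)%:R * q%:R ^+ 2 + (p.2 != t)%:R * (q%:R * `|slice_sum t (conformal t p)|).
  move=> pE; rewrite normrM -[X in _ <= X]mul1r ler_pM ?normr_ge0 ?f1 //.
  have [pt|pt] := eqVneq p.2 t.
    rewrite mul1r mul0r addr0 /T (bigD1 p.1) /=; last first.
      by rewrite inE -pt -surjective_pairing.
    rewrite [X in _ + X]big1 ?addr0 => [|y /andP[_ yp]].
      rewrite -pt !subrr; under eq_bigr => w _ do rewrite mul0r addr0.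
      rewrite plane_sum eqxx mulr1 -surjective_pairing normrM norm_conjC natrX.
      by rewrite normrX normr_nat ler_piMl ?f1 // exprn_ge0 ?ler0n.
    rewrite pt subrr; under eq_bigr => w _ do rewrite mul0r addr0.
    by rewrite plane_sum subr_eq0 eq_sym (negPf yp) !mulr0.
  rewrite mul0r add0r mul1r; have d0 : p.2 - t != 0 by rewrite subr_eq0.
  have -> : T p t = gauss_sum (p.2 - t) * e (- (pdot p.1 p.1 / (4 * (p.2 - t)))) *
      slice_sum t (conformal t p).
    rewrite /T /slice_sum big_distrr /=; apply: eq_bigr => y _.
    rewrite gauss_sum_shift // mulrC -!mulrA; congr (_ * _).
    rewrite [RHS]mulrCA [LHS]mulrC; congr (_ * _).
    rewrite -eD; congr (e _); rewrite /dot3 /pdot /conformal /=; field.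
    have -> : (4 : F) = 2 * 2 by ring.
    by rewrite d0 two0 mulf_neq0.
  by rewrite !normrM norm_gauss_sum // e_norm mulr1.
apply: (@le_trans _ _ (\sum_t \sum_(p in E) ((p.2 == t)%:R * q%:R ^+ 2 +
    (p.2 != t)%:R * (q%:R * `|slice_sum t (conformal t p)|)))).
  apply: ler_sum => t _; apply: le_trans (ler_norm_sum _ _ _) _.
  by apply: ler_sum => p pE; apply: Tle.
under eq_bigr => t _ do rewrite big_split /=.
rewrite big_split /= lerD //.
  rewrite exchange_big /= -[#|E|]sum1_card natr_sum big_distrr /=.
  apply: ler_sum => p _; rewrite (bigD1 p.2) //= eqxx mul1r big1 ?addr0 ?mulr1 //.
  by move=> t tp; rewrite eq_sym (negPf tp) mul0r.
rewrite big_distrr /=; apply: ler_sum => t _; rewrite /slice_weight big_distrr /=.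
rewrite [X in _ <= X](eq_bigl (fun p => (p \in E) && (p.2 != t))) => [|p]; last by rewrite inE.
rewrite [X in _ <= X]big_mkcondr /=; apply: ler_sum => p _.
by case: (p.2 != t); rewrite ?mul1r ?mul0r.
Qed.

Lemma slice_weight_ge0 t : 0 <= slice_weight t.
Proof. by apply: sumr_ge0. Qed.

Lemma slice_weight_le t : slice_weight t <= #|E|%:R * #|slice t|%:R.
Proof.
apply: (@le_trans _ _ (\sum_(p in [set p in E | p.2 != t]) #|slice t|%:R)).
  apply: ler_sum => p _; apply: le_trans (ler_norm_sum _ _ _) _.
  rewrite -[#|slice t|]sum1_card natr_sum; apply: ler_sum => y.
  by rewrite inE => yE; rewrite normrM norm_conjC e_norm mulr1 f1.
rewrite sumr_const -[X in X <= _]mulr_natl ler_wpM2r ?ler0n // ler_nat.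
by apply: subset_leq_card; apply/subsetP => p; rewrite inE => /andP[].
Qed.

(** Hölder over [p]; then, [conformal t] being injective away from height [t], the fourth powers are
    summed over the whole space and [fourth_moment_le] applies. *)
Lemma slice_weight_pow4_le t :
  slice_weight t ^+ 4 <= #|E|%:R ^+ 3 * (q%:R ^+ 3 * (paraboloid_energy (slice t))%:R).
Proof.
set E' := [set p in E | p.2 != t].
apply: (@le_trans _ _ (#|E'|%:R ^+ 3 * \sum_(p in E') `|slice_sum t (conformal t p)| ^+ 4)).
  exact: pow4_sum_le.
apply: ler_pM.
- by rewrite exprn_ge0 ?ler0n.
- by apply: sumr_ge0 => p _; rewrite exprn_ge0.
- rewrite lerXn2r ?nnegrE ?ler0n // ler_nat.
  by apply: subset_leq_card; apply/subsetP => p; rewrite inE => /andP[].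
rewrite -natrX; apply: le_trans (fourth_moment_le (A := slice t) (c := fun y => (f (y, t))^*) _).
  have cinj : {in E' &, injective (conformal t)}.
    move=> [[x1 x2] s] [[x1' x2'] s']; rewrite !inE /= => /andP[_ st] /andP[_ s't].
    rewrite /conformal /= => -[e1 e2 /oppr_inj/invr_inj e3].
    have four0 : (4 : F) != 0.
      by have -> : (4 : F) = 2 * 2 by [ring]; rewrite mulf_neq0.
    have es : s = s' by have /addIr := mulfI four0 e3.
    rewrite -es in e1 e2 *.
    have d0 : (2 * (s - t))^-1 != 0 by rewrite invr_eq0 mulf_neq0 // subr_eq0.
    by rewrite (mulIf d0 e1) (mulIf d0 e2).
  rewrite -(big_imset (fun x : F * F * F => `|slice_sum t x| ^+ 4) cinj) /=.
  rewrite [X in _ <= X](bigID (mem (conformal t @: E'))) /= lerDl.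
  by apply: sumr_ge0 => p _; rewrite exprn_ge0.
by move=> y; rewrite inE norm_conjC => yE; apply: f1.
Qed.

End Slices.

End Fourier.

From mathcomp Require Import all_classical all_reals ereal sequences exp.

Import Order.TTheory GRing.Theory Num.Theory.

Local Open Scope ring_scope.
Local Open Scope complex_scope.

(** * From energies to the extension estimate *)

Lemma ler_expR_pow (R : realType) (x y : R) n : (0 < n)%N -> 0 <= x ->
  x ^+ n <= expR (n%:R * y) -> x <= expR y.
Proof.
move=> n0 x0; rewrite expRM_natl ler_pXn2r ?nnegrE ?expR_ge0 //.
Qed.

Lemma natr_expR (R : realType) n : (0 < n)%N -> (n%:R : R) = expR (ln n%:R).
Proof. by move=> n0; rewrite lnK ?posrE ?ltr0n. Qed.

Lemma ln_natXn (R : realType) a n : (0 < a)%N ->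
  ln ((a ^ n)%:R : R) = n%:R * ln a%:R.
Proof. by move=> a0; rewrite natrX lnXn ?ltr0n // mulr_natl. Qed.

Lemma ler_ln_nat (R : realType) a b : (0 < a)%N -> (0 < b)%N ->
  (ln (a%:R : R) <= ln b%:R) = (a <= b)%N.
Proof. by move=> a0 b0; rewrite ler_ln ?posrE ?ltr0n // ler_nat. Qed.

Lemma ln_nat_ge0 (R : realType) a : 0 <= ln (a%:R : R).
Proof.
case: a => [|a]; first by rewrite ln0.
by apply: ln_ge0; rewrite ler1n.
Qed.

(* Interpolating the energy bound between short and long slices: with
   [d = ln N - ln (s / q)], the weight of a slice is at most the geometric mean
   [N (s/q)^(-3/8)] and [(s/q)^(5/8)] times [exp (- 3 |d| / 8)]. *)
Lemma slice_pointwise (R : realType) (X ls lq lN g : R) : 0 <= X ->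
  X ^+ 8 <= expR (8 * (1 + 3 / 4 * ls - lq / 4 + 5 / 8 * lN - g)) ->
  forall g' : R, g' <= g + 3 / 8 * `|lN - (ls - lq)| ->
  X <= expR (1 + 3 / 4 * ls - lq / 4 - g' - 3 / 8 * (ls - lq)) * expR lN +
       expR (1 + 3 / 4 * ls - lq / 4 - g' + 5 / 8 * (ls - lq)).
Proof.
move=> X0 X8 g' hg.
have XE : X <= expR (1 + 3 / 4 * ls - lq / 4 + 5 / 8 * lN - g).
  by apply: (@ler_expR_pow _ _ _ 8).
rewrite -expRD; apply: (le_trans XE).
have [h|h] := lerP 0 (lN - (ls - lq)).
  rewrite ger0_norm // in hg.
  apply: le_trans (_ : _ <= expR (1 + 3 / 4 * ls - lq / 4 - g' - 3 / 8 * (ls - lq) + lN)) _.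
    by rewrite ler_expR; lra.
  by rewrite lerDl expR_ge0.
rewrite ltr0_norm // in hg.
apply: le_trans (_ : _ <= expR (1 + 3 / 4 * ls - lq / 4 - g' + 5 / 8 * (ls - lq))) _.
  by rewrite ler_expR; lra.
by rewrite lerDr expR_ge0.
Qed.

Lemma slice_weights_bound (R : realType) (T : finType) (N Lam : T -> nat)
    (X : T -> R) (s K c : nat) : (0 < c)%N ->
  (1 < #|T|)%N -> (0 < s)%N -> s = (\sum_t N t)%N -> (s <= #|T| ^ 3)%N -> (0 < K)%N ->
  (#|T| <= (2 * K) ^ c)%N ->
  (forall t, Lam t ^ 2 <= 6 * N t ^ 5)%N ->
  (forall t, N t ^ 5 <= K ^ 5 * #|T| ^ 4 -> #|T| ^ 4 <= K ^ 5 * N t ^ 5 ->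
     K * Lam t ^ 2 <= 6 * N t ^ 5)%N ->
  (forall t, 0 <= X t) -> (forall t, X t * #|T|%:R <= s%:R * (N t)%:R) ->
  (forall t, X t ^+ 4 * #|T|%:R <= s%:R ^+ 3 * (Lam t)%:R) ->
  s%:R + \sum_t X t <= expR 4 * expR ((13 / 9 - (100 * c%:R)^-1) * ln s%:R).
Proof.
move=> c0 T1 s0 sN sT K0 TK L1 LK X0 X1 X4.
have T0 : (0 < #|T|)%N by apply: ltnW.
pose lq : R := ln #|T|%:R; pose ls : R := ln s%:R; pose lk : R := ln K%:R.
pose eta : R := (100 * c%:R)^-1.
have lk0 : 0 <= lk := ln_nat_ge0 R K.
have ls0 : 0 <= ls := ln_nat_ge0 R s.
have lq0 : 0 <= lq := ln_nat_ge0 R #|T|.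
have qE : (#|T|%:R : R) = expR lq := natr_expR R T0.
have sE : (s%:R : R) = expR ls := natr_expR R s0.
have c0R : 0 < c%:R :> R by rewrite ltr0n.
have eta0 : 0 < eta by rewrite invr_gt0 mulr_gt0 ?ltr0n.
have e2 : 2 <= expR 1 :> R by have := expR_ge1Dx (1 : R); lra.
have lqK : lq <= c%:R * (1 + lk).
  have : lq <= ln (((2 * K) ^ c)%N%:R : R).
    by rewrite ler_ln_nat // expn_gt0 muln_gt0 K0.
  rewrite ln_natXn ?muln_gt0 ?K0 // natrM lnM ?posrE ?ltr0n // => h.
  apply: (le_trans h); rewrite ler_wpM2l ?ler0n // lerD2r.
  by rewrite -[1 in leRHS]expRK ler_ln ?posrE ?expR_gt0.
have lsq : ls <= 3 * lq.
  by rewrite -[3]/(3%:R) -ln_natXn // ler_ln_nat // expn_gt0 T0.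
(* From [s <= q ^ 3] and [q <= (2 * K) ^ c]: the saving [s ^ eta] costs only a small power of [K],
   to be paid by the gains below. *)
have etals : eta * ls <= 3 / 100 * (1 + lk).
  apply: (@le_trans _ _ (eta * (3 * (c%:R * (1 + lk))))).
    by rewrite ler_wpM2l ?(ltW eta0) //; apply: (le_trans lsq); rewrite ler_wpM2l.
  have ec : eta * c%:R = 100^-1 by rewrite /eta invfM -mulrA mulVf ?mulr1 ?gt_eqF.
  have -> : eta * (3 * (c%:R * (1 + lk))) = 3 * (eta * c%:R) * (1 + lk) by ring.
  by rewrite ec.
have sle : s%:R <= expR ((13 / 9 - eta) * ls).
  rewrite sE ler_expR -[leLHS]mul1r ler_wpM2r //.
  have : eta <= 100^-1.
    by rewrite /eta invfM ler_piMr ?invr_ge0 // invf_le1 // ler1n.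
  lra.
suff SX : \sum_t X t <= 2 * expR (1 + 1 + (13 / 9 - eta) * ls).
  have e4 : expR 4 = expR 1 * expR 1 * (expR 1 * expR 1) :> R.
    by rewrite -!expRD; congr expR; lra.
  have ee : 4 <= expR 1 * expR 1 :> R by nra.
  rewrite -[(13 / 9 - _) * _]/((13 / 9 - eta) * ls).
  move: sle SX; rewrite e4 expRD (expRD 1 1).
  have := expR_gt0 ((13 / 9 - eta) * ls).
  move: (expR _) (expR _) ee (\sum_t X t) => z w ee S z0 sz SX.
  have h : 1 + 2 * (w * w) <= w * w * (w * w) by nra.
  have := ler_wpM2r (ltW z0) h; lra.
(* Below [q ^ (9/5) / K ^ (1/2)] the trivial bound [s ^ 2 / q] already saves a power of [K]. *)
have [short|long] := lerP ls (9 / 5 * lq - lk / 2).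
  have : (\sum_t X t) * #|T|%:R <= s%:R * s%:R.
    rewrite big_distrl /= {2}sN natr_sum big_distrr /=.
    by apply: ler_sum => t _; apply: X1.
  rewrite -ler_pdivlMr ?ltr0n // => h; apply: (le_trans h).
  rewrite sE qE -expRN -!expRD.
  apply: (@le_trans _ _ (expR (1 + 1 + (13 / 9 - eta) * ls))).
    by rewrite ler_expR; lra.
  by rewrite ler_peMl ?expR_ge0 //; lra.
pose g' : R := if ls <= 9 / 5 * lq + lk / 2 then lk / 8 else 0.
have key t : X t <= expR (1 + 3 / 4 * ls - lq / 4 - g' - 3 / 8 * (ls - lq)) * (N t)%:R +
       expR (1 + 3 / 4 * ls - lq / 4 - g' + 5 / 8 * (ls - lq)).
  have [Nt0|Nt0] := posnP (N t).
    have -> : X t = 0.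
      apply/eqP; rewrite eq_le X0 andbT -(ler_pM2r (_ : 0 < #|T|%:R)) ?ltr0n //.
      by apply: (le_trans (X1 t)); rewrite Nt0 mulr0 mul0r.
    by rewrite addr_ge0 ?mulr_ge0 ?expR_ge0 ?ler0n.
  pose lN : R := ln (N t)%:R.
  have NE : ((N t)%:R : R) = expR lN := natr_expR R Nt0.
  have X8 : X t ^+ 8 * #|T|%:R ^+ 2 <= s%:R ^+ 6 * (Lam t ^ 2)%N%:R.
    rewrite (exprM _ 4 2) -exprMn (exprM _ 3 2) natrX -exprMn.
    by rewrite ler_sqr ?nnegrE ?mulr_ge0 ?exprn_ge0 ?ler0n.
  have six : 6 <= expR 8 :> R.
    have -> : expR 8 = expR 1 ^+ 8 :> R by rewrite -expRM_natl mulr1.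
    apply: (@le_trans _ _ (2 ^+ 8)); last by rewrite lerXn2r ?nnegrE ?expR_ge0.
    by rewrite -natrX ler_nat.
  have N5 : (6 * N t ^ 5)%N%:R <= expR (8 + 5 * lN) :> R.
    rewrite natrM natrX NE expRD (expRM_natl 5) ler_wpM2r ?exprn_ge0 ?expR_ge0 //.
  have bnd g : (Lam t ^ 2)%N%:R <= expR (8 + 5 * lN - 8 * g) ->
      X t ^+ 8 <= expR (8 * (1 + 3 / 4 * ls - lq / 4 + 5 / 8 * lN - g)).
    move=> hL; have q2 : 0 < #|T|%:R ^+ 2 :> R by rewrite exprn_gt0 ?ltr0n.
    rewrite -(ler_pM2r q2); apply: (le_trans X8).
    apply: le_trans (ler_wpM2l _ hL) _; first by rewrite exprn_ge0 ?ler0n.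
    rewrite sE qE -!expRM_natl -!expRD ler_expR; lra.
  rewrite NE.
  have Lt0 : (Lam t ^ 2)%N%:R <= expR (8 + 5 * lN - 8 * 0) :> R.
    by rewrite mulr0 subr0; apply: le_trans N5; rewrite ler_nat.
  have abs0 := normr_ge0 (lN - (ls - lq)).
  rewrite /g'; case: ifPn => [mid|_]; last first.
    by apply: (slice_pointwise (X0 t) (bnd 0 Lt0)); lra.
  (* A slice far from [q ^ (4/5)] differs from the average [s / q] by a factor of at least
     [K ^ (1/2)]. The decay in [slice_pointwise] then saves [K ^ (3/16)], more than the required
     [K ^ (1/8)]. *)
  have [near|far] := lerP `|lN - 4 / 5 * lq| lk; last first.
    apply: (slice_pointwise (X0 t) (bnd 0 Lt0)).
    have : `|lN - 4 / 5 * lq| <= `|lN - (ls - lq)| + lk / 2.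
      have -> : lN - 4 / 5 * lq = (lN - (ls - lq)) + (ls - 9 / 5 * lq) by lra.
      apply: le_trans (ler_normD _ _) _; rewrite lerD2l ler_norml; lra.
    lra.
  rewrite ler_norml in near.
  have Lt1 : (Lam t ^ 2)%N%:R <= expR (8 + 5 * lN - 8 * (lk / 8)) :> R.
    have -> : 8 + 5 * lN - 8 * (lk / 8) = (8 + 5 * lN) - lk by lra.
    rewrite expRB ler_pdivlMr ?expR_gt0 // -(natr_expR R K0).
    apply: le_trans N5; rewrite -natrM ler_nat mulnC; apply: LK.
      rewrite -(ler_ln_nat R) ?muln_gt0 ?expn_gt0 ?K0 ?Nt0 ?T0 //.
      rewrite natrM lnM ?posrE ?ltr0n ?expn_gt0 ?K0 ?T0 //.
      rewrite !ln_natXn // -/lq -/lk -/lN; lra.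
    rewrite -(ler_ln_nat R) ?muln_gt0 ?expn_gt0 ?K0 ?Nt0 ?T0 //.
    rewrite natrM lnM ?posrE ?ltr0n ?expn_gt0 ?K0 ?Nt0 //.
    rewrite !ln_natXn // -/lq -/lk -/lN; lra.
  by apply: (slice_pointwise (X0 t) (bnd _ Lt1)); lra.
apply: le_trans (ler_sum _ (fun t _ => key t)) _.
rewrite big_split /= -big_distrr /= -natr_sum -sN sumr_const.
rewrite -[X in _ + X <= _]mulr_natl sE qE -!expRD.
have gle : (11 / 8) * ls + lq / 8 - g' <= 1 + (13 / 9 - eta) * ls.
  by rewrite /g'; case: (lerP ls) => mid; lra.
by rewrite [leRHS]mulr_natl mulr2n lerD // ler_expR; lra.
Qed.

Local Notation nc := Normc.normc.

(** [K + 1] is the least integer whose [c]-th power reaches [q], and [K + 1 <= 2 * K]. *)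
Lemma exists_scale q c : (0 < c)%N -> (1 < q)%N ->
  exists K, [/\ (0 < K)%N, K = 1%N \/ (K ^ c < q)%N & (q <= (2 * K) ^ c)%N].
Proof.
move=> c0 q1; have ex : exists m, (q <= m ^ c)%N.
  by exists q; rewrite -[X in (X <= _)%N]expn1 leq_pexp2l // ltnW.
have m_min := ex_minnP ex; case: m_min => m qm m_min.
case: m qm m_min => [|[|m]] qm m_min.
- by move: qm; rewrite exp0n // leqn0 => /eqP q0; rewrite q0 in q1.
- by move: qm; rewrite exp1n leqNgt q1.
exists m.+1; split=> //.
  by right; rewrite ltnNge; apply/negP => /m_min; rewrite ltnn.
by apply: (leq_trans qm); rewrite leq_exp2r // mul2n -addnn addnS ltnS leq_addr.
Qed.

Section ComplexNorm.
Variable R : rcfType.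
Implicit Types z : R[i].

Lemma norm_normc z : `|z| = (nc z)%:C.
Proof. by case: z. Qed.

Lemma normc_ge0 z : 0 <= nc z.
Proof. by case: z => a b; apply: sqrtr_ge0. Qed.

Lemma normc_real (a : R) : 0 <= a -> nc a%:C = a.
Proof. by move=> a0; rewrite /= expr0n addr0 sqrtr_sqr ger0_norm. Qed.

Lemma normc_sum_le (T : finType) (P : pred T) (F : T -> R[i]) :
  nc (\sum_(i | P i) F i) <= \sum_(i | P i) nc (F i).
Proof.
rewrite -lecR rmorph_sum /= -norm_normc.
rewrite [X in _ <= X](eq_bigr (fun i => `|F i|)) => [|i _].
  exact: ler_norm_sum.
by rewrite norm_normc.
Qed.

Lemma natr_complex n : (n%:R : R[i]) = (n%:R : R)%:C.
Proof. by rewrite rmorph_nat. Qed.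

End ComplexNorm.

Lemma cauchy_schwarz_sum (R : realFieldType) (T : finType) (a b : T -> R) :
  (\sum_i a i * b i) ^+ 2 <= (\sum_i a i ^+ 2) * \sum_i b i ^+ 2.
Proof.
rewrite -subr_ge0 -(pmulr_rge0 _ (_ : 0 < 2%:R)) ?ltr0n //.
have -> : 2%:R * ((\sum_i a i ^+ 2) * (\sum_i b i ^+ 2) - (\sum_i a i * b i) ^+ 2) =
    \sum_i \sum_j (a i * b j - a j * b i) ^+ 2.
  have h : \sum_i \sum_j (a i * b j - a j * b i) ^+ 2 =
      \sum_i \sum_j (a i ^+ 2 * b j ^+ 2) + \sum_i \sum_j (a j ^+ 2 * b i ^+ 2)
      - 2%:R * \sum_i \sum_j (a i * b i) * (a j * b j).
    rewrite -big_split big_distrr -sumrB /=; apply: eq_bigr => i _.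
    rewrite -big_split big_distrr -sumrB /=; apply: eq_bigr => j _; ring.
  rewrite h [X in _ + X - _]exchange_big /= -big_distrlr -big_distrlr /= expr2.
  ring.
by apply: sumr_ge0 => i _; apply: sumr_ge0 => j _; apply: sqr_ge0.
Qed.

Lemma restriction_estimate (R : realType) : exists c : nat, (0 < c)%N /\
  forall (F : finFieldType) (e : F -> R[i]) (E : {set F * F * F}) (f : F * F * F -> R[i]),
  nonprincipal_character e -> (forall t : F, t ^+ 2 != -1) ->
  {in E, forall p, nc (f p) <= 1} -> (0 < #|E|)%N ->
  \sum_w nc (fourier_paraboloid e E f w) ^+ 2 <=
    #|F|%:R ^+ 2 * (expR 4 * expR ((13 / 9 - (100 * c%:R)^-1) * ln #|E|%:R)).
Proof.
have [c Hc] := energy_gain.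
exists c.+1; split=> // F e E f [[e1 eD] [a0 /eqP ea0]] ns f1 E0.
have q1 : (1 < #|F|)%N by apply/card_gt1P; exists 0, 1; rewrite !inE eq_sym oner_eq0.
have q0R : 0 < #|F|%:R :> R by rewrite ltr0n ltnW.
have two0 := two_neq0 ns.
have f1' : {in E, forall p, `|f p| <= 1}.
  by move=> p pE; rewrite norm_normc -[1]/(1%:C) lecR f1.
have [K [K0 Kq qK]] := exists_scale (ltn0Sn c) q1.
pose W t := nc (slice_weight e E f t).
have WE t : slice_weight e E f t = (W t)%:C.
  by rewrite -norm_normc ger0_norm // slice_weight_ge0.
have main := @slice_weights_bound R F (fun t => #|slice E t|)
  (fun t => paraboloid_energy (slice E t)) (fun t => W t / #|F|%:R) #|E| K c.+1
  (ltn0Sn c) q1 E0 (card_slices E).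
have {}main : #|E|%:R + \sum_t W t / #|F|%:R <=
    expR 4 * expR ((13 / 9 - (100 * c.+1%:R)^-1) * ln #|E|%:R).
  apply: main => //.
  - apply: leq_trans (max_card _) _.
    by rewrite !card_prod !expnS expn0 muln1 mulnA.
  - by move=> t; apply: energy_le.
  - move=> t h1 h2; have [->|Kc] := Kq; first by rewrite mul1n energy_le.
    have [K1|K1] := leqP K 1.
      have -> : K = 1%N by apply/eqP; rewrite eqn_leq K1.
      by rewrite mul1n energy_le.
    apply: Hc => //; apply: leq_ltn_trans Kc; rewrite leq_pexp2l //.
  - by move=> t; rewrite divr_ge0 ?normc_ge0 ?ler0n.
  - move=> t; rewrite divfK ?gt_eqF // -lecR -WE rmorphM /= -!natr_complex.
    exact: slice_weight_le.
  - move=> t; have h : W t ^+ 4 <=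
        #|E|%:R ^+ 3 * (#|F|%:R ^+ 3 * (paraboloid_energy (slice E t))%:R).
      rewrite -lecR rmorphXn /= -WE (rmorphM (real_complex R) (#|E|%:R ^+ 3)).
      rewrite (rmorphM (real_complex R) (#|F|%:R ^+ 3)) !rmorphXn /= -!natr_complex.
      exact (slice_weight_pow4_le e1 eD ea0 two0 f1' t).
    have -> : (W t / #|F|%:R) ^+ 4 * #|F|%:R = W t ^+ 4 / #|F|%:R ^+ 3.
      by field; rewrite gt_eqF.
    rewrite ler_pdivrMr ?exprn_gt0 //; apply: (le_trans h).
    by rewrite (mulrC (#|F|%:R ^+ 3)) mulrA.
apply: le_trans (ler_wpM2l _ main); last by rewrite exprn_ge0 ?ler0n.
have -> : #|F|%:R ^+ 2 * (#|E|%:R + \sum_t W t / #|F|%:R) =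
    #|F|%:R ^+ 2 * #|E|%:R + #|F|%:R * \sum_t W t.
  rewrite -big_distrl /= mulrDr; congr (_ + _).
  by field; rewrite gt_eqF.
rewrite -lecR rmorph_sum rmorphD (rmorphM (real_complex R) (#|F|%:R ^+ 2)).
rewrite (rmorphM (real_complex R) #|F|%:R (\sum_t W t)) /= rmorphXn !rmorph_sum /= -!natr_complex.
rewrite (eq_bigr (fun w => `|fourier_paraboloid e E f w| ^+ 2)) => [|w _]; last first.
  by rewrite rmorphXn /= -norm_normc.
rewrite [X in _ <= _ + _ * X](eq_bigr (fun t => slice_weight e E f t)) => [|t _]; last first.
  by rewrite WE.
exact (sum_norm_fourier_paraboloid_le e1 eD ea0 two0 f1').
Qed.

(** * Duality and the passage from weak to strong type *)

Definition paraboloid_extension (R : rcfType) (F : finFieldType) (e : F -> R[i])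
    (g : F * F -> R[i]) (p : F * F * F) : R[i] :=
  (#|F|%:R ^- 2) * \sum_w g w * e (dot3 p (w, pdot w w)).

Definition paraboloid_norm (R : rcfType) (F : finFieldType) (g : F * F -> R[i]) : R :=
  Num.sqrt (#|F|%:R ^- 2 * \sum_w nc (g w) ^+ 2).

Lemma extension_weak_type (R : realType) : exists c : nat, (0 < c)%N /\
  forall (F : finFieldType) (e : F -> R[i]) (g : F * F -> R[i]) (E : {set F * F * F}),
  nonprincipal_character e -> (forall t : F, t ^+ 2 != -1) -> (0 < #|E|)%N ->
  \sum_(p in E) nc (paraboloid_extension e g p) <=
    paraboloid_norm g * expR 2 *
      expR ((13 / 9 - (100 * c%:R)^-1) / 2 * ln #|E|%:R).
Proof.
have [c [c0 Hc]] := restriction_estimate R.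
exists c; split=> // F e g E he ns E0.
have q0R : 0 < #|F|%:R :> R by rewrite ltr0n; apply/card_gt0P; exists 0.
set th := 13 / 9 - (100 * c%:R)^-1.
pose Ext p := \sum_w g w * e (dot3 p (w, pdot w w)).
(* The conjugate phase of [Ext p], equal to 0 where [Ext p] vanishes. Pairing with it turns the sum
   of moduli into a pairing of [g] with the Fourier transform of [f] on [E]; Cauchy-Schwarz then
   halves the exponent of [restriction_estimate]. *)
pose f p := (nc (Ext p))%:C / Ext p.
have f1 : {in E, forall p, nc (f p) <= 1}.
  move=> p _; rewrite /f Normc.normcM Normc.normcV normc_real ?normc_ge0 //.
  have [->|n0] := eqVneq (nc (Ext p)) 0; first by rewrite mul0r.
  by rewrite divff.
have fE p : f p * Ext p = (nc (Ext p))%:C.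
  have [z|n0] := eqVneq (Ext p) 0; last by rewrite /f divfK.
  by rewrite z mulr0 Normc.normc0.
have sumE : \sum_(p in E) nc (Ext p) <=
    \sum_w nc (g w) * nc (fourier_paraboloid e E f w).
  apply: (@le_trans _ _ (nc (\sum_w g w * fourier_paraboloid e E f w))); last first.
    apply: le_trans (normc_sum_le _ _) _.
    by under eq_bigr do rewrite Normc.normcM.
  have -> : \sum_w g w * fourier_paraboloid e E f w = (\sum_(p in E) nc (Ext p))%:C.
    rewrite rmorph_sum /=; under [RHS]eq_bigr do rewrite -fE /Ext big_distrr /=.
    rewrite exchange_big /=; apply: eq_bigr => w _.
    by rewrite big_distrr /=; apply: eq_bigr => p _; rewrite mulrCA.
  by rewrite normc_real // sumr_ge0 // => p _; apply: normc_ge0.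
have G0 : 0 <= \sum_w nc (g w) ^+ 2 by apply: sumr_ge0 => w _; apply: sqr_ge0.
rewrite -ler_sqr ?nnegrE; last 2 first.
- by apply: sumr_ge0 => p _; apply: normc_ge0.
- by rewrite !mulr_ge0 ?expR_ge0 ?sqrtr_ge0.
have -> : \sum_(p in E) nc (paraboloid_extension e g p) =
    #|F|%:R ^- 2 * \sum_(p in E) nc (Ext p).
  rewrite big_distrr /=; apply: eq_bigr => p _.
  have -> : paraboloid_extension e g p = (#|F|%:R ^- 2)%:C * Ext p.
    by rewrite /paraboloid_extension natr_complex -rmorphXn -fmorphV.
  by rewrite Normc.normcM normc_real // invr_ge0 exprn_ge0 // ltW.
rewrite exprMn.
apply: (@le_trans _ _ ((#|F|%:R ^- 2) ^+ 2 * ((\sum_w nc (g w) ^+ 2) *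
    (#|F|%:R ^+ 2 * (expR 4 * expR (th * ln #|E|%:R)))))).
  rewrite ler_wpM2l ?sqr_ge0 //.
  apply: (@le_trans _ _ ((\sum_w nc (g w) * nc (fourier_paraboloid e E f w)) ^+ 2)).
    rewrite ler_sqr ?nnegrE ?sumE // ?sumr_ge0 // => p _; rewrite ?normc_ge0 //.
    by rewrite mulr_ge0 ?normc_ge0.
  apply: le_trans (cauchy_schwarz_sum _ _) _; rewrite ler_wpM2l //.
  exact: Hc.
rewrite !exprMn /paraboloid_norm sqr_sqrtr; last first.
  by rewrite mulr_ge0 // invr_ge0 exprn_ge0 // ltW.
rewrite -[expR 2 ^+ 2]expRM_natl -[expR (th / 2 * _) ^+ 2]expRM_natl.
have -> : 2%:R * 2 = 4 :> R by ring.
have -> : 2%:R * (th / 2 * ln #|E|%:R) = th * ln #|E|%:R.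
  by rewrite mulrA mulrCA divff ?mulr1 // pnatr_eq0.
rewrite le_eqVlt; apply/orP; left; apply/eqP.
by field; rewrite gt_eqF.
Qed.

Lemma geometric_sum_le (R : realFieldType) (r : R) J : 0 <= r < 1 ->
  \sum_(j < J) r ^+ j <= (1 - r)^-1.
Proof.
move=> /andP[r0 r1]; have d0 : 0 < 1 - r by rewrite subr_gt0.
rewrite -[leRHS]mul1r ler_pdivlMr //.
have -> : (\sum_(j < J) r ^+ j) * (1 - r) = 1 - r ^+ J.
  by rewrite -[RHS]opprB subrX1 -mulNr opprB mulrC.
by rewrite gerBl exprn_ge0.
Qed.

(** Tested on the level set where [h] is between [expR (- j.+1%:R)] and [expR (- j%:R)], the
    hypothesis bounds its size by [expR (rho * j.+1%:R)]. As [rho < r], the levels sum to a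
    geometric series, with [M] depending on the exponents only. *)
Lemma weak_to_strong (R : realType) (th r : R) : 0 <= th < 1 -> (1 - th)^-1 < r ->
  exists M : R, 0 < M /\ forall (T : finType) (h : T -> R), (forall x, 0 <= h x) ->
    (forall E : {set T}, (0 < #|E|)%N -> \sum_(x in E) h x <= expR (th * ln #|E|%:R)) ->
    \sum_x h x `^ r <= M.
Proof.
move=> /andP[th0 th1] hr.
have d0 : 0 < 1 - th by rewrite subr_gt0.
pose rho := (1 - th)^-1; have rho0 : 0 < rho by rewrite invr_gt0.
have r0 : 0 < r by apply: lt_trans hr.
have ratio : 0 <= expR (rho - r) < 1 by rewrite expR_ge0 expR_lt1 subr_lt0.
have M0 : 0 < expR rho * (1 - expR (rho - r))^-1.
  by rewrite mulr_gt0 ?expR_gt0 // invr_gt0 subr_gt0; case/andP: ratio.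
exists (expR rho * (1 - expR (rho - r))^-1); split=> // T h h0 hE.
have h1 x : h x <= 1.
  have := hE [set x]%SET; rewrite cards1 big_set1 ln1 mulr0 expR0; exact.
pose lev x := Num.truncn (- ln (h x)).
have levP x : 0 < h x -> (lev x)%:R <= - ln (h x) < (lev x).+1%:R.
  by move=> hx; apply: Num.Theory.truncn_itv; rewrite oppr_ge0 ln_le0.
pose J := (\max_x lev x).+1.
pose Ej (j : nat) := [set x | (0 < h x) && (lev x == j)]%SET.
have EjJ x : (lev x < J)%N by rewrite ltnS; apply: leq_bigmax.
have cardE j : #|Ej j|%:R <= expR (rho * j.+1%:R).
  have [->|E0] := posnP #|Ej j|; first by rewrite expR_ge0.
  rewrite (natr_expR R E0) ler_expR.
  set l := ln _; suff hl : (1 - th) * l <= j.+1%:R.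
    by rewrite mulrC ler_pdivlMr // mulrC.
  have low : #|Ej j|%:R * expR (- j.+1%:R) <= \sum_(x in Ej j) h x.
    rewrite mulr_natl -sumr_const; apply: ler_sum => x; rewrite inE => /andP[hx /eqP lx].
    rewrite -[leRHS](lnK (_ : h x \in Num.pos)) ?posrE // ler_expR lerNl.
    by have /andP[_ /ltW] := levP x hx; rewrite lx.
  have := le_trans low (hE _ E0); rewrite {1}(natr_expR R E0) -/l -expRD ler_expR.
  lra.
have split_sum : \sum_x h x `^ r = \sum_(j < J) \sum_(x in Ej j) h x `^ r.
  rewrite (bigID (fun x => 0 < h x)) /= [X in _ + X]big1 ?addr0; last first.
    move=> x; rewrite -leNgt => hx; have -> : h x = 0 by apply/eqP; rewrite eq_le hx h0.
    by rewrite powR0 // gt_eqF.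
  rewrite (partition_big (fun x => Ordinal (EjJ x)) predT) //=.
  by apply: eq_bigr => j _; apply: eq_bigl => x; rewrite inE -val_eqE.
rewrite split_sum.
apply: (@le_trans _ _ (\sum_(j < J) expR rho * expR (rho - r) ^+ j)); last first.
  by rewrite -big_distrr /= ler_wpM2l ?expR_ge0 // geometric_sum_le.
apply: ler_sum => j _.
apply: (@le_trans _ _ (\sum_(x in Ej j) expR (- (r * j%:R)))).
  apply: ler_sum => x; rewrite inE => /andP[hx /eqP lx].
  rewrite /powR gt_eqF // ler_expR -mulrN ler_wpM2l ?(ltW r0) // lerNr -lx.
  by have /andP[] := levP x hx.
rewrite sumr_const -[leLHS]mulr_natl.
apply: le_trans (ler_wpM2r (expR_ge0 _) (cardE j)) _.
rewrite -expRM_natl -!expRD ler_expR -natr1; lra.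
Qed.

Lemma extension_strong_type (R : realType) : exists delta C : R,
  [/\ 0 < delta, 1 <= 18 / 5 - delta, 0 <= C &
  forall (F : finFieldType) (e : F -> R[i]) (g : F * F -> R[i]),
  nonprincipal_character e -> (forall t : F, t ^+ 2 != -1) ->
  (\sum_p nc (paraboloid_extension e g p) `^ (18 / 5 - delta)) `^ (18 / 5 - delta)^-1
    <= C * paraboloid_norm g].
Proof.
have [c [c0 Hc]] := extension_weak_type R.
pose eta : R := (100 * c%:R)^-1.
have eta0 : 0 < eta by rewrite invr_gt0 mulr_gt0 ?ltr0n.
have eta1 : eta <= 100^-1.
  by rewrite /eta invfM ler_piMr ?invr_ge0 ?ler0n // invf_le1 ?ltr0n // ler1n.
pose th : R := (13 / 9 - eta) / 2.
have th01 : 0 <= th < 1 by rewrite /th; lra.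
pose rho : R := (1 - th)^-1.
have d0 : 0 < 1 - th by rewrite /th; lra.
have rho18 : rho < 18 / 5.
  by rewrite /rho -div1r ltr_pdivrMr // /th; lra.
have rho0 : 0 < rho by rewrite invr_gt0.
(* Half the gap: [th < 13 / 18] gives [rho < 18 / 5], and the strong bound needs an exponent
   strictly above [rho]. *)
pose delta : R := (18 / 5 - rho) / 2.
have delta0 : 0 < delta by rewrite /delta; lra.
have r1 : 1 <= 18 / 5 - delta by rewrite /delta; lra.
have hr : (1 - th)^-1 < 18 / 5 - delta by rewrite -/rho /delta; lra.
have [M [M0 HM]] := weak_to_strong th01 hr.
set r := 18 / 5 - delta in r1 hr HM *.
have r0 : 0 < r by apply: lt_le_trans r1.
exists delta, (expR 2 * M `^ r^-1); split=> //.
  by rewrite mulr_ge0 ?expR_ge0 ?powR_ge0.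
move=> F e g he ns.
set G := paraboloid_norm g.
have G0 : 0 <= G by apply: sqrtr_ge0.
pose ext p := nc (paraboloid_extension e g p).
have ext0 p : 0 <= ext p by apply: normc_ge0.
have weak (E : {set F * F * F}) : (0 < #|E|)%N ->
    \sum_(p in E) ext p <= G * expR 2 * expR (th * ln #|E|%:R).
  by move=> E0; apply: Hc.
pose h p := ext p / (G * expR 2).
have extE p : ext p = G * expR 2 * h p.
  (* If [g] has norm zero, the weak bound on singletons makes the extension vanish, so the division
     by zero in [h] is harmless. *)
  rewrite /h; have [z|nz] := eqVneq (G * expR 2) 0.
    have := weak [set p]%SET; rewrite cards1 big_set1 z !mul0r => /(_ isT) e0.
    by apply/eqP; rewrite eq_le e0 ext0.
  by rewrite mulrC divfK.
have D0 : 0 <= G * expR 2 by rewrite mulr_ge0 ?expR_ge0.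
have hM : \sum_p h p `^ r <= M.
  apply: HM => [p|E E0]; first by rewrite divr_ge0.
  rewrite -big_distrl /=; have [z|nz] := eqVneq (G * expR 2) 0.
    by rewrite z invr0 mulr0 expR_ge0.
  rewrite ler_pdivrMr; last by rewrite lt_def nz.
  by rewrite mulrC; apply: weak.
have -> : \sum_p nc (paraboloid_extension e g p) `^ r = (G * expR 2) `^ r * \sum_p h p `^ r.
  rewrite big_distrr /=; apply: eq_bigr => p _.
  by rewrite -/(ext p) extE powRM // divr_ge0.
have Sh0 : 0 <= \sum_p h p `^ r by apply: sumr_ge0 => p _; apply: powR_ge0.
rewrite powRM ?powR_ge0 // -powRrM divff ?gt_eqF // powRr1 //.
rewrite -/r (mulrC G) -!mulrA ler_wpM2l ?expR_ge0 // [leLHS]mulrC ler_wpM2r //.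
by apply: ge0_ler_powR; rewrite ?nnegrE ?invr_ge0 ?(ltW r0) ?(ltW M0).
Qed.

(** * From triples of scalars to row vectors *)

Section Coordinates.
Variable F : finFieldType.

Definition plane_row (w : F * F) : 'rV[F]_2 :=
  \row_j (if j == 0 then w.1 else w.2).

Definition paraboloid_point (w : F * F) : 'rV[F]_(2 + 1) :=
  row_mx (plane_row w) (dot (plane_row w) (plane_row w))%:M.

Definition space_row (p : F * F * F) : 'rV[F]_(2 + 1) :=
  row_mx (plane_row p.1) (p.2)%:M.

Lemma plane_row_bij : bijective plane_row.
Proof.
exists (fun v : 'rV[F]_2 => (v 0 0, v 0 1)) => [[a b]|v]; first by rewrite !mxE.
apply/rowP => j; rewrite mxE /=; case: (eqVneq j 0) => [->//|j0].
congr (v 0 _); apply/val_inj; case: j j0 => [[|[|j]] hj] //.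
Qed.

Lemma space_row_bij : bijective space_row.
Proof.
pose g (v : 'rV[F]_(2 + 1)) := ((v 0 (lshift 1 0), v 0 (lshift 1 1)), v 0 (rshift 2 0)).
have gK : cancel space_row g.
  by move=> [[a b] c]; rewrite /g /space_row !row_mxEl row_mxEr !mxE /= mulr1n.
exists g => // v; rewrite /space_row -[RHS]hsubmxK; congr row_mx.
  apply/rowP => j; rewrite !mxE /=; case: (eqVneq j 0) => [->//|j0].
  congr (v 0 _); apply/val_inj; case: j j0 => [[|[|j]] hj] //.
by apply/rowP => j; rewrite !mxE ord1 eqxx mulr1n.
Qed.

Lemma dot_plane_row w w' : dot (plane_row w) (plane_row w') = pdot w w'.
Proof. by rewrite /dot !big_ord_recl big_ord0 !mxE /= addr0. Qed.

Lemma dot_space_row p w :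
  dot (space_row p) (paraboloid_point w) = dot3 p (w, pdot w w).
Proof.
rewrite /dot big_split_ord /= big_ord1 /dot3 /=; congr (_ + _).
  by rewrite -dot_plane_row; apply: eq_bigr => j _; rewrite !row_mxEl.
by rewrite !row_mxEr !mxE dot_plane_row !mulr1n.
Qed.

Lemma sum_paraboloid (V : nmodType) (G : 'rV[F]_(2 + 1) -> V) :
  \sum_(xi in paraboloid F 2) G xi = \sum_w G (paraboloid_point w).
Proof.
rewrite big_imset /=; last first.
  by move=> u v _ _ /eq_row_mx[].
have [h hK Kh] := plane_row_bij.
by rewrite (reindex plane_row) //; exists h => w _; rewrite ?hK ?Kh.
Qed.

Lemma card_paraboloid : #|paraboloid F 2| = (#|F| ^ 2)%N.
Proof.
rewrite card_imset; last by move=> u v /eq_row_mx[].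
by rewrite card_mx mul1n.
Qed.

End Coordinates.

Theorem theorem1 (R : realType) :
  exists delta C : R,
    0 < delta /\ 1 <= 18 / 5 - delta /\
    forall (F : finFieldType) (e : F -> R[i]),
      nonprincipal_character e ->
      ~ (exists a : F, a ^+ 2 = -1) ->
      (extension_constant e (paraboloid F 2) 2%:E (18 / 5 - delta)%:E
         <= C%:E)%E.
Proof.
have [delta [C [delta0 r1 C0 H]]] := extension_strong_type R.
exists delta, C; split=> //; split=> // F e he ns.
have {}ns (t : F) : t ^+ 2 != -1 by apply/eqP => h; apply: ns; exists t.
apply: ereal_inf_lbound; exists C => // g.
have := H F e (fun w => g (paraboloid_point w)) he ns.
have -> : paraboloid_norm (fun w => g (paraboloid_point w)) =
    Lp_norm_on (paraboloid F 2) 2%:E g.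
  rewrite /Lp_norm_on /wnorm powR12_sqrt; last first.
    rewrite mulr_ge0 ?invr_ge0 ?ler0n // sumr_ge0 // => xi _; exact: powR_ge0.
  rewrite /paraboloid_norm card_paraboloid natrX sum_paraboloid.
  congr (Num.sqrt (_ * _)); apply: eq_bigr => w _.
  by rewrite powR_mulrn // normc_ge0.
congr (_ <= _); rewrite /Lq_norm /wnorm mul1r; congr (_ `^ _).
have [h hK Kh] := space_row_bij F.
rewrite [RHS](reindex (@space_row F)) /=; last by exists h => p _; rewrite ?hK ?Kh.
apply: eq_big => [p|p _]; first by rewrite finset.in_setT.
congr (Normc.normc _ `^ _); rewrite /paraboloid_extension /extension.
rewrite card_paraboloid natrX sum_paraboloid; congr (_ * _).
by apply: eq_bigr => w _; rewrite dot_space_row.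
Qed.
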